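(* Let $I_1,\ldots,I_r$ be monomial ideals of $R=\Bbbk[x_1,\ldots,x_n]$. Let $F_i$ be a (multigraded) free DG $\Gamma$-algebra resolution of $R/I_i$ for all $i=1,\ldots,r$. Then the generalized Taylor resolution $F_1*\cdots*F_r$, with the product given in the context, is a DG $\Gamma$-algebra whose divided power structure is given, on elements $f_1*\cdots*f_r$ of positive and even homological degree (with $f_i\in F_i$ bigraded) and for $k\geq 2$, by $$(f_1*\cdots*f_r)^{(k)}=\begin{cases}0 & \text{if there is an } l \text{ such that } |f_l| \text{ is odd},\\ f_1^k*\cdots*f_{j-1}^k*f_j^{(k)}*f_{j+1}^k*\cdots*f_r^k & \text{if } |f_l| \text{ is even for all } l \text{ and } j \text{ is smallest such that } |f_j|>0,\end{cases}$$ where the divided powers of linear combinations of such elements are computed using the axioms defining divided power algebras. Moreover, this is the unique DG $\Gamma$-algebra structure on the DG algebra $F_1*\cdots*F_r$ for which the inclusion maps $F_i\to F_1*\cdots*F_r$, $f_i\mapsto 1*\cdots*1*f_i*1*\cdots*1$ (with $f_i$ in position $i$), are maps of DG $\Gamma$-algebras for all $i=1,\ldots,r$.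
   Context: Conventions. $\Bbbk$ is a field and $R=\Bbbk[x_1,\ldots,x_n]$ is $\mathbb{Z}^n$-graded with $\deg x_i$ the $i$-th standard basis vector. All complexes over $R$ are bigraded: $|x|$ is the homological degree of $x$, and the internal (multi)degree of $x$ is denoted by the unique monomial $m_x=\deg x$ of $R$ with the same $\mathbb{Z}^n$-degree. ''Bigraded'' (bihomogeneous) elements are homogeneous for both gradings. Brackets $[\ldots]$ denote least common multiple. A term whose scalar coefficient in $\Bbbk$ is $0$ is read as $0$. DG algebra. A DG algebra over $R$ is a complex $A$ of finitely generated free $R$-modules with differential $\partial$ and a unitary associative multiplication respecting both gradings such that, for homogeneous $a,b$: $\partial(ab)=\partial(a)b+(-1)^{|a|}a\partial(b)$; $ab=(-1)^{|a||b|}ba$; and $a^2=0$ if $|a|$ is odd. DG $\Gamma$-algebra. A DG algebra $A$ is a DG $\Gamma$-algebra if to every bihomogeneous $x\in A$ of even positive homological degree there is associated a sequence $x^{(k)}\in A$, $k=0,1,2,\ldots$, satisfying: (1) $x^{(0)}=1$, $x^{(1)}=x$, $|x^{(k)}|=k|x|$, $\deg x^{(k)}=(\deg x)^k$; (2) $x^{(h)}x^{(k)}=\binom{h+k}{h}x^{(h+k)}$; (3) if $x,y$ have the same bidegree, $(x+y)^{(k)}=\sum_{i+j=k}x^{(i)}y^{(j)}$; (4) for $k\ge2$ and $x,y$ bihomogeneous, $(xy)^{(k)}=0$ if $|x|$ and $|y|$ are odd, and $(xy)^{(k)}=x^ky^{(k)}$ if $|x|$ is even and $|y|$ is even and positive;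 (5) $(x^{(h)})^{(k)}=\frac{(hk)!}{k!(h!)^k}x^{(hk)}$; (6) $\partial(x^{(k)})=x^{(k-1)}\partial(x)$ for $k\ge1$. A map of DG $\Gamma$-algebras is a map of DG algebras commuting with divided powers. Generalized Taylor resolution. Let $F_i$ be a multigraded free resolution of $R/I_i$ with bihomogeneous basis $a_{i,1},\ldots,a_{i,n_i}$. For a bigraded $f_i\in F_i$ write $\partial^{F_i}(f_i)=\sum_{j=1}^{n_i}\alpha_{i,j}\frac{m_{f_i}}{m_{a_{i,j}}}a_{i,j}$ with $\alpha_{i,j}\in\Bbbk$. As an $R$-module, $F_1*\cdots*F_r=F_1\otimes_R\cdots\otimes_R F_r$, with homological degree $|f_1|+\cdots+|f_r|$, and for basis elements the simple tensor $a_1\otimes\cdots\otimes a_r$ is written $a_1*\cdots*a_r$. The multidegree of $f_1*\cdots*f_r$ is $[m_{f_1},\ldots,m_{f_r}]$; accordingly, for bigraded elements $f_i=\sum_j c_{i,j}\frac{m_{f_i}}{m_{a_{i,j}}}a_{i,j}$ ($c_{i,j}\in\Bbbk$), the symbol $f_1*\cdots*f_r$ means $\sum_{j_1,\ldots,j_r}c_{1,j_1}\cdots c_{r,j_r}\frac{[m_{f_1},\ldots,m_{f_r}]}{[m_{a_{1,j_1}},\ldots,m_{a_{r,j_r}}]}a_{1,j_1}*\cdots*a_{r,j_r}$. The differential is $$\partial(f_1*\cdots*f_r)=\sum_{i=1}^r(-1)^{|f_1|+\cdots+|f_{i-1}|}\sum_{j=1}^{n_i}\alpha_{i,j}\frac{[m_{f_1},\ldots,m_{f_r}]}{[m_{f_1},\ldots,m_{f_{i-1}},m_{a_{i,j}},m_{f_{i+1}},\ldots,m_{f_r}]}f_1*\cdots*f_{i-1}*a_{i,j}*f_{i+1}*\cdots*f_r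 .$$ It is known (Herzog) that this is a multigraded free resolution of $R/(I_1+\cdots+I_r)$. Product. If the $F_i$ are DG algebras and, for bigraded $f,f'\in F_i$, $ff'=\sum_{j}\alpha_{i,j,f,f'}\frac{m_fm_{f'}}{m_{a_{i,j}}}a_{i,j}$ with $\alpha_{i,j,f,f'}\in\Bbbk$, then $F_1*\cdots*F_r$ is a DG algebra with product $$(f_1*\cdots*f_r)(f_1'*\cdots*f_r')=(-1)^{\sum_{i=1}^r|f_i'|\sum_{j=i+1}^r|f_j|}\sum_{j_1,\ldots,j_r}\alpha_{1,j_1,f_1,f_1'}\cdots\alpha_{r,j_r,f_r,f_r'}\frac{[m_{f_1},\ldots,m_{f_r}][m_{f_1'},\ldots,m_{f_r'}]}{[m_{a_{1,j_1}},\ldots,m_{a_{r,j_r}}]}a_{1,j_1}*\cdots*a_{r,j_r}.$$ In expressions such as $f_1^k*\cdots*f_j^{(k)}*\cdots*f_r^k$, the entries are regarded as having multidegrees $m_{f_1}^k,\ldots,m_{f_r}^k$. *)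

(* Defs.v *)
From mathcomp Require Import all_boot all_algebra.
From mathcomp Require Export freeg mpoly.

Set Implicit Arguments.
Unset Strict Implicit.
Unset Printing Implicit Defensive.

Import GRing.Theory.

Local Open Scope ring_scope.

(* Data of a multigraded complex of free modules over k[x_1..x_n], in
   nonnegative homological degrees, with a chosen bihomogeneous basis [gen],
   a multiplication and a unit.  The module is the free module on [gen]; the
   basis may be infinite in total, see [dg_finite] below.  Monomials
   m : 'X_{1..n} are written additively: m1 * m2, m1 / m2, m ^ k of the usual
   notation are (m1 + m2)%MM, (m1 - m2)%MM and (m *+ k)%MM. *)
Record dgData (k : fieldType) (n : nat) := DGData {
  gen : choiceType;
  hdeg : gen -> nat;
  multideg : gen -> 'X_{1..n};
  diff : {freeg gen / {mpoly k[n]}} -> {freeg gen / {mpoly k[n]}};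
  mul : {freeg gen / {mpoly k[n]}} -> {freeg gen / {mpoly k[n]}} ->
        {freeg gen / {mpoly k[n]}};
  one_elt : {freeg gen / {mpoly k[n]}}
}.

Section DGAlgebras.
Variables (k : fieldType) (n : nat).
Local Notation elem A := {freeg (gen A) / {mpoly k[n]}}.
Implicit Types (A B : dgData k n).

Definition is_homog A (d : nat) (x : elem A) : Prop :=
  forall a, coeff a x != 0 -> hdeg a = d.

(* |x| = d and deg x = m; the zero element is of every bidegree *)
Definition is_bihomog A (d : nat) (m : 'X_{1..n}) (x : elem A) : Prop :=
  forall a u, u \in msupp (coeff a x) ->
    hdeg a = d /\ (u + multideg a)%MM = m.

Definition dgexp A (x : elem A) (j : nat) : elem A :=
  iter j (mul x) (one_elt A).

Record is_dgAlgebra A : Prop := IsDGAlgebra {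
  dg_finite : forall d, exists s : seq (gen A), forall a, hdeg a = d -> a \in s;
  dg_diff_linear : linear (@diff _ _ A);
  dg_diff_bihomog : forall d m (x : elem A),
    is_bihomog d.+1 m x -> is_bihomog d m (diff x);
  dg_diff_bottom : forall x : elem A, is_homog 0 x -> diff x = 0;
  dg_diff_diff : forall x : elem A, diff (diff x) = 0;
  dg_mul_linearl : forall y : elem A, linear (fun x : elem A => mul x y);
  dg_mul_linearr : forall x : elem A, linear (fun y : elem A => mul x y);
  dg_mul_bihomog : forall d1 d2 m1 m2 (x y : elem A),
    is_bihomog d1 m1 x -> is_bihomog d2 m2 y ->
    is_bihomog (d1 + d2) (m1 + m2)%MM (mul x y);
  dg_one_bihomog : is_bihomog 0 0%MM (one_elt A);
  dg_mulA : associative (@mul _ _ A);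
  dg_mul1 : left_id (one_elt A) (@mul _ _ A);
  dg_mulr1 : right_id (one_elt A) (@mul _ _ A);
  dg_leibniz : forall d (x y : elem A), is_homog d x ->
    diff (mul x y) = mul (diff x) y + (-1) ^+ d *: mul x (diff y);
  dg_comm : forall d1 d2 (x y : elem A), is_homog d1 x -> is_homog d2 y ->
    mul x y = (-1) ^+ (d1 * d2) *: mul y x;
  dg_sqr0 : forall d (x : elem A), is_homog d x -> odd d -> mul x x = 0
}.

(* [g x j] is the divided power x^(j); it is only meaningful when x is
   bihomogeneous of positive even homological degree. *)
Record is_dgGamma A (g : elem A -> nat -> elem A) : Prop := IsDGGamma {
  gamma_dg : is_dgAlgebra A;
  gamma0 : forall d m (x : elem A), is_bihomog d m x -> (0 < d)%N -> ~~ odd d ->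
    g x 0%N = one_elt A;
  gamma1 : forall d m (x : elem A), is_bihomog d m x -> (0 < d)%N -> ~~ odd d ->
    g x 1%N = x;
  gamma_bihomog : forall d m (x : elem A) j,
    is_bihomog d m x -> (0 < d)%N -> ~~ odd d ->
    is_bihomog (j * d) (m *+ j)%MM (g x j);
  gamma_mul : forall d m (x : elem A) h j,
    is_bihomog d m x -> (0 < d)%N -> ~~ odd d ->
    mul (g x h) (g x j) = g x (h + j)%N *+ 'C(h + j, h);
  gamma_add : forall d m (x y : elem A) j,
    is_bihomog d m x -> is_bihomog d m y -> (0 < d)%N -> ~~ odd d ->
    g (x + y) j = \sum_(i < j.+1) mul (g x i) (g y (j - i)%N);
  gamma_odd : forall d1 d2 m1 m2 (x y : elem A) j,
    is_bihomog d1 m1 x -> is_bihomog d2 m2 y -> odd d1 -> odd d2 -> (2 <= j)%N ->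
    g (mul x y) j = 0;
  gamma_even : forall d1 d2 m1 m2 (x y : elem A) j,
    is_bihomog d1 m1 x -> is_bihomog d2 m2 y ->
    ~~ odd d1 -> (0 < d2)%N -> ~~ odd d2 -> (2 <= j)%N ->
    g (mul x y) j = mul (dgexp x j) (g y j);
  (* h >= 1, since x^(0) = 1 has no divided powers; the quotient is exact *)
  gamma_gamma : forall d m (x : elem A) h j,
    is_bihomog d m x -> (0 < d)%N -> ~~ odd d -> (0 < h)%N ->
    g (g x h) j = g x (h * j)%N *+ ((h * j)`! %/ (j`! * h`! ^ j))%N;
  gamma_diff : forall d m (x : elem A) j,
    is_bihomog d m x -> (0 < d)%N -> ~~ odd d ->
    diff (g x j.+1) = mul (g x j) (diff x)
}.

Record is_dgMap A B (phi : elem A -> elem B) : Prop := IsDGMap {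
  dgmap_linear : linear phi;
  dgmap_bihomog : forall d m (x : elem A),
    is_bihomog d m x -> is_bihomog d m (phi x);
  dgmap_diff : forall x, phi (diff x) = diff (phi x);
  dgmap_mul : forall x y, phi (mul x y) = mul (phi x) (phi y);
  dgmap_one : phi (one_elt A) = one_elt B
}.

Definition is_gammaMap A B (gA : elem A -> nat -> elem A)
    (gB : elem B -> nat -> elem B) (phi : elem A -> elem B) : Prop :=
  is_dgMap phi /\
  forall d m (x : elem A) j, is_bihomog d m x -> (0 < d)%N -> ~~ odd d ->
    phi (gA x j) = gB (phi x) j.

(* equality of divided power structures: values at elements without divided
   powers are irrelevant *)
Definition gamma_eq A (g g' : elem A -> nat -> elem A) : Prop :=
  forall d m (x : elem A) j, is_bihomog d m x -> (0 < d)%N -> ~~ odd d ->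
    g x j = g' x j.

End DGAlgebras.

Section Resolutions.
Variables (k : fieldType) (n : nat).
Local Notation elem A := {freeg (gen A) / {mpoly k[n]}}.

Definition is_monomialIdeal (I : {mpoly k[n]} -> Prop) : Prop :=
  exists S : 'X_{1..n} -> Prop, forall p, I p <->
    exists2 s : seq ({mpoly k[n]} * 'X_{1..n}),
      (forall u, u \in s -> S u.2) & p = \sum_(u <- s) u.1 * 'X_[u.2].

(* A is exact in positive degrees, and a multigraded R-linear map
   A_0 -> R/I induces an isomorphism H_0(A) = R/I.  The map is given by
   representatives in R, equality in R/I being congruence modulo I. *)
Definition is_resolution (A : dgData k n) (I : {mpoly k[n]} -> Prop) : Prop :=
  (forall d (x : elem A), is_homog d.+1 x -> diff x = 0 ->
     exists2 y : elem A, is_homog d.+2 y & diff y = x) /\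
  exists eps : elem A -> {mpoly k[n]},
  [/\ forall p (x y : elem A), is_homog 0 x -> is_homog 0 y ->
        I (eps (p *: x + y) - (p * eps x + eps y)),
      forall m (x : elem A), is_bihomog 0 m x ->
        exists c : k, I (eps x - c *: 'X_[m]),
      forall p, exists2 x : elem A, is_homog 0 x & I (eps x - p)
    & forall x : elem A, is_homog 0 x ->
        (I (eps x) <-> exists2 y : elem A, is_homog 1 y & diff y = x)].

End Resolutions.

Section GeneralizedTaylor.
Variables (k : fieldType) (n r : nat) (F : 'I_r -> dgData k n).
Local Notation elem A := {freeg (gen A) / {mpoly k[n]}}.

Definition tgen : choiceType := {dffun forall i : 'I_r, gen (F i)}.

Local Notation telem := {freeg tgen / {mpoly k[n]}}.

Definition lcms (m : 'I_r -> 'X_{1..n}) : 'X_{1..n} :=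
  \big[@mlcm n/0%MM]_(i < r) m i.

Definition tmultideg (b : tgen) : 'X_{1..n} := lcms (fun i => multideg (b i)).

Definition thdeg (b : tgen) : nat := (\sum_(i < r) hdeg (b i))%N.

(* For f_i bigraded of multidegree m_i, that is
   f_i = \sum_a c_{i,a} (m_i / m_a) a with c_{i,a} in k, the sum over all
   families of basis elements b = (b_1, .., b_r) of
   c_{1,b_1} .. c_{r,b_r} (M / [m_{b_1}, .., m_{b_r}]) b_1 * .. * b_r. *)
Definition star_num (M : 'X_{1..n}) (m : 'I_r -> 'X_{1..n})
    (f : forall i, elem (F i)) : telem :=
  \sum_(s : {dffun forall i : 'I_r, seq_sub (dom (f i))})
    let b : tgen := [ffun i : 'I_r => val (s i) : gen (F i)] in
    << (\prod_(i < r) (coeff (b i) (f i))@_(m i - multideg (b i))%MM)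
         *: 'X_[M - tmultideg b] *g b >>.

(* f_1 * .. * f_r, each f_i being regarded as of multidegree m_i *)
Definition star (m : 'I_r -> 'X_{1..n}) (f : forall i, elem (F i)) :=
  star_num (lcms m) m f.

(* The alternating sum of the b_1 * .. * diff b_i * .. * b_r, where diff b_i
   is of multidegree m_{b_i}. *)
Definition tdiff_gen (b : tgen) : telem :=
  \sum_(i < r) (-1) ^+ (\sum_(l < r | l < i) hdeg (b l))%N *:
    star (fun l => multideg (b l))
      (@dfwith _ (fun l => elem (F l)) (fun l => << b l >>) i (diff << b i >>)).

Definition tmul_gen (b b' : tgen) : telem :=
  (-1) ^+ (\sum_(i < r) (hdeg (b' i) * (\sum_(j < r | i < j) hdeg (b j))))%N
  *: star_num (tmultideg b + tmultideg b')%MM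
       (fun i => multideg (b i) + multideg (b' i))%MM
       (fun i => (mul << b i >> << b' i >> : elem (F i))).

Definition taylor : dgData k n := @DGData k n tgen thdeg tmultideg
  (fglift tdiff_gen)
  (fun x y => fglift (fun b => fglift (tmul_gen b) y) x)
  (star (fun _ => 0%MM) (fun i => one_elt (F i))).

(* f_i |-> 1 * .. * f_i * .. * 1, extended R-linearly from the basis *)
Definition taylor_incl (i : 'I_r) (f : elem (F i)) : elem taylor :=
  fglift (fun a : gen (F i) =>
    star (@dfwith _ (fun _ => 'X_{1..n}) (fun _ => 0%MM) i (multideg a))
         (@dfwith _ (fun l => elem (F l)) (fun l => one_elt (F l)) i << a >>)) f.

Definition taylor_powers (g : forall i, elem (F i) -> nat -> elem (F i))
    (G : elem taylor -> nat -> elem taylor) : Prop :=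
  forall (d : 'I_r -> nat) (m : 'I_r -> 'X_{1..n}) (f : forall i, elem (F i))
    (e : nat),
  (forall i, is_bihomog (d i) (m i) (f i)) ->
  (0 < \sum_(i < r) d i)%N -> ~~ odd (\sum_(i < r) d i)%N -> (2 <= e)%N ->
  ((exists l, odd (d l)) -> G (star m f) e = 0) /\
  (forall j : 'I_r, (forall l, ~~ odd (d l)) ->
     (0 < d j)%N -> (forall i : 'I_r, (i < j)%N -> d i = 0%N) ->
     G (star m f) e =
       star (fun i => m i *+ e)%MM
         (@dfwith _ (fun i => elem (F i)) (fun i => dgexp (f i) e) j
            (g j (f j) e))).

End GeneralizedTaylor.

(* Main.v *)
(** Setting all the x_i to 1 turns a free DG algebra over k[x_1..x_n] into a DG
    algebra over k with the same basis, filtered by multidegree, and loses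
    nothing on elements of a fixed multidegree.  Under this specialization
    [F_1 * .. * F_r] becomes the ordinary tensor product [V_1 (x) .. (x) V_r]
    with Koszul signs, which settles the DG algebra axioms.

    For the divided powers, encode x^(0), x^(1), .. as the exponential series
    [\sum_j x^(j) t^j] with coefficients in the commutative ring of even
    elements.  It must turn sums into products, so it is determined by its
    values on the basis, where it is prescribed.  Multilinear induction shows
    that these values propagate to all pure tensors of homogeneous elements;
    every other axiom is then stable under sums and checked on pure tensors.
    Only the axiom on [(x^(h))^(j)] needs an identity between integers, which
    is verified in rat[z].

    Uniqueness holds because a basis element is, up to sign, the product of its
    part in one slot with an element supported on the other slots. *)
From Stdlib Require Import FunctionalExtensionality.
From HB Require Import structures.
From mathcomp Require Import all_boot all_algebra.
From mathcomp Require Import zify ring.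
From mathcomp Require Import freeg mpoly.
Require Import Defs.

Set Implicit Arguments.
Unset Strict Implicit.
Unset Printing Implicit Defensive.

Import GRing.Theory.
Local Open Scope ring_scope.

(** * Free modules *)

(** Since k may have positive characteristic, integers such as j! cannot be cancelled, so x^(j)
    cannot be treated as x^j / j!. This shapes three places. The formula singles out one slot of
    positive degree; that any such slot would do follows by moving the integer in x^j = j! x^(j)
    from one slot to another. Iterated powers are compared through natural number coefficients,
    never by clearing denominators. Squares of odd elements are shown to vanish separately from
    anticommutativity.

    Defining the exponential on a basis leaves no relation to respect; the price is that the
    formula, imposed on basis tensors only, must be proved for all pure tensors. Even elements are
    needed because a product of series over a support must not depend on its order. Odd elements
    enter only through products x y of two of them, whose series is 1 + x y t.

    The way back to polynomial coefficients needs a multidegree at which to homogenize. If x is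
    bounded by m, then x^(j) is bounded by m^j; on basis tensors this holds because forming least
    common multiples commutes with taking powers. *)

Section FreeModule.
Variables (R : nzRingType) (K : choiceType).
Implicit Types (x y : {freeg K / R}).

Lemma freegP x y : (forall a, coeff a x = coeff a y) -> x = y.
Proof. by move=> h; apply/eqP/freeg_eqP. Qed.

Lemma coeff_basis (a b : K) : coeff b (<< a >> : {freeg K / R}) = (a == b)%:R.
Proof. by rewrite coeffU mul1r. Qed.

Lemma freegU_scale (c : R) (a : K) : << c *g a >> = c *: << a >>.
Proof. by apply: freegP => b; rewrite coeffZ !coeffU mul1r. Qed.

Lemma freeg_expand x : x = \sum_(a <- dom x) coeff a x *: << a >>.
Proof.
by rewrite -[LHS]freeg_sumE; apply: eq_bigr => a _; rewrite freegU_scale.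
Qed.

(** The support of the tail stays inside [Q], so that elements that are homogeneous, even or of
    positive degree can be peeled off one basis term at a time. *)
Lemma freeg_ind_in (Q : K -> Prop) (P : {freeg K / R} -> Prop) :
  P 0 -> (forall c a x, Q a -> (forall b, coeff b x != 0 -> Q b) ->
            P x -> P (c *: << a >> + x)) ->
  forall x, (forall a, coeff a x != 0 -> Q a) -> P x.
Proof.
move=> P0 Pc x Qx; rewrite [x]freeg_expand.
have: forall a, a \in dom x -> Q a by move=> a; rewrite mem_dom; apply: Qx.
(* A partial sum is not known beforehand to be supported on its list, so the support condition is
   carried through the induction as a second conjunct. *)
suff: (forall a, a \in dom x -> Q a) ->
  P (\sum_(a <- dom x) coeff a x *: << a >>) /\
  (forall b, coeff b (\sum_(a <- dom x) coeff a x *: << a >>) != 0 -> Q b).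
  by move=> h h'; case: (h h').
elim: (dom x) => [|a s IHs] Qs.
  by rewrite big_nil; split=> // b; rewrite coeff0 eqxx.
rewrite big_cons; case: IHs => [b bs|Ps Qs']; first by apply: Qs; rewrite inE bs orbT.
have Qa: Q a by apply: Qs; rewrite inE eqxx.
split; first exact: Pc.
move=> b; rewrite coeffD coeffZ coeff_basis.
by case: (a =P b) => [<-//|_]; rewrite mulr0 add0r; apply: Qs'.
Qed.

Lemma freeg_ind (P : {freeg K / R} -> Prop) :
  P 0 -> (forall c a x, P x -> P (c *: << a >> + x)) -> forall x, P x.
Proof.
by move=> P0 Pc x; apply: (@freeg_ind_in (fun _ => True)) => // c a y _ _; apply: Pc.
Qed.

Section Lift.
Variables (M : lmodType R) (f : K -> M).

Lemma fglift_linear : linear (fglift f).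
Proof.
have fD : additive (fglift f) by apply: lift_is_additive.
have f0 : fglift f 0 = 0 by rewrite -(subrr 0) fD subrr.
have fN x : fglift f (- x) = - fglift f x by rewrite -(sub0r x) fD f0 sub0r.
have f_D x y : fglift f (x + y) = fglift f x + fglift f y.
  by rewrite -{1}(opprK y) fD fN opprK.
move=> c x y; rewrite f_D; congr (_ + _).
elim/freeg_ind: x => [|d a x IHx]; first by rewrite scaler0 f0 scaler0.
rewrite scalerDr !f_D scalerDr IHx; congr (_ + _).
by rewrite scalerA -!freegU_scale !liftU scalerA.
Qed.

Lemma fglift_basis a : fglift f << a >> = f a.
Proof. by rewrite liftU scale1r. Qed.

End Lift.

End FreeModule.

Section LinearMaps.
Variables (R : nzRingType) (U V : lmodType R) (f : U -> V).
Hypothesis fL : linear f.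

Lemma lin0 : f 0 = 0.
Proof. by have := fL (-1) 0 0; rewrite scaler0 add0r scaleN1r addNr. Qed.

Lemma linD x y : f (x + y) = f x + f y.
Proof. by have := fL 1 x y; rewrite !scale1r. Qed.

Lemma linZ c x : f (c *: x) = c *: f x.
Proof. by have := fL c x 0; rewrite lin0 !addr0. Qed.

Lemma lin_sum (J : Type) (s : seq J) (P : pred J) (h : J -> U) :
  f (\sum_(i <- s | P i) h i) = \sum_(i <- s | P i) f (h i).
Proof.
by apply: (big_morph f); [exact: linD | exact: lin0].
Qed.

End LinearMaps.

(** Only the left argument is restricted by [Q]: the sign in the Leibniz rule depends on the left
    factor alone, and one even factor is enough for commutation. *)
Lemma basis_ind2 (R : nzRingType) (K K' : choiceType) (M : lmodType R)
    (U V : {freeg K / R} -> {freeg K' / R} -> M) (Q : K -> Prop) :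
  (forall x, linear (U x)) -> (forall y, linear (U^~ y)) ->
  (forall x, linear (V x)) -> (forall y, linear (V^~ y)) ->
  (forall a b, Q a -> U << a >> << b >> = V << a >> << b >>) ->
  forall y x, (forall a, coeff a x != 0 -> Q a) -> U x y = V x y.
Proof.
move=> Ur Ul Vr Vl UV y; apply: freeg_ind_in => [|c a x Qa _ IHx].
  by rewrite (lin0 (Ul y)) (lin0 (Vl y)).
rewrite (Ul y) (Vl y) IHx; congr (_ *: _ + _).
elim/freeg_ind: y {IHx} => [|d b y IHy]; first by rewrite (lin0 (Ur _)) (lin0 (Vr _)).
by rewrite (Ur _) (Vr _) IHy UV.
Qed.

Section CoefficientMap.
Variables (R R' : nzRingType) (K : choiceType) (phi : K -> R -> R').
Hypothesis phi0 : forall a, phi a 0 = 0.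

(** [phi] may depend on the basis element, because homogenization multiplies each coefficient by its
    own monomial. *)
Definition cmap (x : {freeg K / R}) : {freeg K / R'} :=
  \sum_(a <- dom x) << phi a (coeff a x) *g a >>.

Lemma coeff_cmap a x : coeff a (cmap x) = phi a (coeff a x).
Proof.
rewrite /cmap raddf_sum /=; have [ax|/coeff_outdom ax] := boolP (a \in dom x).
  rewrite (bigD1_seq a) ?uniq_dom //= coeffU eqxx mulr1 big1 ?addr0 // => b.
  by move=> /negPf ba; rewrite coeffU ba mulr0.
rewrite ax phi0 big1_seq // => b /andP[_ bx]; rewrite coeffU.
case: eqP => [e|_]; last by rewrite mulr0.
by move: bx; rewrite e mem_dom ax eqxx.
Qed.

End CoefficientMap.

(** * Specialization at x = 1 *)

Section Dehomogenization.
Variables (k : fieldType) (n : nat).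
Local Notation elem A := {freeg (gen A) / {mpoly k[n]}}.
Local Notation velem A := {freeg (gen A) / k}.
Implicit Types (A : dgData k n).

Definition at1 (p : {mpoly k[n]}) : k := p.@[fun=> 1].

Lemma at1D p q : at1 (p + q) = at1 p + at1 q. Proof. exact: mevalD. Qed.
Lemma at1M p q : at1 (p * q) = at1 p * at1 q. Proof. exact: mevalM. Qed.
Lemma at10 : at1 0 = 0. Proof. exact: meval0. Qed.
Lemma at11 : at1 1 = 1. Proof. exact: meval1. Qed.
Lemma at1N p : at1 (- p) = - at1 p. Proof. exact: mevalN. Qed.
Lemma at1C c : at1 c%:MP = c. Proof. exact: mevalC. Qed.
Lemma at1Xp p j : at1 (p ^+ j) = at1 p ^+ j.
Proof. by elim: j => [|j IHj]; rewrite ?expr0 ?at11 // !exprS at1M IHj. Qed.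
Lemma at1X m : at1 'X_[m] = 1.
Proof. by rewrite /at1 mevalX big1 // => i _; rewrite expr1n. Qed.
Lemma at1Z c p : at1 (c *: p) = c * at1 p. Proof. exact: mevalZ. Qed.

Definition ev A (x : elem A) : velem A := cmap (fun _ => at1) x.

Lemma coeff_ev A (x : elem A) a : coeff a (ev x) = at1 (coeff a x).
Proof. by rewrite coeff_cmap // => _; apply: at10. Qed.

Lemma ev0 A : ev (0 : elem A) = 0.
Proof. by apply: freegP => a; rewrite coeff_ev !coeff0 at10. Qed.
Lemma evD A (x y : elem A) : ev (x + y) = ev x + ev y.
Proof. by apply: freegP => a; rewrite !(coeff_ev, coeffD) at1D. Qed.
Lemma evZ A p (x : elem A) : ev (p *: x) = at1 p *: ev x.
Proof. by apply: freegP => a; rewrite !(coeff_ev, coeffZ) at1M. Qed.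
Lemma evMn A (x : elem A) j : ev (x *+ j) = ev x *+ j.
Proof. by elim: j => [|j IHj]; rewrite ?ev0 // !mulrS evD IHj. Qed.
Lemma ev_basis A (a : gen A) : ev (<< a >> : elem A) = << a >>.
Proof. by apply: freegP => b; rewrite coeff_ev !coeff_basis; case: eqP; rewrite ?at11 ?at10. Qed.
Lemma ev_sum A (J : Type) (s : seq J) (P : pred J) (h : J -> elem A) :
  ev (\sum_(i <- s | P i) h i) = \sum_(i <- s | P i) ev (h i).
Proof. by apply: (big_morph (@ev A)); [exact: evD | exact: ev0]. Qed.

(* [hmg m x] is homogeneous of multidegree m only when m is divisible by the
   multidegrees in the support of x, the subtraction being truncated. *)
Definition hmg A (m : 'X_{1..n}) (x : velem A) : elem A :=
  cmap (fun a c => c *: 'X_[m - multideg a]) x.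

Lemma coeff_hmg A m (x : velem A) a :
  coeff a (hmg m x) = coeff a x *: 'X_[m - multideg a].
Proof. by rewrite coeff_cmap // => b; rewrite scale0r. Qed.

Lemma hmgK A m (x : velem A) : ev (hmg m x) = x.
Proof. by apply: freegP => a; rewrite coeff_ev coeff_hmg at1Z at1X mulr1. Qed.

Lemma hmg0 A m : hmg m (0 : velem A) = 0.
Proof. by apply: freegP => a; rewrite coeff_hmg !coeff0 scale0r. Qed.

(** This is the image under [ev] of the elements of bidegree (d, m). *)
Definition bnd A (d : nat) (m : 'X_{1..n}) (x : velem A) : Prop :=
  forall a, coeff a x != 0 -> hdeg a = d /\ (multideg a <= m)%MM.

Lemma hmg_bihomog A d m (x : velem A) : bnd d m x -> is_bihomog d m (hmg m x).
Proof.
move=> bx a u; rewrite coeff_hmg.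
have [->|nz] := eqVneq (coeff a x) 0; first by rewrite scale0r msupp0.
move/msuppZ_le; rewrite msuppX inE => /eqP ->.
by have [-> le] := bx a nz; rewrite submK.
Qed.

Definition is_mhomog A (m : 'X_{1..n}) (x : elem A) : Prop :=
  forall a u, u \in msupp (coeff a x) -> (u + multideg a)%MM = m.

Lemma bihomog_mhomog A d m (x : elem A) : is_bihomog d m x -> is_mhomog m x.
Proof. by move=> hx a u /hx[]. Qed.

(** The equation u + multideg a = m leaves a single exponent u, so the coefficient is a scalar times
    one known monomial, and its value at 1 recovers it. *)
Lemma coeff_mhomog A m (x : elem A) a : is_mhomog m x ->
  coeff a x = at1 (coeff a x) *: 'X_[m - multideg a].
Proof.
move=> hx; have [->|nz] := eqVneq (coeff a x) 0; first by rewrite at10 scale0r.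
have su u : u \in msupp (coeff a x) -> u = (m - multideg a)%MM.
  by move=> /hx <-; rewrite addmK.
have e: coeff a x = (coeff a x)@_(m - multideg a)%MM *: 'X_[m - multideg a].
  apply/mpolyP => u; rewrite mcoeffZ mcoeffX.
  have [<-|ne] := eqVneq (m - multideg a)%MM u; first by rewrite mulr1.
  rewrite mulr0; apply/memN_msupp_eq0/negP => /su e; by rewrite e eqxx in ne.
by rewrite e at1Z at1X mulr1.
Qed.

Lemma evK A m (x : elem A) : is_mhomog m x -> hmg m (ev x) = x.
Proof.
by move=> hx; apply: freegP => a; rewrite coeff_hmg coeff_ev -(coeff_mhomog a hx).
Qed.

Lemma mhomog_inj A m (x y : elem A) :
  is_mhomog m x -> is_mhomog m y -> ev x = ev y -> x = y.
Proof. by move=> hx hy e; rewrite -(evK hx) e (evK hy). Qed.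

Lemma mhomogD A m (x y : elem A) :
  is_mhomog m x -> is_mhomog m y -> is_mhomog m (x + y).
Proof.
move=> hx hy a u; rewrite coeffD => /msuppD_le; rewrite mem_cat.
by case/orP; [apply: hx | apply: hy].
Qed.

Lemma bihomog_bnd A d m (x : elem A) : is_bihomog d m x -> bnd d m (ev x).
Proof.
move=> hx a; rewrite coeff_ev => nz.
have /hx[<- <-] : (m - multideg a)%MM \in msupp (coeff a x).
  rewrite (coeff_mhomog a (bihomog_mhomog hx)).
  by rewrite mcoeff_msupp mcoeffZ mcoeffX eqxx mulr1.
by split=> //; rewrite lem_addl.
Qed.

(** Identities over k return to the polynomial ring through this lemma. Only the multidegrees must
    agree; two independent homological degrees spare conversions and the truncated predecessor in
    degree 0. *)
Lemma bihomog_inj A d d' m (x y : elem A) :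
  is_bihomog d m x -> is_bihomog d' m y -> ev x = ev y -> x = y.
Proof. by move=> hx hy; apply: mhomog_inj; [exact: bihomog_mhomog hx|exact: bihomog_mhomog hy]. Qed.

Lemma bihomog0 A d m : is_bihomog d m (0 : elem A).
Proof. by move=> a u; rewrite coeff0 msupp0. Qed.

Lemma bihomogD A d m (x y : elem A) :
  is_bihomog d m x -> is_bihomog d m y -> is_bihomog d m (x + y).
Proof.
move=> hx hy a u; rewrite coeffD => /msuppD_le; rewrite mem_cat.
by case/orP; [apply: hx | apply: hy].
Qed.

Lemma bihomogZ A d m c (x : elem A) :
  is_bihomog d m x -> is_bihomog d m (c%:MP *: x).
Proof.
move=> hx a u; rewrite coeffZ mul_mpolyC => /msuppZ_le; exact: hx.
Qed.

Lemma bihomogZX A d m u (x : elem A) :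
  is_bihomog d m x -> is_bihomog d (u + m)%MM ('X_[u] *: x).
Proof.
move=> hx a v; rewrite coeffZ mulrC (perm_mem (msuppMX _ _)) => /mapP[w ws ->].
by have [-> <-] := hx a w ws; rewrite -addmA.
Qed.

Lemma bihomogMn A d m (x : elem A) j :
  is_bihomog d m x -> is_bihomog d m (x *+ j).
Proof.
move=> hx; elim: j => [|j IHj]; first exact: bihomog0.
by rewrite mulrS; apply: bihomogD.
Qed.

Lemma bihomog_sum A d m (J : Type) (s : seq J) (P : pred J) (h : J -> elem A) :
  (forall i, P i -> is_bihomog d m (h i)) ->
  is_bihomog d m (\sum_(i <- s | P i) h i).
Proof. by move=> hh; apply: big_ind => //; [apply: bihomog0 | apply: bihomogD]. Qed.

Lemma bihomog_basis A (a : gen A) : is_bihomog (hdeg a) (multideg a) (<< a >> : elem A).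
Proof.
move=> b u; rewrite coeff_basis; case: eqP => [->|_]; last by rewrite msupp0.
by rewrite msupp1 inE => /eqP->; rewrite add0m.
Qed.

Arguments bihomog_basis {A} a.

Lemma bihomog_homog A d m (x : elem A) : is_bihomog d m x -> is_homog d x.
Proof.
move=> hx a; rewrite -msupp_eq0; case e: (msupp _) => [//|u s] _.
by have [] := hx a u; rewrite ?e ?inE ?eqxx.
Qed.

Lemma basis_homog A (a : gen A) : is_homog (hdeg a) (<< a >> : elem A).
Proof. exact: (bihomog_homog (bihomog_basis a)). Qed.

End Dehomogenization.

(** * Transfer of the DG algebra axioms between the polynomial ring and k *)

Section Specialization.
Variables (k : fieldType) (n : nat).
Local Notation elem A := {freeg (gen A) / {mpoly k[n]}}.
Local Notation velem A := {freeg (gen A) / k}.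
Implicit Types (A : dgData k n).

(** A section of [ev] that is linear over k and, unlike [hmg], requires no choice of a multidegree;
    its values need not be multihomogeneous. *)
Definition up A (x : velem A) : elem A := cmap (fun _ c => c%:MP) x.

Lemma coeff_up A (x : velem A) a : coeff a (up x) = (coeff a x)%:MP.
Proof. by rewrite coeff_cmap // => _; apply: mpolyC0. Qed.

Lemma upK A (x : velem A) : ev (up x) = x.
Proof. by apply: freegP => a; rewrite coeff_ev coeff_up at1C. Qed.

Lemma up_linear A c (x y : velem A) : up (c *: x + y) = c%:MP *: up x + up y.
Proof.
apply: freegP => a; rewrite !(coeff_up, coeffD, coeffZ) mpolyCD.
by rewrite mpolyCM.
Qed.

Lemma up_basis A (a : gen A) : up << a >> = (<< a >> : elem A).
Proof.
by apply: freegP => b; rewrite coeff_up !coeff_basis; case: (a == b); rewrite ?mpolyC0 ?mpolyC1.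
Qed.

Lemma up0 A : up (0 : velem A) = 0.
Proof. by apply: freegP => b; rewrite coeff_up !coeff0 mpolyC0. Qed.

Definition vdiff A (x : velem A) : velem A := ev (diff (up x)).
Definition vmul A (x y : velem A) : velem A := ev (mul (up x) (up y)).
Definition vone A : velem A := ev (one_elt A).

Definition hom A (d : nat) (x : velem A) : Prop :=
  forall a, coeff a x != 0 -> hdeg a = d.

Lemma homog_up A d (x : velem A) : hom d x -> is_homog d (up x).
Proof. by move=> hx a; rewrite coeff_up mpolyC_eq0 => /hx. Qed.

Lemma bnd_hom A d m (x : velem A) : bnd d m x -> hom d x.
Proof. by move=> hx a /hx[]. Qed.

(** The least multidegree at which a homogeneous x can be homogenized. *)
Definition sdeg A (x : velem A) : 'X_{1..n} :=
  \big[@mlcm n/0%MM]_(a <- dom x) multideg a.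

Lemma hom_bnd A d (x : velem A) : hom d x -> bnd d (sdeg x) x.
Proof.
move=> hx a nz; split; first exact: hx.
move: nz; rewrite -mem_dom /sdeg; elim: (dom x) => //= b s IHs.
rewrite inE big_cons => /orP[/eqP->|/IHs h]; first exact: lem_mlcml.
by apply: lepm_trans h _; apply: lem_mlcmr.
Qed.

Lemma bnd0 A d m : bnd d m (0 : velem A).
Proof. by move=> a; rewrite coeff0 eqxx. Qed.

Lemma bndD A d m (x y : velem A) : bnd d m x -> bnd d m y -> bnd d m (x + y).
Proof.
move=> hx hy a; rewrite coeffD; have [->|nz _] := eqVneq (coeff a x) 0.
  by rewrite add0r; apply: hy.
exact: hx.
Qed.

Lemma bndZ A d m c (x : velem A) : bnd d m x -> bnd d m (c *: x).
Proof.
by move=> hx a; rewrite coeffZ => h; apply: hx; apply: contraNneq h => ->; rewrite mulr0.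
Qed.

Lemma bnd_sum A d m (J : Type) (s : seq J) (P : pred J) (h : J -> velem A) :
  (forall i, P i -> bnd d m (h i)) -> bnd d m (\sum_(i <- s | P i) h i).
Proof. by move=> hh; apply: big_ind => //; [apply: bnd0 | apply: bndD]. Qed.

Lemma bnd_le A d m m' (x : velem A) : (m <= m')%MM -> bnd d m x -> bnd d m' x.
Proof. by move=> le hx a /hx[-> le']; split=> //; apply: lepm_trans le. Qed.

Lemma bnd_basis A (a : gen A) : bnd (hdeg a) (multideg a) (<< a >> : velem A).
Proof.
move=> b; rewrite coeff_basis; have [->|_] := eqVneq a b; last by rewrite eqxx.
by move=> _; split=> //; apply: lepm_refl.
Qed.

Lemma hom0 A d : hom d (0 : velem A).
Proof. by move=> a; rewrite coeff0 eqxx. Qed.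

Lemma homZ A d c (x : velem A) : hom d x -> hom d (c *: x).
Proof.
by move=> hx a; rewrite coeffZ => h; apply: hx; apply: contraNneq h => ->; rewrite mulr0.
Qed.

Lemma hom_basis A (a : gen A) : hom (hdeg a) (<< a >> : velem A).
Proof. exact: bnd_hom (@bnd_basis A a). Qed.

(* The part of [is_dgAlgebra] that is lost when x = 1. *)
Record is_pre A : Prop := IsPre {
  pre_finite : forall d, exists s : seq (gen A), forall a, hdeg a = d -> a \in s;
  pre_diff_linear : linear (@diff _ _ A);
  pre_diff_bihomog : forall d m (x : elem A),
    is_bihomog d.+1 m x -> is_bihomog d m (diff x);
  pre_diff_bottom : forall x : elem A, is_homog 0 x -> diff x = 0;
  pre_mul_linearl : forall y : elem A, linear (fun x : elem A => mul x y);
  pre_mul_linearr : forall x : elem A, linear (fun y : elem A => mul x y);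
  pre_mul_bihomog : forall d1 d2 m1 m2 (x y : elem A),
    is_bihomog d1 m1 x -> is_bihomog d2 m2 y ->
    is_bihomog (d1 + d2) (m1 + m2)%MM (mul x y);
  pre_one_bihomog : is_bihomog 0 0%MM (one_elt A)
}.

Lemma dg_pre A : is_dgAlgebra A -> is_pre A.
Proof. by case. Qed.

Record is_vdga A : Prop := IsVdga {
  v_diff_diff : forall x : velem A, vdiff (vdiff x) = 0;
  v_mulA : associative (@vmul A);
  v_mul1 : left_id (vone A) (@vmul A);
  v_mulr1 : right_id (vone A) (@vmul A);
  v_leibniz : forall d (x y : velem A), hom d x ->
    vdiff (vmul x y) = vmul (vdiff x) y + (-1) ^+ d *: vmul x (vdiff y);
  v_comm : forall d1 d2 (x y : velem A), hom d1 x -> hom d2 y ->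
    vmul x y = (-1) ^+ (d1 * d2) *: vmul y x;
  v_sqr0 : forall d (x : velem A), hom d x -> odd d -> vmul x x = 0
}.

Section Pre.
Variables (A : dgData k n) (H : is_pre A).

(** A map that is semilinear along [at1] cannot distinguish x from [up (ev x)]: both have the same
    coefficients at 1 on the same basis. Hence the operations over k do not depend on the section
    chosen to define them. *)
Lemma ev_up_ev (f : elem A -> velem A) :
  (forall p x y, f (p *: x + y) = at1 p *: f x + f y) ->
  forall x, f (up (ev x)) = f x.
Proof.
move=> fL; have f0: f 0 = 0.
  by have := fL (-1) 0 0; rewrite scaler0 add0r at1N at11 scaleN1r addNr.
elim/freeg_ind => [|c a x IHx]; first by rewrite ev0 up0.
by rewrite evD evZ ev_basis up_linear up_basis !fL at1C IHx.
Qed.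

Lemma ev_diff (x : elem A) : ev (diff x) = vdiff (ev x).
Proof.
rewrite /vdiff (@ev_up_ev (fun x => ev (diff x))) // => p y z.
by rewrite (pre_diff_linear H) evD evZ.
Qed.

Lemma ev_mul (x y : elem A) : ev (mul x y) = vmul (ev x) (ev y).
Proof.
rewrite /vmul (@ev_up_ev (fun x => ev (mul x (up (ev y))))); last first.
  by move=> p u v; rewrite (pre_mul_linearl H) evD evZ.
rewrite (@ev_up_ev (fun y => ev (mul x y))) // => p u v.
by rewrite (pre_mul_linearr H) evD evZ.
Qed.

Lemma vdiff_linear : linear (@vdiff A).
Proof. by move=> c x y; rewrite /vdiff up_linear (pre_diff_linear H) evD evZ at1C. Qed.

Lemma vmul_linearl y : linear (fun x => @vmul A x y).
Proof. by move=> c x z; rewrite /vmul up_linear (pre_mul_linearl H) evD evZ at1C. Qed.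

Lemma vmul_linearr x : linear (@vmul A x).
Proof. by move=> c y z; rewrite /vmul up_linear (pre_mul_linearr H) evD evZ at1C. Qed.

Lemma vdiff_bnd d m (x : velem A) : bnd d.+1 m x -> bnd d m (vdiff x).
Proof.
move=> hx; rewrite -(hmgK m x) -ev_diff; apply: bihomog_bnd.
by apply: (pre_diff_bihomog H); apply: hmg_bihomog.
Qed.

Lemma vmul_bnd d1 d2 m1 m2 (x y : velem A) : bnd d1 m1 x -> bnd d2 m2 y ->
  bnd (d1 + d2) (m1 + m2)%MM (vmul x y).
Proof.
move=> hx hy; rewrite -(hmgK m1 x) -(hmgK m2 y) -ev_mul; apply: bihomog_bnd.
by apply: (pre_mul_bihomog H); apply: hmg_bihomog.
Qed.

Lemma vone_bnd m : bnd 0 m (vone A).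
Proof.
apply: (@bnd_le A 0 0%MM); first by apply/mnm_lepP => i; rewrite mnm0E.
exact: bihomog_bnd (pre_one_bihomog H).
Qed.

Lemma vone_hom : hom 0 (vone A).
Proof. exact: bnd_hom (vone_bnd 0%MM). Qed.

Lemma vdiff_hom d (x : velem A) : hom d.+1 x -> hom d (vdiff x).
Proof. by move=> /hom_bnd/vdiff_bnd/bnd_hom. Qed.

Lemma vmul_hom d1 d2 (x y : velem A) : hom d1 x -> hom d2 y -> hom (d1 + d2) (vmul x y).
Proof. by move=> /hom_bnd hx /hom_bnd hy; have /bnd_hom := vmul_bnd hx hy. Qed.

Lemma vdiff_bottom (x : velem A) : hom 0 x -> vdiff x = 0.
Proof. by move=> /homog_up hx; rewrite /vdiff (pre_diff_bottom H hx) ev0. Qed.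

Lemma diff_bihomog_pred d m (x : elem A) :
  is_bihomog d m x -> is_bihomog d.-1 m (diff x).
Proof.
case: d => [|d] hx; last exact: (pre_diff_bihomog H).
by rewrite (pre_diff_bottom H); [apply: bihomog0 | apply: bihomog_homog hx].
Qed.

End Pre.

Lemma at1_sign j : at1 ((-1) ^+ j : {mpoly k[n]}) = (-1) ^+ j.
Proof. by rewrite at1Xp at1N at11. Qed.

Lemma dg_vdga A : is_dgAlgebra A -> is_vdga A.
Proof.
move=> H; have P := dg_pre H; split.
- by move=> x; rewrite {2}/vdiff -(ev_diff P) (dg_diff_diff H) ev0.
- move=> x y z; rewrite -(upK x) -(upK y) -(upK z) -!(ev_mul P).
  by rewrite (dg_mulA H).
- by move=> x; rewrite -(upK x) -(ev_mul P) (dg_mul1 H).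
- by move=> x; rewrite -(upK x) -(ev_mul P) (dg_mulr1 H).
- move=> d x y /homog_up hx; rewrite -(upK x) -(upK y) -!(ev_diff P, ev_mul P).
  by rewrite (dg_leibniz H _ hx) evD evZ at1_sign.
- move=> d1 d2 x y /homog_up hx /homog_up hy.
  by rewrite /vmul (dg_comm H hx hy) evZ at1_sign.
- by move=> d x /homog_up hx od; rewrite /vmul (dg_sqr0 H hx od) ev0.
Qed.

(** Apart from the vanishing of squares, each identity is linear in every argument over the
    polynomial ring, so it reduces to basis elements. There both sides are homogeneous of one
    multidegree, and [bihomog_inj] or [mhomog_inj] applies. *)
Lemma vdga_dg A : is_pre A -> is_vdga A -> is_dgAlgebra A.
Proof.
move=> P H.
have dL := pre_diff_linear P.
have mL := pre_mul_linearl P.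
have mR := pre_mul_linearr P.
have mB := pre_mul_bihomog P.
have dB := diff_bihomog_pred P.
have bB := @bihomog_basis k n A.
have comm d1 d2 (x y : elem A) : is_homog d1 x -> is_homog d2 y ->
    mul x y = (-1) ^+ (d1 * d2) *: mul y x.
  move=> hx hy; move: x hx; apply: freeg_ind_in => [|c a x ha _ IHx].
    by rewrite (lin0 (mL _)) (lin0 (mR _)) scaler0.
  rewrite mL mR IHx scalerDr; congr (_ + _).
  rewrite scalerA mulrC -scalerA; congr (_ *: _).
  move: y hy {IHx}; apply: freeg_ind_in => [|d b y hb _ IHy].
    by rewrite (lin0 (mL _)) (lin0 (mR _)) scaler0.
  rewrite mL mR IHy scalerDr; congr (_ + _).
  rewrite scalerA mulrC -scalerA; congr (_ *: _).
  apply: (bihomog_inj (d' := (hdeg b + hdeg a)%N) (mB _ _ _ _ _ _ (bB a) (bB b))).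
    rewrite addmC -[_ ^+ _](_ : ((-1) ^+ (d1 * d2))%:MP = _); last first.
      by rewrite rmorphXn rmorphN1.
    exact: bihomogZ (mB _ _ _ _ _ _ (bB b) (bB a)).
  rewrite evZ at1_sign !(ev_mul P) (v_comm H (d1 := d1) (d2 := d2)) //.
  - by rewrite ev_basis -ha; apply: hom_basis.
  - by rewrite ev_basis -hb; apply: hom_basis.
split=> //; try by case: P.
- elim/freeg_ind => [|c a x IHx]; first by rewrite !(lin0 dL).
  rewrite !dL IHx addr0 -[RHS](scaler0 _ c); congr (_ *: _).
  apply: (bihomog_inj (dB _ _ _ (dB _ _ _ (bB a))) (@bihomog0 _ _ A 0 _)).
  by rewrite !(ev_diff P) (v_diff_diff H) ev0.
- move=> x y z; elim/freeg_ind: z => [|c a z IHz]; first by rewrite !(lin0 (mR _)).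
  rewrite !mR IHz; congr (_ *: _ + _) => {z IHz}.
  apply: (@basis_ind2 _ _ _ _ (fun x y => mul x (mul y _)) (fun x y => mul (mul x y) _)
     (fun _ => True)) => [u c' v w|v c' u w|u c' v w|v c' u w|u v _|//].
  + by rewrite mL mR.
  + by rewrite mL.
  + by rewrite mR mL.
  + by rewrite !mL.
  apply: (bihomog_inj (d' := (hdeg u + hdeg v + hdeg a)%N)
    (mB _ _ _ _ _ _ (bB u) (mB _ _ _ _ _ _ (bB v) (bB a)))).
    by rewrite addmA; apply: (mB _ _ _ _ _ _ (mB _ _ _ _ _ _ (bB u) (bB v)) (bB a)).
  by rewrite !(ev_mul P) (v_mulA H).
- elim/freeg_ind => [|c a x IHx]; first by rewrite (lin0 (mR _)).
  rewrite mR IHx; congr (_ *: _ + _).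
  have := mB _ _ _ _ _ _ (pre_one_bihomog P) (bB a); rewrite add0m => h.
  by apply: (bihomog_inj h (bB a)); rewrite (ev_mul P) (v_mul1 H).
- elim/freeg_ind => [|c a x IHx]; first by rewrite (lin0 (mL _)).
  rewrite mL IHx; congr (_ *: _ + _).
  have := mB _ _ _ _ _ _ (bB a) (pre_one_bihomog P); rewrite addm0 => h.
  by apply: (bihomog_inj h (bB a)); rewrite (ev_mul P) (v_mulr1 H).
- move=> d x y hx.
  apply: (@basis_ind2 _ _ _ _ (fun x y => diff (mul x y))
    (fun x y => mul (diff x) y + (-1) ^+ d *: mul x (diff y))
     (fun a => hdeg a = d)) hx => [u c' v w|v c' u w|u c' v w|v c' u w|u v hu].
  + by rewrite mR dL.
  + by rewrite mL dL.
  + by rewrite dL !mR !scalerDr !scalerA addrACA [c' * _]mulrC.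
  + by rewrite dL !mL !scalerDr !scalerA addrACA [c' * _]mulrC.
  have hs : ((-1) ^+ d : {mpoly k[n]}) = ((-1) ^+ d)%:MP by rewrite rmorphXn rmorphN1.
  apply: (mhomog_inj (m := (multideg u + multideg v)%MM)).
  + by apply: bihomog_mhomog (dB _ _ _ (mB _ _ _ _ _ _ (bB u) (bB v))).
  + apply: mhomogD; first exact: bihomog_mhomog (mB _ _ _ _ _ _ (dB _ _ _ (bB u)) (bB v)).
    rewrite hs; apply: (@bihomog_mhomog _ _ _ (hdeg u + (hdeg v).-1)).
    exact: bihomogZ (mB _ _ _ _ _ _ (bB u) (dB _ _ _ (bB v))).
  rewrite evD evZ at1_sign !(ev_diff P, ev_mul P, ev_basis) (v_leibniz H (d := d)) //.
  by rewrite -hu; apply: hom_basis.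
(* Squaring is not linear: the cross terms of (c a + x)^2 cancel by [comm], as d is odd. *)
- move=> d x + od; move: x; apply: freeg_ind_in => [|c a x ha hx IHx].
    by rewrite (lin0 (mL _)).
  rewrite mL !mR IHx addr0 (comm d d x << a >>) //; last first.
    by rewrite -ha; apply: basis_homog.
  rewrite -signr_odd oddM od expr1 scaleN1r scalerN scalerDr -addrA subrr addr0.
  rewrite -[RHS](scaler0 _ (c * c)) scalerA; congr (_ *: _).
  apply: (bihomog_inj (mB _ _ _ _ _ _ (bB a) (bB a)) (@bihomog0 _ _ A 0 _)).
  rewrite (ev_mul P) ev0 (v_sqr0 H (d := d)) // ev_basis -ha; exact: hom_basis.
Qed.

End Specialization.

(** * The Taylor resolution as a tensor product *)

Section Lcm.
Variable n : nat.
Implicit Types (m u : 'X_{1..n}).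

Lemma lem_lcms r (m : 'I_r -> 'X_{1..n}) u :
  (lcms m <= u)%MM <-> (forall i, (m i <= u)%MM).
Proof.
split=> [le i|le].
  apply: lepm_trans le; rewrite /lcms.
  have := mem_index_enum i; elim: (index_enum _) => // j s IHs; rewrite inE big_cons => /orP[/eqP->|/IHs h].
    exact: lem_mlcml.
  by apply: lepm_trans h _; apply: lem_mlcmr.
rewrite /lcms; elim/big_rec: _ => [|i v _ IH]; first by apply/mnm_lepP=> j; rewrite mnm0E.
by rewrite lem_mlcm le IH.
Qed.

Lemma le_lcms r (m : 'I_r -> 'X_{1..n}) i : (m i <= lcms m)%MM.
Proof. by move: i; apply/lem_lcms/lepm_refl. Qed.

Lemma lcms_muln r (m : 'I_r -> 'X_{1..n}) j :
  lcms (fun i => m i *+ j)%MM = (lcms m *+ j)%MM.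
Proof.
rewrite /lcms; elim/big_rec2: _ => [|i u v _ ->].
  by apply/mnmP => l; rewrite mulmnE !mnm0E.
by apply/mnmP => l; rewrite !(mnmE, mulmnE) maxnMl.
Qed.

Lemma lem_muln m u j : (m <= u)%MM -> (m *+ j <= u *+ j)%MM.
Proof. by move=> /mnm_lepP le; apply/mnm_lepP => i; rewrite !mulmnE leq_mul2r le orbT. Qed.

Lemma lem_add m m' u u' : (m <= u -> m' <= u' -> m + m' <= u + u')%MM.
Proof. by move=> /mnm_lepP h /mnm_lepP h'; apply/mnm_lepP => i; rewrite !mnmDE leq_add. Qed.

End Lcm.

Section Tensor.
Variables (k : fieldType) (n r : nat) (F : 'I_r -> dgData k n).
Local Notation elem A := {freeg (gen A) / {mpoly k[n]}}.
Local Notation velem A := {freeg (gen A) / k}.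
Local Notation V := (fun i : 'I_r => velem (F i)).
Local Notation W := (velem (taylor F)).
Local Notation upd f i x := (@dfwith _ V f i x).
Local Notation "'Pi'" := (forall i : 'I_r, velem (F i)).
Implicit Types (b : tgen F) (d : 'I_r -> nat).

(** The families drawn from the finite supports embed into [tgen], so at most one summand
    contributes to each coefficient. *)
Lemma coeff_dffun_sum (R : nzRingType) (D : forall i, seq (gen (F i))) (w : tgen F -> R) b :
  coeff b (\sum_(s : {dffun forall i : 'I_r, seq_sub (D i)})
     << w [ffun i : 'I_r => val (s i) : gen (F i)] *g
        ([ffun i : 'I_r => val (s i) : gen (F i)] : tgen F) >>) =
  w b *+ [forall i, b i \in D i].
Proof.
rewrite raddf_sum /=; case: forallP => [bD|nbD]; last first.
  rewrite mulr0n big1 // => s _; rewrite coeffU; case: eqP => [e|_]; last by rewrite mulr0.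
  by case: nbD => i; rewrite -e ffunE; apply: valP.
pose s0 : {dffun forall i : 'I_r, seq_sub (D i)} := [ffun i : 'I_r => SeqSub (bD i)].
have e0 : [ffun i : 'I_r => val (s0 i) : gen (F i)] = b.
  by apply/ffunP => i; rewrite !ffunE.
rewrite (bigD1 s0) //= big1 => [|s ne].
  by rewrite e0 coeffU eqxx mulr1 addr0.
rewrite coeffU; case: eqP => [e|_]; last by rewrite mulr0.
case/eqP: ne; apply/ffunP => i; apply: val_inj.
by have /ffunP/(_ i) := etrans e (esym e0); rewrite !ffunE.
Qed.

(** The pure tensor of the f_i over k, indexed in the same way as [star_num]. *)
Definition tens (f : Pi) : W :=
  \sum_(s : {dffun forall i : 'I_r, seq_sub (dom (f i))})
    << \prod_(i < r) coeff ([ffun i : 'I_r => val (s i) : gen (F i)] i) (f i) *g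
       ([ffun i : 'I_r => val (s i) : gen (F i)] : tgen F) >>.

Lemma coeff_tens f b : coeff b (tens f) = \prod_(i < r) coeff (b i) (f i).
Proof.
rewrite /tens (coeff_dffun_sum _ (fun b : tgen F => \prod_(i < r) coeff (b i) (f i))).
case: forallP => // /forallP; rewrite negb_forall => /existsP[i ni].
by rewrite mulr0n (bigD1 i) //= (coeff_outdom ni) mul0r.
Qed.

Lemma coeff_star_num M m (f : forall i, elem (F i)) b :
  (forall i, is_mhomog (m i) (f i)) ->
  coeff b (star_num M m f) =
  (\prod_(i < r) at1 (coeff (b i) (f i))) *: 'X_[M - tmultideg b].
Proof.
move=> hf; rewrite /star_num /=.
rewrite (coeff_dffun_sum _ (fun b : tgen F =>
  (\prod_(i < r) (coeff (b i) (f i))@_(m i - multideg (b i))%MM)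
         *: 'X_[M - tmultideg b])).
have -> : \prod_(i < r) (coeff (b i) (f i))@_(m i - multideg (b i))%MM =
          \prod_(i < r) at1 (coeff (b i) (f i)).
  apply: eq_bigr => i _; rewrite (coeff_mhomog (b i) (hf i)).
  by rewrite mcoeffZ mcoeffX eqxx at1Z at1X.
case: forallP => // /forallP; rewrite negb_forall => /existsP[i ni].
by rewrite mulr0n (bigD1 i) //= (coeff_outdom ni) at10 mul0r scale0r.
Qed.

(** For [f i] homogeneous of multidegree [m i], the scalar read off in [star_num] is the value of
    the coefficient at x = 1, so the star symbol is a homogenized pure tensor. *)
Lemma star_numE M m (f : forall i, elem (F i)) : (forall i, is_mhomog (m i) (f i)) ->
  star_num M m f = @hmg _ _ (taylor F) M (tens (fun i => ev (f i))).
Proof.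
move=> hf; apply: freegP => b; rewrite coeff_star_num // (@coeff_hmg _ _ (taylor F)) coeff_tens.
by under eq_bigr do rewrite -coeff_ev.
Qed.

Lemma starE m (f : forall i, elem (F i)) : (forall i, is_mhomog (m i) (f i)) ->
  star m f = @hmg _ _ (taylor F) (lcms m) (tens (fun i => ev (f i))).
Proof. exact: star_numE. Qed.

Lemma bnd_tens d m f : (forall i, bnd (d i) (m i) (f i)) ->
  bnd (\sum_(i < r) d i) (lcms m) (tens f).
Proof.
move=> hf b; rewrite coeff_tens prodf_seq_neq0 => /allP nz.
have h i : hdeg (b i) = d i /\ (multideg (b i) <= m i)%MM.
  by apply: hf; have := nz i; rewrite mem_index_enum => /(_ isT).
split; first by apply: eq_bigr => i _; case: (h i).
apply/lem_lcms => i; apply: lepm_trans (le_lcms m i).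
by case: (h i).
Qed.

Lemma hom_tens d f : (forall i, hom (d i) (f i)) -> hom (\sum_(i < r) d i) (tens f).
Proof.
by move=> hf; apply: (bnd_hom (@bnd_tens d (fun i => sdeg (f i)) f _)) => i; apply: hom_bnd.
Qed.

Lemma upd_in f i x : upd f i x i = x. Proof. exact: dfwith_in. Qed.
Lemma upd_out f i x j : i != j -> upd f i x j = f j. Proof. exact: dfwith_out. Qed.
Lemma upd_id f i : upd f i (f i) = f.
Proof.
apply: functional_extensionality_dep => j.
by have [e|/upd_out->//] := eqVneq i j; case: _ / e; rewrite upd_in.
Qed.
Lemma upd_upd f i x y : upd (upd f i x) i y = upd f i y.
Proof.
apply: functional_extensionality_dep => j.
by have [e|ne] := eqVneq i j; [case: _ / e; rewrite !upd_in | rewrite !upd_out].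
Qed.
Lemma upd_comm f i j x y : i != j -> upd (upd f i x) j y = upd (upd f j y) i x.
Proof.
move=> ne; apply: functional_extensionality_dep => l.
have [e|nel] := eqVneq i l.
  by case: _ / e; rewrite upd_in upd_out 1?eq_sym // upd_in.
have [e|nel'] := eqVneq j l; last by rewrite !upd_out.
by case: _ / e; rewrite upd_in upd_out // upd_in.
Qed.

Lemma tens_linear f i c x y :
  tens (upd f i (c *: x + y)) = c *: tens (upd f i x) + tens (upd f i y).
Proof.
apply: freegP => b; rewrite coeffD coeffZ !coeff_tens !(bigD1 i (P := predT)) //= !upd_in.
rewrite coeffD coeffZ mulrDl -mulrA.
by congr (_ * (_ * _) + _ * _); apply: eq_bigr => j ne; rewrite !upd_out // eq_sym.
Qed.

Lemma tens0 f i : f i = 0 -> tens f = 0.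
Proof.
move=> f0; apply: freegP => b; rewrite coeff_tens coeff0 (bigD1 i) //= f0 coeff0.
by rewrite mul0r.
Qed.

Lemma tensZ f i c x : tens (upd f i (c *: x)) = c *: tens (upd f i x).
Proof. by have := @tens_linear f i c x 0; rewrite [tens (upd f i 0)](@tens0 _ i) ?upd_in // !addr0. Qed.

Lemma tens_basis b : tens (fun i => << b i >>) = << b >>.
Proof.
apply: freegP => b'; rewrite coeff_tens coeff_basis.
under eq_bigr do rewrite coeff_basis.
have [<-|ne] := eqVneq b b'; first by rewrite big1 // => i _; rewrite eqxx.
have [i ni|e] := pickP (fun i => b i != b' i); first by rewrite (bigD1 i) //= (negPf ni) mul0r.
by case/eqP: ne; apply/ffunP => i; apply/eqP/negbFE/e.
Qed.

Lemma upd_hom d f i x : (forall l, hom (d l) (f l)) -> hom (d i) x ->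
  forall l, hom (d l) (upd f i x l).
Proof.
by move=> hf hx l; have [e|ne] := eqVneq i l; [case: _ / e; rewrite upd_in | rewrite upd_out].
Qed.

(** Induction on m, where the slots of index at least m already hold basis elements: slot m is
    expanded by linearity, which leaves the other slots untouched. *)
Lemma multi_ind d (P : Pi -> Prop) :
  (forall b, (forall i, hdeg (b i) = d i) -> P (fun i => << b i >>)) ->
  (forall f i, (forall l, hom (d l) (f l)) -> P (upd f i 0)) ->
  (forall f i c x y, (forall l, hom (d l) (f l)) -> hom (d i) x -> hom (d i) y ->
     P (upd f i x) -> P (upd f i y) -> P (upd f i (c *: x + y))) ->
  forall f, (forall i, hom (d i) (f i)) -> P f.
Proof.
move=> Pb P0 PL f hf.
suff main : forall m f, (forall i, hom (d i) (f i)) ->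
    (forall i : 'I_r, (m <= i)%N -> exists2 a, f i = << a >> & hdeg a = d i) -> P f.
  by apply: (main r) => // i; rewrite leqNgt ltn_ord.
move=> {f hf}; elim=> [|m IHm] f hf fb.
  have /fin_all_exists[b hb] : forall i, exists a : gen (F i), f i = << a >> /\ hdeg a = d i.
    by move=> i; have [a] := fb i isT; exists a.
  have -> : f = fun i => << ([ffun i : 'I_r => b i] : tgen F) i >>.
    by apply: functional_extensionality_dep => i; rewrite ffunE; case: (hb i).
  by apply: Pb => i; rewrite ffunE; case: (hb i).
have [lt|ge] := ltnP m r; last first.
  by apply: IHm => // i le; have := leq_trans ge le; rewrite leqNgt ltn_ord.
pose i := Ordinal lt; rewrite -(upd_id f i).
suff: forall x, hom (d i) x -> P (upd f i x) by apply.
apply: freeg_ind_in => [|c a x ha hx Px]; first exact: P0.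
have ha' : hom (d i) << a >> by rewrite -ha; apply: hom_basis.
apply: PL => //; apply: IHm => [|j le]; first exact: upd_hom.
have [e|ne] := eqVneq i j; first by case: _ / e; exists a; rewrite ?upd_in.
rewrite upd_out //; apply: fb; rewrite ltn_neqAle le andbT.
by apply: contraNneq ne => e; apply/eqP/val_inj.
Qed.

End Tensor.

Section LiftHomogeneous.
Variables (k : fieldType) (n : nat).
Local Notation elem A := {freeg (gen A) / {mpoly k[n]}}.
Implicit Types (A B : dgData k n).

Lemma fglift_expand A B (f : gen A -> elem B) x :
  fglift f x = \sum_(a <- dom x) coeff a x *: f a.
Proof.
rewrite {1}[x]freeg_expand (lin_sum (fglift_linear f)).
by apply: eq_bigr => a _; rewrite (linZ (fglift_linear f)) fglift_basis.
Qed.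

(** The shift u is 0 for the differential and the multidegree of the other factor for the
    product. *)
Lemma fglift_bihomog A B (f : gen A -> elem B) d d' m u x :
  (forall a, hdeg a = d -> is_bihomog d' (multideg a + u)%MM (f a)) ->
  is_bihomog d m x -> is_bihomog d' (m + u)%MM (fglift f x).
Proof.
move=> hf hx; rewrite fglift_expand big_seq.
apply: bihomog_sum => a; rewrite mem_dom => nz.
have h := bihomog_bnd hx.
have [|ha le] := h a.
  rewrite coeff_ev; apply: contraNneq nz => e.
  by rewrite (coeff_mhomog a (bihomog_mhomog hx)) e scale0r.
rewrite (coeff_mhomog a (bihomog_mhomog hx)) -mul_mpolyC -scalerA.
rewrite -[in X in is_bihomog _ X](submK le) -addmA.
by apply: bihomogZ; apply: bihomogZX; apply: hf.
Qed.

Lemma bihomog_sign A d m (x : elem A) j :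
  is_bihomog d m x -> is_bihomog d m ((-1) ^+ j *: x).
Proof.
have -> : ((-1) ^+ j : {mpoly k[n]}) = ((-1) ^+ j)%:MP by rewrite rmorphXn rmorphN1.
exact: bihomogZ.
Qed.

End LiftHomogeneous.

(** * Differential and product of the Taylor resolution on pure tensors *)

Section Taylor.
Variables (k : fieldType) (n r : nat) (F : 'I_r -> dgData k n).
Hypothesis HF : forall i, is_dgAlgebra (F i).
Local Notation elem A := {freeg (gen A) / {mpoly k[n]}}.
Local Notation velem A := {freeg (gen A) / k}.
Local Notation V := (fun i : 'I_r => velem (F i)).
Local Notation W := (velem (taylor F)).
Local Notation upd f i x := (@dfwith _ V f i x).
Local Notation "'Pi'" := (forall i : 'I_r, velem (F i)).
Implicit Types (b : tgen F) (d : 'I_r -> nat) (f : Pi).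
Let HP i := dg_pre (HF i).

Lemma star_bihomog d m (f : forall i, elem (F i)) :
  (forall i, is_bihomog (d i) (m i) (f i)) ->
  @is_bihomog _ _ (taylor F) (\sum_(i < r) d i) (lcms m) (star m f).
Proof.
move=> hf; rewrite starE => [|i]; last exact: bihomog_mhomog (hf i).
by apply: hmg_bihomog; apply: bnd_tens => i; apply: bihomog_bnd.
Qed.

Lemma ev_star m (f : forall i, elem (F i)) : (forall i, is_mhomog (m i) (f i)) ->
  @ev _ _ (taylor F) (star m f) = tens (fun i => ev (f i)).
Proof. by move=> hf; rewrite starE // hmgK. Qed.

Lemma sum_dfwith d i x : (\sum_(l < r) @dfwith _ (fun=> nat) d i x l + d i = \sum_(l < r) d l + x)%N.
Proof.
rewrite (bigD1 i) //= dfwith_in [in RHS](bigD1 i) //=.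
rewrite (eq_bigr d) => [|l ne]; first by rewrite addnAC [(x + _)%N]addnC addnAC.
by rewrite dfwith_out // eq_sym.
Qed.

Definition before d (i : 'I_r) : nat := (\sum_(l < r | l < i) d l)%N.

Lemma dfwith_ev (f : forall i, elem (F i)) i (x : elem (F i)) :
  (fun l => ev (@dfwith _ (fun l => elem (F l)) f i x l)) =
  upd (fun l => ev (f l)) i (ev x).
Proof.
apply: functional_extensionality_dep => l; have [e|ne] := eqVneq i l.
  by case: _ / e; rewrite !dfwith_in.
by rewrite !dfwith_out.
Qed.

Lemma dfwith_bihomog d m (f : forall i, elem (F i)) i e u x :
  (forall l, is_bihomog (d l) (m l) (f l)) -> is_bihomog e u x ->
  forall l, is_bihomog (@dfwith _ (fun=> nat) d i e l)
     (@dfwith _ (fun=> 'X_{1..n}) m i u l) (@dfwith _ (fun l => elem (F l)) f i x l).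
Proof.
move=> hf hx l; have [e'|ne] := eqVneq i l.
  by case: _ / e'; rewrite !dfwith_in.
by rewrite !dfwith_out.
Qed.

Lemma dfwith_same (T : Type) (h : 'I_r -> T) i : @dfwith _ (fun=> T) h i (h i) = h.
Proof.
apply: functional_extensionality => l; have [<-|ne] := eqVneq i l.
  by rewrite dfwith_in.
by rewrite dfwith_out.
Qed.

Lemma basis_bihomog b i : @is_bihomog _ _ (F i) (hdeg (b i)) (multideg (b i)) << b i >>.
Proof. exact: bihomog_basis. Qed.
Arguments basis_bihomog b i : clear implicits.

Lemma tdiff_term_bihomog b i :
  @is_bihomog _ _ (taylor F) (thdeg b).-1 (tmultideg b)
  (star (fun l => multideg (b l))
      (@dfwith _ (fun l => elem (F l)) (fun l => << b l >>) i (diff << b i >>))).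
Proof.
have hd := diff_bihomog_pred (HP i) (basis_bihomog b i).
have := dfwith_bihomog (basis_bihomog b) hd; rewrite dfwith_same => h.
(* In degree 0 the truncated predecessor does not lower the total degree, but the term vanishes
   because the differential does. *)
have [h0|pos] := posnP (hdeg (b i)).
  rewrite starE; last by move=> l; apply: bihomog_mhomog (h l).
  rewrite (@tens0 _ _ _ _ _ i) ?hmg0 ?dfwith_in; first exact: bihomog0.
  by rewrite (dg_diff_bottom (HF i)) ?ev0 // -h0; apply: basis_homog.
have := star_bihomog h; rewrite -[thdeg b](addnK (hdeg (b i))).
rewrite /thdeg -(sum_dfwith (fun l => hdeg (b l)) i (hdeg (b i))) dfwith_same addnK.
suff -> : (\sum_(i0 < r) @dfwith _ (fun=> nat) (fun l => hdeg (b l)) i (hdeg (b i)).-1 i0)%N =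
  (\sum_(l < r) hdeg (b l)).-1 by [].
have := sum_dfwith (fun l => hdeg (b l)) i (hdeg (b i)).-1.
set X := (\sum_(_ < r) _)%N; set S := (\sum_(_ < r) _)%N.
case: (hdeg (b i)) pos => //= e _; rewrite addnS -addSn => /addIn.
by move=> <-.
Qed.

Lemma tdiff_gen_bihomog b :
  @is_bihomog _ _ (taylor F) (thdeg b).-1 (tmultideg b) (tdiff_gen b).
Proof.
apply: bihomog_sum => i _; apply: bihomog_sign; exact: tdiff_term_bihomog.
Qed.

Lemma ev_tdiff_gen b : @ev _ _ (taylor F) (tdiff_gen b) =
  \sum_(i < r) (-1) ^+ before (fun l => hdeg (b l)) i *:
     tens (upd (fun l => << b l >>) i (vdiff << b i >>)).
Proof.
rewrite /tdiff_gen (@ev_sum _ _ (taylor F)); apply: eq_bigr => i _.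
rewrite (@evZ _ _ (taylor F)) at1_sign; congr (_ *: _).
have hd := diff_bihomog_pred (HP i) (basis_bihomog b i).
have := dfwith_bihomog (basis_bihomog b) hd; rewrite dfwith_same => h.
rewrite ev_star => [|l]; last exact: bihomog_mhomog (h l).
congr tens; rewrite dfwith_ev.
rewrite (ev_diff (HP i)) ev_basis.
have -> // : (fun l => ev << b l >>) = (fun l => << b l >>) :> Pi.
by apply: functional_extensionality_dep => l; rewrite ev_basis.
Qed.

(* The Koszul sign exponent: the factor d'_i moves past d_j for all j > i. *)
Definition crossing (d d' : 'I_r -> nat) : nat :=
  (\sum_(i < r) (d' i * (\sum_(j < r | i < j) d j)))%N.

(** This makes the division in the product formula a genuine one: the tensor of the slotwise
    products is bounded by the multidegree at which it is homogenized. *)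
Lemma lcms_le_add b b' :
  (lcms (fun i => multideg (b i) + multideg (b' i)) <= tmultideg b + tmultideg b')%MM.
Proof.
by apply/lem_lcms => i; apply: lem_add; apply: (le_lcms (fun i => multideg (_ i))).
Qed.

Lemma mul_basis_bihomog b b' i :
  @is_bihomog _ _ (F i) (hdeg (b i) + hdeg (b' i)) (multideg (b i) + multideg (b' i))%MM
     (mul << b i >> << b' i >>).
Proof. by apply: (dg_mul_bihomog (HF i)); apply: bihomog_basis. Qed.
Arguments mul_basis_bihomog b b' i : clear implicits.

Lemma tmul_genE b b' : tmul_gen b b' =
  (-1) ^+ crossing (fun i => hdeg (b i)) (fun i => hdeg (b' i)) *:
  @hmg _ _ (taylor F) (tmultideg b + tmultideg b')%MM
     (tens (fun i => vmul << b i >> << b' i >>)).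
Proof.
rewrite /tmul_gen star_numE => [|i]; last exact: bihomog_mhomog (mul_basis_bihomog b b' i).
congr (_ *: hmg _ (tens _)); apply: functional_extensionality_dep => i.
by rewrite (ev_mul (HP i)) !ev_basis.
Qed.

Lemma tmul_gen_bihomog b b' :
  @is_bihomog _ _ (taylor F) (thdeg b + thdeg b') (tmultideg b + tmultideg b')%MM (tmul_gen b b').
Proof.
rewrite tmul_genE; apply: bihomog_sign; apply: hmg_bihomog.
apply: bnd_le (lcms_le_add b b') _; rewrite /thdeg -big_split.
by apply: bnd_tens => i; apply: (vmul_bnd (HP i)); apply: bnd_basis.
Qed.

Lemma taylor_finite e : exists s : seq (tgen F), forall b, thdeg b = e -> b \in s.
Proof.
have /fin_all_exists[D hD] : forall i, exists s : seq (gen (F i)),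
    forall a, (hdeg a <= e)%N -> a \in s.
  move=> i; elim: e => [|e [s hs]].
    have [s hs] := dg_finite (HF i) 0; exists s => a; rewrite leqn0 => /eqP; exact: hs.
  have [s' hs'] := dg_finite (HF i) e.+1; exists (s ++ s') => a.
  rewrite leq_eqVlt mem_cat => /orP[/eqP/hs'->|]; first by rewrite orbT.
  by rewrite ltnS => /hs->.
exists [seq ([ffun i : 'I_r => val (s i) : gen (F i)] : tgen F) |
         s : {dffun forall i : 'I_r, seq_sub (D i)}] => b hb.
have bD i : b i \in D i.
  by apply: hD; rewrite -hb /thdeg (bigD1 i) //= leq_addr.
apply/imageP; exists [ffun i : 'I_r => SeqSub (bD i)] => //.
by apply/ffunP => i; rewrite !ffunE.
Qed.

Lemma taylor_pre : is_pre (taylor F).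
Proof.
split.
- exact: taylor_finite.
- exact: fglift_linear.
- move=> e m x; rewrite -[m in X in _ -> X]addm0; apply: (@fglift_bihomog _ _ (taylor F)).
  by move=> b hb; rewrite addm0 -[e]/(e.+1.-1) -hb; apply: tdiff_gen_bihomog.
- have dL : linear (@diff _ _ (taylor F)) by exact: fglift_linear.
  apply: freeg_ind_in => [|c b x hb _ IHx]; first by rewrite (lin0 dL).
  rewrite dL IHx addr0 -[RHS](scaler0 _ c); congr (_ *: _).
  rewrite /= fglift_basis /tdiff_gen big1 // => i _.
  have h0 : hdeg (b i) = 0%N.
    by apply/eqP; rewrite -leqn0 -hb /= /thdeg (bigD1 i) //= leq_addr.
  have hd := diff_bihomog_pred (HP i) (basis_bihomog b i).
  have := dfwith_bihomog (basis_bihomog b) hd; rewrite dfwith_same => h.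
  rewrite starE; last by move=> l; apply: bihomog_mhomog (h l).
  rewrite (@tens0 _ _ _ _ _ i) ?hmg0 ?scaler0 ?dfwith_in //.
  by rewrite (dg_diff_bottom (HF i)) ?ev0 // -h0; apply: basis_homog.
- by move=> y; apply: fglift_linear.
- move=> x c y z /=; rewrite !(@fglift_expand _ _ (taylor F) (taylor F)) scaler_sumr -big_split.
  apply: eq_bigr => b _ /=; rewrite fglift_linear scalerDr !scalerA.
  by rewrite [_ * c]mulrC.
- move=> d1 d2 m1 m2 x y hx hy /=.
  apply: fglift_bihomog hx => b hb; rewrite addmC.
  apply: fglift_bihomog hy => b' hb'; rewrite addmC -hb -hb'.
  exact: tmul_gen_bihomog.
- have -> : 0%N = \sum_(i < r) 0%N by rewrite big1.
  have -> : 0%MM = lcms (fun _ : 'I_r => 0%MM : 'X_{1..n}).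
    by apply/esym; rewrite /lcms; elim/big_ind: _ => // u v -> ->; rewrite mlc0m.
  by apply: star_bihomog => i; apply: (dg_one_bihomog (HF i)).
Qed.

Let TP := taylor_pre.

Lemma vone_taylor : vone (taylor F) = tens (fun i => vone (F i)).
Proof.
by rewrite /vone /= ev_star // => i; apply: bihomog_mhomog (dg_one_bihomog (HF i)).
Qed.

Lemma vmul_taylor_basis b b' : vmul (<< b >> : W) << b' >> =
  (-1) ^+ crossing (fun i => hdeg (b i)) (fun i => hdeg (b' i)) *:
  tens (fun i => vmul << b i >> << b' i >>).
Proof.
rewrite /vmul !(@up_basis _ _ (taylor F)) /= !fglift_basis tmul_genE.
by rewrite (@evZ _ _ (taylor F)) at1_sign (@hmgK _ _ (taylor F)).
Qed.

Lemma vmul_upd_r f f' i x :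
  (fun l => vmul (f l) (upd f' i x l)) = upd (fun l => vmul (f l) (f' l)) i (vmul (f i) x).
Proof.
apply: functional_extensionality_dep => l; have [e|ne] := eqVneq i l.
  by case: _ / e; rewrite !dfwith_in.
by rewrite !dfwith_out.
Qed.

Lemma vmul_upd_l f f' i x :
  (fun l => vmul (upd f i x l) (f' l)) = upd (fun l => vmul (f l) (f' l)) i (vmul x (f' i)).
Proof.
apply: functional_extensionality_dep => l; have [e|ne] := eqVneq i l.
  by case: _ / e; rewrite !dfwith_in.
by rewrite !dfwith_out.
Qed.

(** The Koszul sign depends on the degrees alone, hence stays constant while each slot is expanded
    linearly from the basis, where the formula is the definition. *)
Lemma vmul_tens d d' f f' : (forall i, hom (d i) (f i)) -> (forall i, hom (d' i) (f' i)) ->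
  vmul (tens f) (tens f') = (-1) ^+ crossing d d' *: tens (fun i => vmul (f i) (f' i)).
Proof.
move=> hf hf'; move: f hf; apply: multi_ind => [b hb|f i _|f i c x y _ _ _ IHx IHy].
- move: f' hf'; apply: multi_ind => [b' hb'|f' i _|f' i c x y _ _ _ IHx IHy].
  + rewrite !tens_basis vmul_taylor_basis; congr ((-1) ^+ _ *: _).
    by apply: eq_bigr => i _; rewrite hb'; congr (_ * _)%N; apply: eq_bigr => j _; rewrite hb.
  + rewrite [tens (upd _ _ _)](@tens0 _ _ _ _ _ i) ?upd_in // (lin0 (vmul_linearr TP _)).
    by rewrite (@tens0 _ _ _ _ _ i) ?scaler0 // upd_in (lin0 (vmul_linearr (HP i) _)).
  + rewrite tens_linear (vmul_linearr TP) IHx IHy !vmul_upd_r (vmul_linearr (HP i)).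
    by rewrite tens_linear scalerDr !scalerA [c * _]mulrC.
- rewrite [tens (upd _ _ _)](@tens0 _ _ _ _ _ i) ?upd_in // (lin0 (vmul_linearl TP _)).
  by rewrite (@tens0 _ _ _ _ _ i) ?scaler0 // upd_in (lin0 (vmul_linearl (HP i) _)).
- rewrite tens_linear (vmul_linearl TP) IHx IHy !vmul_upd_l (vmul_linearl (HP i)).
  by rewrite tens_linear scalerDr !scalerA [c * _]mulrC.
Qed.

Lemma vdiff_tens d f : (forall i, hom (d i) (f i)) ->
  vdiff (tens f) = \sum_(i < r) (-1) ^+ before d i *: tens (upd f i (vdiff (f i))).
Proof.
move: f; apply: multi_ind => [b hb|f i _|f j c x y _ _ _ IHx IHy].
- rewrite tens_basis /vdiff (@up_basis _ _ (taylor F)) /= fglift_basis ev_tdiff_gen.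
  apply: eq_bigr => i _; congr ((-1) ^+ _ *: _); apply: eq_bigr => l _; exact: hb.
- rewrite (@tens0 _ _ _ _ _ i) ?upd_in // (lin0 (vdiff_linear TP)).
  rewrite big1 // => l _; rewrite (@tens0 _ _ _ _ _ i) ?scaler0 //.
  have [e|ne] := eqVneq l i; last by rewrite upd_out // upd_in.
  by case: _ / e; rewrite !upd_in (lin0 (vdiff_linear (HP l))).
- rewrite tens_linear (vdiff_linear TP) IHx IHy scaler_sumr -big_split.
  apply: eq_bigr => i _ /=; rewrite !scalerA [c * _]mulrC -!scalerA -scalerDr; congr (_ *: _).
  have [e|ne] := eqVneq i j.
    by case: _ / e in x y {IHx IHy} *; rewrite !upd_in !upd_upd (vdiff_linear (HP i)) tens_linear.
  rewrite !(upd_out _ _ (j := i)) 1?eq_sym // !(@upd_comm _ _ _ _ _ j i) 1?eq_sym //.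
  by rewrite tens_linear.
Qed.

End Taylor.

(** * Arithmetic of the Koszul sign exponents *)

Section Signs.
Variable r : nat.
Implicit Types (d : 'I_r -> nat).

Lemma sign_parity (R : pzRingType) a b : odd a = odd b -> (-1) ^+ a = (-1) ^+ b :> R.
Proof. by move=> e; rewrite -signr_odd e signr_odd. Qed.

Lemma signrr (R : pzRingType) a : (-1) ^+ a * (-1) ^+ a = 1 :> R.
Proof. by rewrite -exprD -signr_odd addnn odd_double. Qed.

Definition after d (i : 'I_r) : nat := (\sum_(j < r | i < j) d j)%N.

Lemma crossingDl d1 d2 d :
  (crossing (fun i => d1 i + d2 i) d = crossing d1 d + crossing d2 d)%N.
Proof.
rewrite /crossing -big_split; apply: eq_bigr => i _ /=.
by rewrite big_split /= mulnDr.
Qed.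

Lemma crossingDr d1 d2 d :
  (crossing d (fun i => d1 i + d2 i) = crossing d d1 + crossing d d2)%N.
Proof. by rewrite /crossing -big_split; apply: eq_bigr => i _ /=; rewrite mulnDl. Qed.

Lemma beforeD d1 d2 i : (before (fun i => d1 i + d2 i) i = before d1 i + before d2 i)%N.
Proof. exact: big_split. Qed.

Lemma before_after d i : (\sum_(j < r) d j = before d i + d i + after d i)%N.
Proof.
rewrite (bigD1 i) //= (bigID (fun j : 'I_r => (j < i)%N)) /= addnA [(d i + _)%N]addnC.
congr (_ + _ + _)%N; apply: eq_bigl => j; rewrite -val_eqE /=; case: ltngtP => //.
Qed.

Lemma crossing0l d : crossing (fun=> 0%N) d = 0%N.
Proof. by rewrite /crossing big1 // => i _; rewrite big1 ?muln0. Qed.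

Lemma crossing0r d : crossing d (fun=> 0%N) = 0%N.
Proof. by rewrite /crossing big1 // => i _. Qed.

(** The product of the two sums is split over pairs (i, j) with i > j, i < j and i = j. The diagonal
    is the exponent produced by commuting slot by slot. *)
Lemma crossing_sym d d' :
  (crossing d d' + crossing d' d + \sum_(i < r) d i * d' i =
   (\sum_(i < r) d i) * (\sum_(i < r) d' i))%N.
Proof.
rewrite big_distrlr /=.
have -> : crossing d d' = (\sum_(i < r) \sum_(j < r | j < i) d i * d' j)%N.
  rewrite (exchange_big_dep predT) //=; apply: eq_bigr => i _.
  by rewrite big_distrr /=; apply: eq_bigr => j _; rewrite mulnC.
have -> : crossing d' d = (\sum_(i < r) \sum_(j < r | i < j) d i * d' j)%N.
  by apply: eq_bigr => i _; rewrite big_distrr.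
rewrite -!big_split; apply: eq_bigr => i _ /=.
rewrite [RHS](bigD1 i) //= [in RHS](bigID (fun j : 'I_r => (j < i)%N)) /= addnC.
congr (_ + (_ + _))%N; apply: eq_bigl => j; rewrite -val_eqE /=; case: ltngtP => //.
Qed.

(** The unit vector at i, the amount by which the differential in slot i lowers the degrees. *)
Definition delta_deg (i : 'I_r) : 'I_r -> nat := fun j => (i == j).

Lemma dfwith_pred d i : (0 < d i)%N ->
  d = (fun j => @dfwith _ (fun=> nat) d i (d i).-1 j + delta_deg i j)%N.
Proof.
move=> pos; apply: functional_extensionality => j; rewrite /delta_deg.
have [<-|ne] := eqVneq i j; first by rewrite dfwith_in addn1 prednK.
by rewrite dfwith_out // addn0.
Qed.

Lemma before_delta i j : before (delta_deg i) j = (i < j)%N.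
Proof.
rewrite /before /delta_deg; have [lt|ge] := boolP (i < j)%N.
  by rewrite (bigD1 i) //= eqxx big1 // => l /andP[_ /negPf]; rewrite eq_sym => ->.
rewrite big1 // => l lt; case: eqP => // e; by rewrite e lt in ge.
Qed.

Lemma crossing_deltal i d : crossing (delta_deg i) d = before d i.
Proof.
rewrite /crossing /before.
under eq_bigr do rewrite big_distrr /=.
rewrite (exchange_big_dep predT) //= (bigD1 i) //= [X in (_ + X)%N]big1 => [|j ne].
  rewrite addn0 /delta_deg eqxx; apply: eq_bigr => l _; by rewrite muln1.
by rewrite big1 // => l _; rewrite /delta_deg eq_sym (negPf ne) muln0.
Qed.

Lemma crossing_deltar i d : crossing d (delta_deg i) = after d i.
Proof.
rewrite /crossing (bigD1 i) //= [X in (_ + X)%N]big1 => [|j ne].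
  by rewrite addn0 /delta_deg eqxx mul1n.
by rewrite /delta_deg eq_sym (negPf ne).
Qed.

End Signs.

(** * The DG algebra identities on the tensor product *)

Section TaylorAlgebra.
Variables (k : fieldType) (n r : nat) (F : 'I_r -> dgData k n).
Hypothesis HF : forall i, is_dgAlgebra (F i).
Local Notation velem A := {freeg (gen A) / k}.
Local Notation V := (fun i : 'I_r => velem (F i)).
Local Notation W := (velem (taylor F)).
Local Notation upd f i x := (@dfwith _ V f i x).
Local Notation "'Pi'" := (forall i : 'I_r, velem (F i)).
Implicit Types (b : tgen F) (d : 'I_r -> nat) (f : Pi).
Let HP i := dg_pre (HF i).
Let HV i := dg_vdga (HF i).
Let TP := taylor_pre HF.

Lemma tens_scale (c : 'I_r -> k) f :
  tens (fun i => c i *: f i) = (\prod_(i < r) c i) *: tens f.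
Proof.
apply: freegP => b; rewrite coeffZ !coeff_tens -big_split; apply: eq_bigr => i _.
by rewrite coeffZ.
Qed.

Lemma hom_basis_slot b i : hom (hdeg (b i)) (<< b i >> : velem (F i)).
Proof. exact: hom_basis. Qed.
Arguments hom_basis_slot b i : clear implicits.

Lemma hom_vdiff_pred d f i : (forall l, hom (d l) (f l)) ->
  forall l, hom (@dfwith _ (fun=> nat) d i (d i).-1 l) (upd f i (vdiff (f i)) l).
Proof.
move=> hf l; have [e|ne] := eqVneq i l; last by rewrite !dfwith_out.
case: _ / e; rewrite !dfwith_in; have := hf i.
case: (d i) => [|e] h; last exact: (vdiff_hom (HP i)).
by rewrite (vdiff_bottom (HP i)) //; apply: hom0.
Qed.

Lemma before_pred d i j : (0 < d i)%N ->
  (before d j = before (@dfwith _ (fun=> nat) d i (d i).-1) j + (i < j))%N.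
Proof.
by move=> pos; rewrite [in LHS](dfwith_pred pos) beforeD before_delta.
Qed.

(** In the double sum of the [t i j] the diagonal vanishes slotwise. Off the diagonal [t i j] and
    [t j i] are the same tensor with opposite signs, since lowering slot i changes the sign of slot
    j exactly when i < j. *)
Lemma taylor_diff_diff (x : W) : vdiff (vdiff x) = 0.
Proof.
have dL := vdiff_linear TP.
elim/freeg_ind: x => [|c b x IHx]; first by rewrite !(lin0 dL).
rewrite !dL IHx addr0 -[RHS](scaler0 _ c) -tens_basis; congr (_ *: _) => {c x IHx}.
pose d i := hdeg (b i); pose f i : velem (F i) := << b i >>.
have hf i : hom (d i) (f i) by apply: hom_basis.
rewrite (vdiff_tens HF hf) (lin_sum dL).
pose t i j := (-1) ^+ before d i *: ((-1) ^+ before (@dfwith _ (fun=> nat) d i (d i).-1) j *: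
   tens (upd (upd f i (vdiff (f i))) j (vdiff (upd f i (vdiff (f i)) j)))).
rewrite (eq_bigr (fun i => \sum_(j < r) t i j)) => [|i _]; last first.
  by rewrite (linZ dL) (vdiff_tens HF (hom_vdiff_pred (i := i) hf)) scaler_sumr.
have t_diag i : t i i = 0.
  by rewrite /t (@tens0 _ _ _ _ _ i) ?scaler0 // !upd_in (v_diff_diff (HV i)).
have t_anti (i j : 'I_r) : (i < j)%N -> t i j = - t j i.
  move=> lt; have ne : i != j by rewrite -val_eqE neq_ltn lt.
  have ne' : j != i by rewrite eq_sym.
  rewrite /t !upd_out // (@upd_comm _ _ _ _ f i j) //.
  (* Degree 0 is set apart because [before_pred] fails for the truncated predecessor; both terms
     then vanish. *)
  have [d0|pos] := posnP (d i).
    have z : vdiff (f i) = 0 by apply: (vdiff_bottom (HP i)); rewrite -d0.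
    by rewrite (@tens0 _ _ _ _ _ i) ?upd_in // !scaler0 oppr0.
  have [d0|pos'] := posnP (d j).
    have z : vdiff (f j) = 0 by apply: (vdiff_bottom (HP j)); rewrite -d0.
    by rewrite (@tens0 _ _ _ _ _ j) ?scaler0 ?oppr0 // upd_out // upd_in.
  rewrite !scalerA -!exprD -scaleNr (before_pred j pos) (before_pred i pos') lt.
  rewrite ltnNge (ltnW lt) addn0 addn1.
  congr (_ *: _); rewrite -[RHS]mulN1r -exprS; apply: sign_parity.
  by rewrite /= !(oddD, oddS) /=; do 2!case: (odd _).
rewrite (eq_bigr (fun i : 'I_r => \sum_(j < r | (i < j)%N) t i j + \sum_(j < r | (j < i)%N) t i j)).
  rewrite big_split /= [X in _ + X](exchange_big_dep predT) //= -big_split big1 // => i _.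
  by rewrite -big_split big1 // => j lt /=; rewrite t_anti // addNr.
move=> i _; rewrite (bigD1 i) //= t_diag add0r (bigID (fun j : 'I_r => (i < j)%N)) /=.
congr (_ + _); apply: eq_bigl => j; rewrite -val_eqE /=; case: ltngtP => //.
Qed.

(** Since [crossing] is additive in each argument, both bracketings carry the same three exponents,
    and the slots are associative. *)
Lemma taylor_mulA : associative (@vmul _ _ (taylor F)).
Proof.
have mL := vmul_linearl TP; have mR := vmul_linearr TP.
move=> x y z; elim/freeg_ind: z => [|c a z IHz]; first by rewrite !(lin0 (mR _)).
rewrite !mR IHz; congr (_ *: _ + _) => {z IHz}.
apply: (@basis_ind2 _ _ _ _ (fun x y => vmul x (vmul y << a >>))
  (fun x y => vmul (vmul x y) << a >>)
   (fun _ => True)) => [u c' v w|v c' u w|u c' v w|v c' u w|u v _|//].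
- by rewrite mL mR.
- by rewrite mL.
- by rewrite mR mL.
- by rewrite !mL.
rewrite -!tens_basis !(vmul_tens HF (hom_basis_slot _) (hom_basis_slot _)).
rewrite (linZ (mL _)) (linZ (mR _)).
rewrite (vmul_tens HF (hom_basis_slot u) (fun i =>
   vmul_hom (HP i) (hom_basis_slot v i) (hom_basis_slot a i))).
rewrite (vmul_tens HF (fun i =>
   vmul_hom (HP i) (hom_basis_slot u i) (hom_basis_slot v i)) (hom_basis_slot a)).
rewrite !scalerA -!exprD crossingDl crossingDr; congr (_ *: tens _).
  by apply: sign_parity; rewrite !oddD; do 3!case: (odd _).
by apply: functional_extensionality_dep => i; rewrite (v_mulA (HV i)).
Qed.

Lemma hom_vone i : hom 0 (vone (F i)).
Proof. exact: vone_hom (HP i). Qed.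
Arguments hom_vone i : clear implicits.

Lemma taylor_mul1 : left_id (vone (taylor F)) (@vmul _ _ (taylor F)).
Proof.
elim/freeg_ind => [|c b x IHx]; first by rewrite (lin0 (vmul_linearr TP _)).
rewrite (vmul_linearr TP) IHx vone_taylor // -tens_basis.
rewrite (vmul_tens HF hom_vone (hom_basis_slot b)) crossing0l scale1r.
congr (_ *: tens _ + _); apply: functional_extensionality_dep => i.
by rewrite (v_mul1 (HV i)).
Qed.

Lemma taylor_mulr1 : right_id (vone (taylor F)) (@vmul _ _ (taylor F)).
Proof.
elim/freeg_ind => [|c b x IHx]; first by rewrite (lin0 (vmul_linearl TP _)).
rewrite (vmul_linearl TP) IHx vone_taylor // -tens_basis.
rewrite (vmul_tens HF (hom_basis_slot b) hom_vone) crossing0r scale1r.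
congr (_ *: tens _ + _); apply: functional_extensionality_dep => i.
by rewrite (v_mulr1 (HV i)).
Qed.

(** Commuting every slot produces the diagonal exponent of [crossing_sym], the only part of the
    total exponent not already present in the two product signs. *)
Lemma taylor_comm e e' (x y : W) : hom e x -> hom e' y ->
  vmul x y = (-1) ^+ (e * e') *: vmul y x.
Proof.
have mL := vmul_linearl TP; have mR := vmul_linearr TP.
move=> hx hy; move: x hx; apply: freeg_ind_in => [|c b x hb _ IHx].
  by rewrite (lin0 (mL _)) (lin0 (mR _)) scaler0.
rewrite mL mR IHx scalerDr; congr (_ + _).
rewrite scalerA mulrC -scalerA; congr (_ *: _).
move: y hy {IHx}; apply: freeg_ind_in => [|c' b' y hb' _ IHy].
  by rewrite (lin0 (mL _)) (lin0 (mR _)) scaler0.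
rewrite mL mR IHy scalerDr; congr (_ + _).
rewrite scalerA mulrC -scalerA; congr (_ *: _).
rewrite -!tens_basis !(vmul_tens HF (hom_basis_slot _) (hom_basis_slot _)).
rewrite -[e]hb -[e']hb' -crossing_sym.
have -> : (fun i => vmul << b i >> << b' i >>) =
    (fun i => (-1) ^+ (hdeg (b i) * hdeg (b' i)) *: vmul << b' i >> << b i >>) :> Pi.
  apply: functional_extensionality_dep => i.
  by rewrite (v_comm (HV i) (hom_basis_slot b i) (hom_basis_slot b' i)).
rewrite tens_scale -(@big_morph _ _ (fun i => (-1) ^+ i : k) 1 *%R 0%N addn) //; last first.
  by move=> i j; rewrite exprD.
rewrite !scalerA -!exprD; congr (_ *: _); apply: sign_parity.
by rewrite !oddD; do 3!case: (odd _).
Qed.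

(** Anticommutativity does not suffice in characteristic 2. A basis tensor of odd total degree has
    an odd slot, whose square is zero; cross terms cancel in pairs. *)
Lemma taylor_sqr0 e (x : W) : hom e x -> odd e -> vmul x x = 0.
Proof.
have mL := vmul_linearl TP; have mR := vmul_linearr TP.
move=> + od; move: x; apply: freeg_ind_in => [|c b x hb hx IHx].
  by rewrite (lin0 (mL _)).
have hb' : hom e (<< b >> : W) by rewrite -hb; apply: (@hom_basis _ _ (taylor F)).
rewrite mL !mR IHx addr0 (taylor_comm hx hb').
rewrite -signr_odd oddM od expr1 scaleN1r scalerN scalerDr -addrA subrr addr0.
rewrite -[RHS](scaler0 _ (c * c)) scalerA; congr (_ *: _).
rewrite -tens_basis (vmul_tens HF (hom_basis_slot _) (hom_basis_slot _)).
have [i odi|ev_all] := pickP (fun i => odd (hdeg (b i))).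
  by rewrite (@tens0 _ _ _ _ _ i) ?scaler0 // (v_sqr0 (HV i) (hom_basis_slot b i)).
move: od; rewrite -hb /= /thdeg (big_morph odd oddD (erefl _ : odd 0 = false)) big1 //.
Qed.

(** The identity holds separately for the differential in each slot i. The sign of its second half
    uses that the total degree is what lies before, in and after slot i. *)
Lemma taylor_leibniz e (x y : W) : hom e x ->
  vdiff (vmul x y) = vmul (vdiff x) y + (-1) ^+ e *: vmul x (vdiff y).
Proof.
have mL := vmul_linearl TP; have mR := vmul_linearr TP; have dL := vdiff_linear TP.
move=> hx.
apply: (@basis_ind2 _ _ _ _ (fun x y : W => vdiff (vmul x y))
    (fun x y => vmul (vdiff x) y + (-1) ^+ e *: vmul x (vdiff y))
     (fun a : tgen F => thdeg a = e)) hx => [u c' v w|v c' u w|u c' v w|v c' u w|b b' hb].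
- by rewrite mR dL.
- by rewrite mL dL.
- by rewrite dL !mR !scalerDr !scalerA addrACA [c' * _]mulrC.
- by rewrite dL !mL !scalerDr !scalerA addrACA [c' * _]mulrC.
pose d i := hdeg (b i); pose f i : velem (F i) := << b i >>.
pose d' i := hdeg (b' i); pose f' i : velem (F i) := << b' i >>.
have hf i : hom (d i) (f i) by apply: hom_basis.
have hf' i : hom (d' i) (f' i) by apply: hom_basis.
rewrite -!tens_basis -/f -/f' (vmul_tens HF hf hf') (linZ dL).
rewrite (vdiff_tens HF (d := fun i => (d i + d' i)%N)); last first.
  by move=> i; apply: (vmul_hom (HP i)).
rewrite (vdiff_tens HF hf) (vdiff_tens HF hf') (lin_sum (mL _)) (lin_sum (mR _)).
rewrite !scaler_sumr -big_split; apply: eq_bigr => i _ /=.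
rewrite (linZ (mL _)) (linZ (mR _)).
rewrite (vmul_tens HF (hom_vdiff_pred (i := i) hf) hf') (vmul_tens HF hf (hom_vdiff_pred (i := i) hf')).
rewrite (v_leibniz (HV i) _ (hf i)) -[vmul (vdiff _) _]scale1r tens_linear scale1r tensZ.
rewrite vmul_upd_l vmul_upd_r !scalerA -!exprD -hb.
rewrite scalerDr !scalerA -!exprD beforeD; congr (_ + _).
  have [d0|pos] := posnP (d i).
    have z : vdiff (f i) = 0 by apply: (vdiff_bottom (HP i)); rewrite -d0.
    by rewrite (@tens0 _ _ _ _ _ i) ?scaler0 // upd_in z (lin0 (vmul_linearl (HP i) _)).
  congr (_ *: _); apply: sign_parity.
  rewrite [in X in odd (X + _)](dfwith_pred pos) crossingDl crossing_deltal.
  by rewrite !oddD; do 3!case: (odd _).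
have [d0|pos] := posnP (d' i).
  have z : vdiff (f' i) = 0 by apply: (vdiff_bottom (HP i)); rewrite -d0.
  by rewrite (@tens0 _ _ _ _ _ i) ?scaler0 // upd_in z (lin0 (vmul_linearr (HP i) _)).
congr (_ *: _); apply: sign_parity.
rewrite [in X in odd (X + _ + _)](dfwith_pred pos) crossingDr crossing_deltar.
rewrite /thdeg (before_after d i).
by rewrite !oddD; do 5!case: (odd _).
Qed.

Lemma taylor_dg : is_dgAlgebra (taylor F).
Proof.
apply: (vdga_dg TP); split.
- exact: taylor_diff_diff.
- exact: taylor_mulA.
- exact: taylor_mul1.
- exact: taylor_mulr1.
- exact: taylor_leibniz.
- exact: taylor_comm.
- exact: taylor_sqr0.
Qed.

End TaylorAlgebra.

(** * The ring of even elements *)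

Section SpecialRing.
Variables (k : fieldType) (n : nat) (A : dgData k n).

(** The proof [H] is an argument so that the ring structure, which depends on it, can be attached to
    the type. *)
Definition vring (H : is_dgAlgebra A) : Type := {freeg (gen A) / k}.

Variable H : is_dgAlgebra A.
Let HP := dg_pre H.
Let HV := dg_vdga H.
Local Notation V := (vring H).

HB.instance Definition _ := GRing.Lmodule.copy V {freeg (gen A) / k}.

Fact vring_mulDl : left_distributive (@vmul k n A : V -> V -> V) +%R.
Proof. by move=> x y z; apply: (linD (vmul_linearl HP z)). Qed.
Fact vring_mulDr : right_distributive (@vmul k n A : V -> V -> V) +%R.
Proof. by move=> x y z; apply: (linD (vmul_linearr HP x)). Qed.

(** Rings with 1 = 0 have to be allowed, as the basis may be empty. *)
HB.instance Definition _ := GRing.Zmodule_isPzRing.Build V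
  (v_mulA HV) (v_mul1 HV) (v_mulr1 HV) vring_mulDl vring_mulDr.

Lemma vring_mulE (x y : V) : x * y = vmul x y. Proof. by []. Qed.
Lemma vscalerAl (c : k) (x y : V) : c *: (x * y) = (c *: x) * y.
Proof. by rewrite /GRing.mul /= (linZ (vmul_linearl HP y)). Qed.
Lemma vscalerAr (c : k) (x y : V) : c *: (x * y) = x * (c *: y).
Proof. by rewrite /GRing.mul /= (linZ (vmul_linearr HP x)). Qed.

Lemma vexprZ (c : k) (x : V) j : (c *: x) ^+ j = c ^+ j *: x ^+ j.
Proof.
elim: j => [|j IHj]; first by rewrite !expr0 scale1r.
by rewrite !exprS IHj -vscalerAl -vscalerAr scalerA.
Qed.

Lemma hom1 : hom 0 (1 : V). Proof. exact: vone_hom HP. Qed.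

Lemma hom_mul d d' (x y : V) : hom d x -> hom d' y -> hom (d + d') (x * y).
Proof. exact: vmul_hom HP _ _ _ _. Qed.

Lemma hom_exp d (x : V) j : hom d x -> hom (j * d) (x ^+ j).
Proof.
move=> hx; elim: j => [|j IHj]; first exact: hom1.
by rewrite exprS mulSn; apply: hom_mul.
Qed.

Lemma bnd_exp d m (x : V) j : bnd d m x -> bnd (j * d) (m *+ j)%MM (x ^+ j).
Proof.
move=> hx; elim: j => [|j IHj]; first exact: (vone_bnd HP).
by rewrite exprS mulSn mulmS; apply: (vmul_bnd HP).
Qed.

Definition evenp (x : V) : bool := all (fun a : gen A => ~~ odd (hdeg a)) (dom x).

Lemma evenpP (x : V) : reflect (forall a, coeff a x != 0 -> ~~ odd (hdeg a)) (evenp x).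
Proof. by apply: (iffP allP) => h a; [rewrite -mem_dom => /h | rewrite mem_dom => /h]. Qed.

Lemma hom_even d (x : V) : hom d x -> ~~ odd d -> evenp x.
Proof. by move=> hx ed; apply/evenpP => a /hx ->. Qed.

Lemma evenp0 : evenp 0. Proof. by rewrite /evenp dom0. Qed.

Lemma evenpL c (x y : V) : evenp x -> evenp y -> evenp (c *: x + y).
Proof.
move=> /evenpP hx /evenpP hy; apply/evenpP => a; rewrite coeffD coeffZ.
by have [->|nz _] := eqVneq (coeff a x) 0; [rewrite mulr0 add0r; apply: hy | apply: hx].
Qed.

Lemma evenpM (x y : V) : evenp x -> evenp y -> evenp (x * y).
Proof.
move=> /evenpP hx /evenpP hy; move: x hx; apply: freeg_ind_in => [|c a x ha _ IHx].
  by rewrite vring_mulE (lin0 (vmul_linearl HP _)) evenp0.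
rewrite vring_mulE (vmul_linearl HP); apply: evenpL => {x IHx} //.
move: y hy; apply: freeg_ind_in => [|c' b x hb _ IHx].
  by rewrite (lin0 (vmul_linearr HP _)) evenp0.
rewrite (vmul_linearr HP); apply: evenpL => {x IHx} //.
apply: (@hom_even (hdeg a + hdeg b)); last by rewrite oddD (negPf ha) (negPf hb).
by apply: hom_mul; apply: hom_basis.
Qed.

Fact even_subring : GRing.subring_closed evenp.
Proof.
split; first exact: (hom_even hom1).
  by move=> x y hx hy; rewrite -topredE /= -scaleN1r addrC; apply: evenpL.
by move=> x y; apply: evenpM.
Qed.


Record evenring := EvenRing { evenval : V; _ : evenval \in evenp }.
HB.instance Definition _ := [isSub for evenval].
HB.instance Definition _ := [Choice of evenring by <:].
HB.instance Definition _ := GRing.SubChoice_isSubPzRing.Build V evenp evenring even_subring.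

Lemma evenval_inj : injective evenval. Proof. exact: val_inj. Qed.
Lemma evenval_even s : evenp (evenval s). Proof. exact: valP. Qed.
Lemma evenvalD s t : evenval (s + t) = evenval s + evenval t.
Proof. exact: (rmorphD (val : evenring -> V)). Qed.
Lemma evenvalM s t : evenval (s * t) = evenval s * evenval t.
Proof. exact: (rmorphM (val : evenring -> V)). Qed.
Lemma evenval0 : evenval 0 = 0. Proof. exact: (rmorph0 (val : evenring -> V)). Qed.
Lemma evenval1 : evenval 1 = 1. Proof. exact: (rmorph1 (val : evenring -> V)). Qed.
Lemma evenvalX s j : evenval (s ^+ j) = evenval s ^+ j.
Proof. exact: (rmorphXn (val : evenring -> V)). Qed.
Lemma evenvalMn s j : evenval (s *+ j) = evenval s *+ j.
Proof. exact: (rmorphMn (val : evenring -> V)). Qed.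
Lemma evenval_sum (J : Type) (t : seq J) (P : pred J) (h : J -> evenring) :
  evenval (\sum_(i <- t | P i) h i) = \sum_(i <- t | P i) evenval (h i).
Proof. by apply: (big_morph evenval); [exact: evenvalD | exact: evenval0]. Qed.

Definition toeven (x : V) : evenring := insubd 0 x.
Lemma toevenK x : evenp x -> evenval (toeven x) = x.
Proof. by move=> ex; apply: (insubdK 0 (ex : x \in evenp)). Qed.

Lemma comm_even (x y : V) : evenp x -> x * y = y * x.
Proof.
move=> /evenpP; apply: (@basis_ind2 _ _ _ _ (@vmul k n A) (fun x y : V => y * x)).
- exact: vmul_linearr HP.
- exact: vmul_linearl HP.
- exact: vmul_linearl HP.
- exact: vmul_linearr HP.
move=> a b ha; rewrite (v_comm HV (hom_basis (a := a)) (hom_basis (a := b))).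
by rewrite -signr_odd oddM (negPf ha) expr0 scale1r.
Qed.

Fact evenring_mulC : @commutative evenring evenring *%R.
Proof. by move=> x y; apply: val_inj; apply: comm_even; case: x. Qed.

HB.instance Definition _ := GRing.PzRing_hasCommutativeMul.Build evenring evenring_mulC.

End SpecialRing.

(** * Exponential series *)

(* Sequences are the coefficients of power series, [conv] is their product. *)
Definition conv (S : pzRingType) (E E' : nat -> S) : nat -> S :=
  fun j => \sum_(i < j.+1) E i * E' (j - i)%N.

Definition conv1 (S : pzRingType) : nat -> S := fun j => (j == 0%N)%:R.

(** Replacing the triangular sum by a square one with an indicator turns commutativity and
    associativity of [conv] into exchanges of summations. *)
Lemma conv_square (S : pzRingType) (E E' : nat -> S) J j : (j < J)%N ->
  conv E E' j = \sum_(a < J) \sum_(b < J) (E a * E' b) *+ (a + b == j)%N.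
Proof.
move=> lt; rewrite /conv (big_ord_widen J (fun i => E i * E' (j - i)%N)) // big_mkcond.
apply: eq_bigr => a _; have [le|gt] := ltnP a j.+1.
  have lt' : (j - a < J)%N by apply: leq_ltn_trans (leq_subr _ _) lt.
  rewrite (bigD1 (Ordinal lt')) //= subnKC // eqxx mulr1n big1 ?addr0 // => b ne.
  case: eqP => // e; case/eqP: ne; apply: val_inj; by rewrite /= -e addKn.
rewrite big1 // => b _; case: eqP => // e; have := leq_addr b a.
by rewrite e leqNgt gt.
Qed.

Section Convolution.
Variable S : comPzRingType.
Implicit Types (E : nat -> S).

Lemma convC : commutative (@conv S).
Proof.
move=> E E'; apply: functional_extensionality => j.
rewrite !(@conv_square _ _ _ j.+1) // exchange_big /=.
by apply: eq_bigr => a _; apply: eq_bigr => b _; rewrite mulrC addnC.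
Qed.

Lemma conv_triple E E' E'' J j : (j < J)%N -> conv E (conv E' E'') j =
  \sum_(a < J) \sum_(b < J) \sum_(c < J) (E a * (E' b * E'' c)) *+ (a + (b + c) == j)%N.
Proof.
move=> lt; rewrite (conv_square _ _ lt); apply: eq_bigr => a _.
transitivity (\sum_(d < J) \sum_(b < J) \sum_(c < J)
   (E a * (E' b * E'' c)) *+ (b + c == d)%N *+ (a + d == j)%N).
  apply: eq_bigr => d _; rewrite (conv_square _ _ (ltn_ord d)) mulr_sumr -sumrMnl.
  apply: eq_bigr => b _; rewrite mulr_sumr -sumrMnl.
  by apply: eq_bigr => c _; rewrite mulrnAr.
rewrite exchange_big; apply: eq_bigr => b _; rewrite exchange_big; apply: eq_bigr => c _ /=.
have [ltd|ged] := ltnP (b + c) J.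
  rewrite (bigD1 (Ordinal ltd)) //= eqxx mulr1n big1 ?addr0 // => d ne.
  case: eqP => [e|]; last by rewrite mul0rn.
  by case/eqP: ne; apply: val_inj.
rewrite big1 => [|d _].
  case: eqP => // e; have := leq_trans lt ged.
  by rewrite -e ltnNge leq_addl.
by case: eqP => [e|]; [move: (ltn_ord d); rewrite -e ltnNge ged | rewrite mul0rn].
Qed.

Lemma convA : associative (@conv S).
Proof.
move=> E E' E''; apply: functional_extensionality => j.
rewrite (convC (conv E E')) !(@conv_triple _ _ _ j.+1) //.
rewrite [RHS]exchange_big; apply: eq_bigr => a _.
rewrite [RHS]exchange_big; apply: eq_bigr => b _; apply: eq_bigr => c _ /=.
by congr (_ *+ _); [rewrite mulrA mulrC | rewrite addnA addnC].
Qed.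

Lemma conv1E : left_id (conv1 S) (@conv S).
Proof.
move=> E; apply: functional_extensionality => j; rewrite /conv big_ord_recl big1 => [|i _].
  by rewrite /conv1 eqxx mul1r subn0 addr0.
by rewrite /conv1 mul0r.
Qed.

HB.instance Definition _ := Monoid.isComLaw.Build (nat -> S) (conv1 S) (@conv S)
  convA convC conv1E.

(** Substitution of s t for t, which models (s x)^(j) = s^j x^(j). *)
Definition scaleseq (s : S) E : nat -> S := fun j => s ^+ j * E j.

(** The series with coefficients E behaves like exp (x t). *)
Definition divpow E : Prop := E 0%N = 1 /\
  forall h j, E h * E j = E (h + j)%N *+ 'C(h + j, h).

Lemma scaleseq_conv s E E' : scaleseq s (conv E E') = conv (scaleseq s E) (scaleseq s E').
Proof.
apply: functional_extensionality => j; rewrite /scaleseq /conv mulr_sumr.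
apply: eq_bigr => i _; rewrite mulrACA -exprD subnKC //.
by rewrite -ltnS.
Qed.

Lemma scaleseq1 s : scaleseq s (conv1 S) = conv1 S.
Proof.
apply: functional_extensionality => -[|j]; rewrite /scaleseq /conv1 /= ?mulr0 //.
by rewrite mulr1 expr0.
Qed.

Lemma scaleseqM s t E : scaleseq s (scaleseq t E) = scaleseq (s * t) E.
Proof. by apply: functional_extensionality => j; rewrite /scaleseq mulrA exprMn. Qed.

Lemma scale1seq E : scaleseq 1 E = E.
Proof. by apply: functional_extensionality => j; rewrite /scaleseq expr1n mul1r. Qed.

(** The identity exp ((s + t) x) = exp (s x) exp (t x): the binomial theorem for (s + t)^j, its
    coefficients being absorbed by the product rule of E. *)
Lemma scaleseqD s t E : divpow E ->
  scaleseq (s + t) E = conv (scaleseq s E) (scaleseq t E).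
Proof.
move=> [E0 ED]; apply: functional_extensionality => j; rewrite /scaleseq /conv.
rewrite addrC exprDn mulr_suml; apply: eq_bigr => i _.
have le : (i <= j)%N by rewrite -ltnS.
rewrite mulrACA ED subnKC // mulrnAl mulrnAr; congr (_ *+ _).
by rewrite [t ^+ _ * _]mulrC.
Qed.

Lemma scale0seq E : divpow E -> scaleseq 0 E = conv1 S.
Proof.
move=> [E0 _]; apply: functional_extensionality => -[|j]; rewrite /scaleseq /conv1.
  by rewrite expr0 E0 mulr1.
by rewrite expr0n mul0r.
Qed.

Lemma scaleseq_divpow s E : divpow E -> divpow (scaleseq s E).
Proof.
move=> [E0 ED]; split=> [|h j]; first by rewrite /scaleseq expr0 E0 mulr1.
by rewrite /scaleseq mulrACA -exprD ED mulrnAr.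
Qed.

Lemma conv1_divpow : divpow (conv1 S).
Proof.
split=> // -[|h] [|j]; rewrite /conv1 /= ?mulr0 ?mul0r ?mul0rn ?mulr1 ?mul1r ?bin0 //.
Qed.

Lemma conv_divpow E E' : divpow E -> divpow E' -> divpow (conv E E').
Proof.
move=> [E0 ED] [E'0 ED']; split=> [|h j].
  by rewrite /conv big_ord_recl big_ord0 subn0 E0 E'0 mulr1 addr0.
(* Here p is the total index on E and a the part of it coming from the h-th coefficient. Outside a
   <= p <= a + j a binomial vanishes, so p may range freely; summing over a first is then
   Vandermonde's identity. *)
pose t a p := E p * E' (h + j - p)%N *+ ('C(p, a) * 'C(h + j - p, h - a)).
transitivity (\sum_(a < h.+1) \sum_(p < (h + j).+1) t a p).
  rewrite /conv mulr_suml; apply: eq_bigr => a _; rewrite mulr_sumr.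
  have lea : (a <= h)%N by rewrite -ltnS.
  rewrite -(big_mkord predT (t a)) (@big_cat_nat _ _ _ a) //=; last first.
    by rewrite ltnW // ltnS (leq_trans lea) ?leq_addr.
  rewrite [X in X + _]big_nat [X in X + _]big1 ?add0r; last first.
    move=> p /andP [_ lt].
    by rewrite /t bin_small // mul0n mulr0n.
  rewrite (@big_cat_nat _ _ _ (a + j).+1) //=; first last.
  - by rewrite ltnS leq_add2r.
  - by rewrite leqW ?leq_addr.
  rewrite [X in _ + X]big_nat [X in _ + X]big1 ?addr0 => [|p /andP [gt lt]]; last first.
    by rewrite /t ['C(h + j - p, _)]bin_small ?muln0 //; lia.
  rewrite -[X in \sum_(X <= _ < _) _]add0n big_addn subSn ?leq_addr // addKn big_mkord.
  apply: eq_bigr => c _; rewrite /t mulrACA ED ED' mulrnAl mulrnAr -mulrnA [(c + a)%N]addnC.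
  have lec : (c <= j)%N by rewrite -ltnS.
  have -> : (h + j - (a + c) = h - a + (j - c))%N by lia.
  by rewrite [X in _ *+ X]mulnC.
rewrite exchange_big /conv -sumrMnl; apply: eq_bigr => p _ /=.
rewrite /t sumrMnr; congr (_ *+ _); rewrite binomial.Vandermonde subnKC //.
by rewrite -ltnS.
Qed.

End Convolution.

(** * The exponential of a linear combination of basis elements *)

Section ExponentialSum.
Variables (k : fieldType) (B : choiceType) (S : comPzRingType) (iota : k -> S).
Hypotheses (iota0 : iota 0 = 0) (iota1 : iota 1 = 1)
  (iotaD : forall a b, iota (a + b) = iota a + iota b)
  (iotaM : forall a b, iota (a * b) = iota a * iota b).
Variables (delta : B -> nat -> S) (deltaP : forall b, divpow (delta b)).
Implicit Types (x y : {freeg B / k}).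

Definition expf x : nat -> S :=
  \big[@conv S/conv1 S]_(b <- dom x) scaleseq (iota (coeff b x)) (delta b).

(** A zero coefficient contributes the unit series, so two elements can be compared over one common
    list. *)
Lemma expf_widen s x : uniq s -> {subset dom x <= s} ->
  expf x = \big[@conv S/conv1 S]_(b <- s) scaleseq (iota (coeff b x)) (delta b).
Proof.
move=> us sub; rewrite [RHS](bigID (mem (dom x))) /=.
rewrite [X in conv _ X]big1 => [|b /coeff_outdom ->]; last by rewrite iota0 scale0seq.
rewrite Monoid.mulm1 -big_filter; apply: perm_big; apply: uniq_perm.
- exact: uniq_dom.
- exact: filter_uniq.
- by move=> b; rewrite mem_filter; case: (boolP (b \in dom x)) => // /sub ->.
Qed.

Lemma expfD x y : expf (x + y) = conv (expf x) (expf y).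
Proof.
pose s := undup (dom x ++ dom y).
have us : uniq s by apply: undup_uniq.
have sx : {subset dom x <= s} by move=> b bx; rewrite mem_undup mem_cat bx.
have sy : {subset dom y <= s} by move=> b bx; rewrite mem_undup mem_cat bx orbT.
have sxy : {subset dom (x + y) <= s} by move=> b /domD_subset; rewrite mem_undup.
rewrite (expf_widen us sx) (expf_widen us sy) (expf_widen us sxy).
rewrite -big_split; apply: eq_bigr => b _ /=.
by rewrite coeffD iotaD scaleseqD.
Qed.

Lemma expfZ c x : expf (c *: x) = scaleseq (iota c) (expf x).
Proof.
rewrite (expf_widen (uniq_dom x) (@domZ_subset _ _ c x)) /expf.
rewrite (big_morph _ (scaleseq_conv (iota c)) (scaleseq1 (iota c))).
by apply: eq_bigr => b _; rewrite coeffZ iotaM scaleseqM.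
Qed.

Lemma expf0 : expf 0 = conv1 S.
Proof. by rewrite /expf dom0 big_nil. Qed.

Lemma expf_basis b : expf << b >> = delta b.
Proof. by rewrite /expf domU1 big_seq1 coeff_basis eqxx iota1 scale1seq. Qed.

Lemma expf_divpow x : divpow (expf x).
Proof.
apply: big_ind => [|E E'|b _]; first exact: conv1_divpow.
  exact: conv_divpow.
exact: scaleseq_divpow.
Qed.

End ExponentialSum.

(** For h > 0, the number of partitions of a set with h j elements into j blocks of size h. *)
Definition comp_coef (h j : nat) : nat := ((h * j)`! %/ (j`! * h`! ^ j))%N.

(** Divisibility follows the count of set partitions: the block containing a fixed element can be
    chosen in C(h (j + 1) - 1, h - 1) ways. *)
Lemma comp_coefE h j : (0 < h)%N -> (comp_coef h j * (j`! * h`! ^ j) = (h * j)`!)%N.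
Proof.
move=> h0; rewrite /comp_coef divnK //.
elim: j => [|j /dvdnP[q IHj]]; first by rewrite muln0 fact0.
have e : ('C(h * j.+1, h) = j.+1 * 'C((h * j.+1).-1, h.-1))%N.
  apply/eqP; rewrite -(eqn_pmul2l h0) mulnA; apply/eqP.
  by have := mul_bin_diag (h * j.+1) h.-1; rewrite (prednK h0).
apply/dvdnP; exists (q * 'C((h * j.+1).-1, h.-1))%N.
have le : (h <= h * j.+1)%N by rewrite leq_pmulr.
rewrite -(bin_fact le) e mulnS addKn IHj factS expnS.
by rewrite -!mulnA; lia.
Qed.

(** * The integer identity behind iterated divided powers of a sum *)

Section CompositionIdentity.
Variables (S : comPzRingType) (E E' : nat -> S).
Hypotheses (EP : divpow E) (EP' : divpow E').

(* [p] is the image of [s] when E_a E'_b is read as z^a / (a! b!) in rat[z];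
   identities between integral combinations can thus be checked over rat. *)
Definition crel (D : nat) (p : {poly rat}) (s : S) : Prop :=
  exists c : nat -> nat, [/\ (size p <= D.+1)%N,
    forall a, (a <= D)%N -> (c a)%:R = p`_a * (a`! * (D - a)`!)%:R
  & s = \sum_(a < D.+1) (E a * E' (D - a)%N) *+ c a].

Lemma crel0 D : crel D 0 0.
Proof.
exists (fun=> 0%N); split; first by rewrite size_poly0.
  by move=> a _; rewrite coef0 mul0r.
by rewrite big1 // => i _; rewrite mulr0n.
Qed.

Lemma crelD D p q s t : crel D p s -> crel D q t -> crel D (p + q) (s + t).
Proof.
move=> [c [sp cE ->]] [c' [sq cE' ->]]; exists (fun a => c a + c' a)%N; split.
- by apply: leq_trans (size_polyD _ _) _; rewrite geq_max sp.
- by move=> a le; rewrite natrD cE // cE' // coefD mulrDl.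
- by rewrite -big_split; apply: eq_bigr => a _ /=; rewrite mulrnDr.
Qed.

Lemma crel_mul D1 D2 p q s t : crel D1 p s -> crel D2 q t -> crel (D1 + D2) (p * q) (s * t).
Proof.
move=> [c [sp cE ->]] [c' [sq cE' ->]].
(* The binomials come from E_i E_l and E'_(D1 - i) E'_(D2 - l) under the product rules. *)
pose w i l := ('C(i + l, i) * 'C(D1 + D2 - (i + l), D1 - i))%N.
exists (fun a => \sum_(i < D1.+1) \sum_(l < D2.+1) (i + l == a)%N * (c i * c' l * w i l))%N.
have factE i l : (i <= D1)%N -> (l <= D2)%N ->
    (w i l * ((i`! * (D1 - i)`!) * (l`! * (D2 - l)`!)) = (i + l)`! * (D1 + D2 - (i + l))`!)%N.
  move=> lei lel; rewrite /w.
  have <- := @bin_fact (i + l) i (leq_addr _ _).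
  have <- := @bin_fact (D1 + D2 - (i + l)) (D1 - i); last by lia.
  have -> : (D1 + D2 - (i + l) - (D1 - i) = D2 - l)%N by lia.
  by rewrite addKn; lia.
split.
- apply: leq_trans (size_polyMleq _ _) _.
  by move: sp sq; rewrite -subn1 leq_subLR; lia.
- move=> a lea.
  have poly_widen (u : {poly rat}) D : (size u <= D.+1)%N -> u = \sum_(i < D.+1) u`_i *: 'X^i.
    move=> su; rewrite -{1}[u]coefK poly_def (big_ord_widen D.+1 (fun i => u`_i *: 'X^i)) //.
    rewrite big_mkcond; apply: eq_bigr => i _; case: ltnP => // le.
    by rewrite nth_default ?scale0r.
  rewrite (poly_widen p D1 sp) (poly_widen q D2 sq).
  rewrite mulr_suml coef_sum natr_sum mulr_suml; apply: eq_bigr => i _.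
  rewrite mulr_sumr coef_sum natr_sum mulr_suml; apply: eq_bigr => l _.
  rewrite -scalerAl -scalerAr -exprD !coefZ coefXn [a == _]eq_sym.
  case: (_ =P a) => [<-|_]; last by rewrite mul0n !mulr0 mul0r.
  rewrite mul1n mulr1 -factE -1?ltnS // !natrM (cE _ _) ?(cE' _ _) -1?ltnS //.
  by rewrite !natrM; ring.
- rewrite mulr_suml.
  transitivity (\sum_(i < D1.+1) \sum_(l < D2.+1)
     (E (i + l)%N * E' (D1 + D2 - (i + l))%N) *+ (c i * c' l * w i l)).
    apply: eq_bigr => i _; rewrite mulr_sumr; apply: eq_bigr => l _.
    have lei : (i <= D1)%N by rewrite -ltnS.
    have lel : (l <= D2)%N by rewrite -ltnS.
    rewrite mulrnAl mulrnAr mulrACA EP.2 EP'.2 mulrnAl mulrnAr -!mulrnA.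
    have -> : (D1 - i + (D2 - l) = D1 + D2 - (i + l))%N by lia.
    by congr (_ *+ _); rewrite /w; lia.
  under [RHS]eq_bigr do rewrite -sumrMnr.
  rewrite [RHS]exchange_big; apply: eq_bigr => i _ /=.
  under [RHS]eq_bigr do rewrite -sumrMnr.
  rewrite [RHS]exchange_big; apply: eq_bigr => l _ /=.
  have lt : (i + l < (D1 + D2).+1)%N by rewrite ltnS leq_add // -ltnS.
  rewrite (bigD1 (Ordinal lt)) //= eqxx mul1n big1 ?addr0 // => a ne.
  case: eqP => [e|_]; last by rewrite mul0n mulr0n.
  by case/eqP: ne; apply: val_inj.
Qed.

Lemma crel_monomial D a q m : (a <= D)%N -> m%:R = q * (a`! * (D - a)`!)%:R ->
  crel D (q *: 'X^a) ((E a * E' (D - a)%N) *+ m).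
Proof.
move=> le e; exists (fun b => if b == a then m else 0%N); split.
- by apply: leq_trans (size_scale_leq _ _) _; rewrite size_polyXn.
- move=> b leb; rewrite coefZ coefXn; have [->|_] := eqVneq b a; first by rewrite mulr1.
  by rewrite mulr0 mul0r.
rewrite (bigD1 (Ordinal (le : (a < D.+1)%N))) //= eqxx big1 ?addr0 // => b ne.
by rewrite -val_eqE /= in ne; rewrite (negPf ne) mulr0n.
Qed.

Lemma crel_conv h P Q X Y : (forall j, crel (h * j) (P j) (X j)) ->
  (forall j, crel (h * j) (Q j) (Y j)) -> forall j, crel (h * j) (conv P Q j) (conv X Y j).
Proof.
move=> hX hY j; rewrite /conv.
have : forall i : 'I_j.+1, crel (h * j) (P i * Q (j - i)%N) (X i * Y (j - i)%N).
  by move=> i; rewrite -{1}(subnKC (ltn_ord i : (i <= j)%N)) mulnDr; apply: crel_mul.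
move=> hXY; apply: (big_ind2 (crel (h * j))) => [|p s q t|i _] //; [exact: crel0 | exact: crelD].
Qed.

Lemma divpow_exp i j : exists2 m, E i ^+ j = E (i * j)%N *+ m & (m * i`! ^ j = (i * j)`!)%N.
Proof.
elim: j => [|j [m IHj mE]]; first by exists 1%N; rewrite ?muln0 // EP.1.
exists ('C(i + i * j, i) * m)%N.
  by rewrite exprS IHj mulrnAr EP.2 mulnS -mulrnA.
by rewrite mulnS -(@bin_fact (i + i * j) i) ?leq_addr // addKn expnS -mE; lia.
Qed.

Let fact_neq0 m : m`!%:R != 0 :> rat.
Proof. by rewrite Num.Theory.pnatr_eq0 -lt0n fact_gt0. Qed.

(** The divided powers of 1 in rat[z]; [scaleseq u ediv] is thus the exponential series of u. *)
Let ediv (j : nat) : {poly rat} := (j`!%:R^-1)%:P.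

Let ediv_divpow : divpow ediv.
Proof.
split=> [|h j]; first by rewrite /ediv fact0 invr1.
rewrite /ediv -polyCM -polyCMn; congr _%:P; rewrite -mulr_natr.
have h0 := fact_neq0 h; have j0 := fact_neq0 j; have hj0 := fact_neq0 (h + j).
have := @bin_fact (h + j) h (leq_addr _ _); rewrite addKn => /(congr1 (fun m => m%:R : rat)).
rewrite !natrM => e; rewrite -e in hj0 *; field.
by rewrite h0 j0 /=; apply: contraNneq hj0 => ->; rewrite mul0r.
Qed.

(** With E and E' the series of x and y, [X i] stands for the series of x^(i) y^(h - i), a summand
    of (x + y)^(h). For i < h the even-product rule puts the iterated power on the second factor;
    for i = h that factor is 1 and the first one carries it. Over rat[z] the summands add up to (1 +
    z)^h / h!, whose exponential has j-th coefficient (1 + z)^(h j) / (h!^j j!). *)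
Lemma comp_conv h (X : nat -> nat -> S) : (0 < h)%N ->
  (forall i j, (i < h)%N -> X i j = E i ^+ j * (E' ((h - i) * j)%N *+ comp_coef (h - i) j)) ->
  (forall j, X h j = E (h * j)%N *+ comp_coef h j) ->
  forall j, (\big[@conv S/conv1 S]_(i < h.+1) X i) j = conv E E' (h * j)%N *+ comp_coef h j.
Proof.
move=> h0 Xlt Xh j.
(* The polynomial attached to E_i E'_(h - i) by [crel]. *)
pose u i : {poly rat} := (i`! * (h - i)`!)%:R^-1 *: 'X^i.
have uX (i : 'I_h.+1) l : crel (h * l) (scaleseq (u i) ediv l) (X i l).
  have lei : (i <= h)%N by rewrite -ltnS.
  have -> : scaleseq (u i) ediv l =
      ((i`! * (h - i)`!)%:R^-1 ^+ l * l`!%:R^-1) *: 'X^(i * l).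
    by rewrite /scaleseq /u exprZn -exprM mulrC mul_polyC scalerA mulrC.
  have [m Em mE] := divpow_exp i l.
  have le : (i * l <= h * l)%N by rewrite leq_mul2r lei orbT.
  have e : (h * l - i * l = (h - i) * l)%N by rewrite mulnBl.
  have ne := (fact_neq0 i, fact_neq0 (h - i), fact_neq0 l).
  have [lti|gei] := ltnP i h.
    have -> : X i l = (E (i * l)%N * E' (h * l - i * l)%N) *+ (m * comp_coef (h - i) l).
      by rewrite Xlt // Em e mulrnAl mulrnAr -mulrnA [(m * _)%N]mulnC.
    apply: crel_monomial le _; rewrite e -mE -comp_coefE ?subn_gt0 //.
    rewrite !natrM !natrX exprVn exprMn; field.
    by rewrite !expf_neq0 ?ne.
  have ei : i = h :> nat by apply/eqP; rewrite eqn_leq lei.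
  have -> : X i l = (E (i * l)%N * E' (h * l - i * l)%N) *+ comp_coef h l.
    by rewrite ei Xh subnn EP'.1 mulr1.
  apply: crel_monomial le _; rewrite ei !subnn fact0 muln1 muln1 -comp_coefE //.
  rewrite !natrM !natrX exprVn; field.
  by rewrite !expf_neq0 ?ne // -ei ne.
have [c [_ cE ->]] : crel (h * j) ((\big[@conv _/conv1 _]_(i < h.+1) scaleseq (u i) ediv) j)
                      ((\big[@conv S/conv1 S]_(i < h.+1) X i) j).
  apply: (big_ind2 (fun P X => forall l, crel (h * l) (P l) (X l))) => //.
  - case=> [|l]; rewrite /conv1 /=; last exact: crel0.
    rewrite muln0; have := @crel_monomial 0 0 1 1 (leqnn 0).
    by rewrite subnn expr0 scale1r EP.1 EP'.1 !mul1r mulr1n; apply.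
  - by move=> P X1 Q X2; apply: crel_conv.
rewrite /conv -sumrMnl; apply: eq_bigr => a _; congr (_ *+ _).
have lea : (a <= h * j)%N by rewrite -ltnS.
apply/eqP; rewrite -(Num.Theory.eqr_nat rat); apply/eqP; rewrite cE //.
(* In rat[z] the product of exponentials is the exponential of the sum of the [u i]. *)
rewrite -(big_morph (fun v => scaleseq v ediv) (fun v w => scaleseqD v w ediv_divpow)
   (scale0seq ediv_divpow)).
have -> : \sum_(i < h.+1) u i = h`!%:R^-1 *: (1 + 'X) ^+ h.
  rewrite exprDn scaler_sumr; apply: eq_bigr => i _.
  have lei : (i <= h)%N by rewrite -ltnS.
  rewrite expr1n mul1r -scaler_nat scalerA; congr (_ *: _).
  rewrite -(bin_fact lei) [in RHS]natrM invfM mulrAC mulVf ?mul1r //.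
  by rewrite Num.Theory.pnatr_eq0 -lt0n bin_gt0.
have coefb m b : (b <= m)%N -> ((1 + 'X : {poly rat}) ^+ m)`_b = 'C(m, b)%:R.
  move=> leb; rewrite exprDn coef_sum (bigD1 (Ordinal (leb : (b < m.+1)%N))) //=.
  rewrite expr1n mul1r coefMn coefXn eqxx big1 ?addr0 // => i ne.
  rewrite expr1n mul1r coefMn coefXn; case: eqP => [e|_]; last by rewrite mul0rn.
  by case/eqP: ne; apply: val_inj.
rewrite /scaleseq [_ * ediv j]mulrC mul_polyC exprZn -exprM !coefZ coefb //.
have := bin_fact lea; rewrite -(comp_coefE j h0) => /(congr1 (fun m => m%:R : rat)).
rewrite !natrM natrX => e.
have ne := (fact_neq0 h, fact_neq0 j).
apply: (@mulIf _ (j`!%:R * h`!%:R ^+ j)); first by rewrite mulf_neq0 ?expf_neq0 ?ne.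
rewrite -e exprVn; field.
by rewrite expf_neq0 ?ne.
Qed.

End CompositionIdentity.

(** * Divided powers over k *)

Section SpecialGamma.
Variables (k : fieldType) (n : nat) (A : dgData k n) (H : is_dgAlgebra A).
Local Notation elem := {freeg (gen A) / {mpoly k[n]}}.
Local Notation V := (vring H).
Let HP := dg_pre H.

(** Only [vg_bnd] still mentions multidegrees. Over the polynomial ring, for j >= 2, [vg_scale] is
    the even-product axiom with a factor of degree 0. *)
Record vGamma (v : V -> nat -> V) : Prop := VGamma {
  vg_bnd : forall d m (x : V) j, bnd d m x -> (0 < d)%N -> ~~ odd d ->
    bnd (j * d) (m *+ j)%MM (v x j);
  vg0 : forall d (x : V), hom d x -> (0 < d)%N -> ~~ odd d -> v x 0%N = 1;
  vg1 : forall d (x : V), hom d x -> (0 < d)%N -> ~~ odd d -> v x 1%N = x;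
  vg_mul : forall d (x : V) h j, hom d x -> (0 < d)%N -> ~~ odd d ->
    v x h * v x j = v x (h + j)%N *+ 'C(h + j, h);
  vg_add : forall d (x y : V) j, hom d x -> hom d y -> (0 < d)%N -> ~~ odd d ->
    v (x + y) j = conv (v x) (v y) j;
  vg_scale : forall d c (x : V) j, hom d x -> (0 < d)%N -> ~~ odd d ->
    v (c *: x) j = c ^+ j *: v x j;
  vg_odd : forall d d' (x y : V) j, hom d x -> hom d' y -> odd d -> odd d' ->
    (2 <= j)%N -> v (x * y) j = 0;
  vg_even : forall d d' (x y : V) j, hom d x -> hom d' y ->
    ~~ odd d -> (0 < d')%N -> ~~ odd d' -> (2 <= j)%N ->
    v (x * y) j = x ^+ j * v y j;
  vg_comp : forall d (x : V) h j, hom d x -> (0 < d)%N -> ~~ odd d -> (0 < h)%N ->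
    v (v x h) j = v x (h * j)%N *+ comp_coef h j;
  vg_diff : forall d (x : V) j, hom d x -> (0 < d)%N -> ~~ odd d ->
    vdiff (v x j.+1) = v x j * vdiff x
}.

Lemma ev_dgexp (x : elem) j : ev (dgexp x j) = (ev x : V) ^+ j.
Proof. by elim: j => [//|j IHj]; rewrite exprS -IHj /dgexp iterS (ev_mul HP). Qed.

Lemma dgexp_bihomog d m (x : elem) j :
  is_bihomog d m x -> is_bihomog (j * d) (m *+ j)%MM (dgexp x j).
Proof.
move=> hx; elim: j => [|j IHj]; first exact: (dg_one_bihomog H).
by rewrite /dgexp iterS mulSn mulmS; apply: (dg_mul_bihomog H).
Qed.

Lemma sdeg_le d m (x : V) : bnd d m x -> (sdeg x <= m)%MM.
Proof.
move=> hx; rewrite /sdeg big_seq; elim/big_rec: _ => [|a u].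
  by apply/mnm_lepP => i; rewrite mnm0E.
by rewrite mem_dom lem_mlcm => /hx [_ ->].
Qed.

Section Specialize.
Variables (g : elem -> nat -> elem) (gP : is_dgGamma g).

Definition vgam (x : V) j : V := ev (g (hmg (sdeg x) x) j).

(** The multidegree used to homogenize is immaterial: y is a monomial times the homogenization at
    [sdeg], and the even-product axiom extracts that monomial, which becomes 1. As this axiom starts
    at j = 2, the powers 0 and 1 are treated apart. *)
Lemma ev_gamma d m (y : elem) j : is_bihomog d m y -> (0 < d)%N -> ~~ odd d ->
  ev (g y j) = vgam (ev y) j.
Proof.
move=> hy d0 de; rewrite /vgam.
have hx := bihomog_bnd hy; set x : V := ev y in hx *.
have hs : is_bihomog d (sdeg x) (hmg (sdeg x) x).
  by apply: hmg_bihomog; apply: hom_bnd (bnd_hom hx).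
case: j => [|[|j]].
- by rewrite (gamma0 gP hy) // (gamma0 gP hs).
- by rewrite (gamma1 gP hy) // (gamma1 gP hs) // hmgK.
set u := (m - sdeg x)%MM.
have h1 : is_bihomog 0 u ('X_[u] *: one_elt A).
  by rewrite -[u in is_bihomog _ u _]addm0; apply: bihomogZX; apply: (dg_one_bihomog H).
have -> : y = mul ('X_[u] *: one_elt A) (hmg (sdeg x) x).
  apply: (bihomog_inj hy (d' := (0 + d)%N)).
    by rewrite -{1}(submK (sdeg_le hx)); apply: (dg_mul_bihomog H).
  rewrite (ev_mul HP) evZ at1X scale1r hmgK.
  exact: (esym (v_mul1 (dg_vdga H) x)).
rewrite (gamma_even gP h1 hs) // (ev_mul HP) ev_dgexp evZ at1X scale1r.
by rewrite (expr1n V) [vmul _ _](v_mul1 (dg_vdga H)).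
Qed.

Lemma vgam_hmg d m (x : V) j : bnd d m x -> (0 < d)%N -> ~~ odd d ->
  vgam x j = ev (g (hmg m x) j).
Proof. by move=> hx d0 de; rewrite (ev_gamma _ (hmg_bihomog hx)) // hmgK. Qed.

Lemma hmgD m (x y : V) : hmg m (x + y) = hmg m x + hmg m y :> elem.
Proof. by apply: freegP => a; rewrite !(coeffD, coeff_hmg) scalerDl. Qed.

Lemma vgam_bnd d m (x : V) j : bnd d m x -> (0 < d)%N -> ~~ odd d ->
  bnd (j * d) (m *+ j)%MM (vgam x j).
Proof.
move=> hx d0 de; rewrite (vgam_hmg _ hx) //; apply: bihomog_bnd.
by apply: (gamma_bihomog gP) => //; apply: hmg_bihomog.
Qed.

Lemma vgam0 d (x : V) : hom d x -> (0 < d)%N -> ~~ odd d -> vgam x 0 = 1.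
Proof. by move=> /hom_bnd/hmg_bihomog hx d0 de; rewrite /vgam (gamma0 gP hx). Qed.

Lemma vgam1 d (x : V) : hom d x -> (0 < d)%N -> ~~ odd d -> vgam x 1 = x.
Proof. by move=> /hom_bnd/hmg_bihomog hx d0 de; rewrite /vgam (gamma1 gP hx) // hmgK. Qed.

Lemma vgam_even d d' (x y : V) j : hom d x -> hom d' y ->
    ~~ odd d -> (0 < d')%N -> ~~ odd d' -> (2 <= j)%N ->
    vgam (x * y) j = x ^+ j * vgam y j.
Proof.
move=> /hom_bnd/hmg_bihomog hx /hom_bnd/hmg_bihomog hy de d0 d'e lej.
rewrite -{1}(hmgK (sdeg x) x) -{1}(hmgK (sdeg y) y) vring_mulE -(ev_mul HP).
rewrite -(ev_gamma _ (dg_mul_bihomog H hx hy)) ?addn_gt0 ?d0 ?orbT //; last first.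
  by rewrite oddD (negPf de) (negPf d'e).
by rewrite (gamma_even gP hx hy) // (ev_mul HP) ev_dgexp hmgK.
Qed.

Lemma vgam_vGamma : vGamma vgam.
Proof.
split.
- exact: vgam_bnd.
- exact: vgam0.
- exact: vgam1.
- move=> d x h j /hom_bnd/hmg_bihomog hx d0 de.
  by rewrite /vgam vring_mulE -(ev_mul HP) (gamma_mul gP _ _ hx) // evMn.
- move=> d x y j /hom_bnd hx /hom_bnd hy d0 de.
  (* The addition axiom wants equal bidegrees, so both terms are homogenized at a common
     multiple. *)
  set m := mlcm (sdeg x) (sdeg y).
  have {}hx := bnd_le (lem_mlcml _ _ : (_ <= m)%MM) hx.
  have {}hy := bnd_le (lem_mlcmr _ _ : (_ <= m)%MM) hy.
  rewrite (vgam_hmg _ (bndD hx hy)) // hmgD.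
  rewrite (gamma_add gP _ (hmg_bihomog hx) (hmg_bihomog hy)) // ev_sum.
  apply: eq_bigr => i _; rewrite (ev_mul HP).
  by rewrite -(vgam_hmg _ hx) // -(vgam_hmg _ hy).
- move=> d c x [|[|j]] hx d0 de.
  + by rewrite !(vgam0 (d := d)) ?expr0 ?scale1r //; apply: homZ.
  + by rewrite !(vgam1 (d := d)) //; apply: homZ.
  + rewrite -{1}[x]mul1r vscalerAl (@vgam_even 0 d) ?vexprZ ?expr1n -?vscalerAl ?mul1r //.
    exact/homZ/hom1.
- move=> d d' x y j /hom_bnd/hmg_bihomog hx /hom_bnd/hmg_bihomog hy od od' lej.
  rewrite -{1}(hmgK (sdeg x) x) -{1}(hmgK (sdeg y) y) vring_mulE -(ev_mul HP).
  rewrite -(ev_gamma _ (dg_mul_bihomog H hx hy)) ?addn_gt0 ?odd_gt0 //; last first.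
    by rewrite oddD od od'.
  by rewrite (gamma_odd gP hx hy) // ev0.
- exact: vgam_even.
- move=> d x h j /hom_bnd/hmg_bihomog hx d0 de h0.
  rewrite {2}/vgam -(ev_gamma _ (gamma_bihomog gP (j := h) hx d0 de)) ?muln_gt0 ?h0 //; last first.
    by rewrite oddM (negPf de) andbF.
  by rewrite (gamma_gamma gP _ hx) // evMn.
- move=> d x j /hom_bnd/hmg_bihomog hx d0 de.
  by rewrite /vgam -(ev_diff HP) (gamma_diff gP _ hx) // (ev_mul HP) (ev_diff HP) hmgK.
Qed.

End Specialize.

Section Homogenize.
Variables (v : V -> nat -> V) (vP : vGamma v).

(* The multidegree of y when y is homogeneous and nonzero. *)
Definition mdeg_of (y : elem) : 'X_{1..n} :=
  if dom y is a :: _ then (mlead (coeff a y) + multideg a)%MM else 0%MM.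

Lemma mdeg_ofE d m (y : elem) : is_bihomog d m y -> y = 0 \/ mdeg_of y = m.
Proof.
move=> hy; rewrite /mdeg_of; case e: (dom y) => [|a s].
  by left; apply/eqP; rewrite -dom_eq0 e.
right; have : a \in dom y by rewrite e inE eqxx.
by rewrite mem_dom => /mlead_supp /hy [].
Qed.

Definition hgam (y : elem) (j : nat) : elem := hmg (mdeg_of y *+ j)%MM (v (ev y) j).

Lemma vgamma_zero j : (0 < j)%N -> v 0 j = 0.
Proof.
(* The 2 is an arbitrary even positive degree; zero is homogeneous of each. *)
case: j => // j _; have := @vg_scale _ vP 2 0 0 j.+1 (@hom0 _ _ A 2) isT isT.
by rewrite scale0r expr0n scale0r.
Qed.

(** Zero has no definite multidegree, which does no harm: for j > 0 its powers vanish, and for j = 0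
    the multidegree is multiplied by 0. *)
Lemma hgamE d m (y : elem) j : is_bihomog d m y -> hgam y j = hmg (m *+ j)%MM (v (ev y) j).
Proof.
move=> hy; rewrite /hgam; case: (mdeg_ofE hy) => [->|-> //].
by case: j => [//|j]; rewrite ev0 vgamma_zero // !hmg0.
Qed.

Lemma ev_hgam (y : elem) j : ev (hgam y j) = v (ev y) j.
Proof. exact: hmgK. Qed.

Lemma hgam_bihomog d m (y : elem) j : is_bihomog d m y -> (0 < d)%N -> ~~ odd d ->
  is_bihomog (j * d) (m *+ j)%MM (hgam y j).
Proof.
move=> hy d0 de; rewrite (hgamE j hy); apply: hmg_bihomog.
by apply: (vg_bnd vP) => //; apply: bihomog_bnd.
Qed.

Lemma mulmnD (m : 'X_{1..n}) i j : (m *+ (i + j) = m *+ i + m *+ j)%MM.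
Proof. by apply/mnmP => l; rewrite mnmDE !mulmnE mulnDr. Qed.

Lemma mulmnA (m : 'X_{1..n}) i j : (m *+ (i * j) = m *+ i *+ j)%MM.
Proof. by apply/mnmP => l; rewrite !mulmnE mulnA. Qed.

Lemma mulmDl (m m' : 'X_{1..n}) j : ((m + m') *+ j = m *+ j + m' *+ j)%MM.
Proof. by apply/mnmP => l; rewrite !(mnmDE, mulmnE) mulnDl. Qed.

Lemma hgam_dgGamma : is_dgGamma hgam.
Proof.
have hh d m (x : elem) : is_bihomog d m x -> hom d (ev x) by move=> /bihomog_bnd/bnd_hom.
split.
- exact: H.
- move=> d m x hx d0 de; apply: (bihomog_inj (hgam_bihomog (j := 0) hx d0 de) (dg_one_bihomog H)).
  by rewrite ev_hgam (vg0 vP (hh _ _ _ hx)).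
- move=> d m x hx d0 de; apply: (bihomog_inj (hgam_bihomog (j := 1) hx d0 de) hx).
  by rewrite ev_hgam (vg1 vP (hh _ _ _ hx)).
- by move=> d m x j; apply: hgam_bihomog.
- move=> d m x h j hx d0 de; have hg l := hgam_bihomog (j := l) hx d0 de.
  apply: (bihomog_inj (dg_mul_bihomog H (hg h) (hg j)) (d' := ((h + j) * d)%N)).
    by rewrite -mulmnD; apply: bihomogMn.
  by rewrite (ev_mul HP) evMn !ev_hgam -vring_mulE (vg_mul vP _ _ (hh _ _ _ hx)).
- move=> d m x y j hx hy d0 de.
  apply: (bihomog_inj (hgam_bihomog (j := j) (bihomogD hx hy) d0 de) (d' := (j * d)%N)).
    apply: bihomog_sum => -[i /= lei] _.
    rewrite -[in (j * d)%N](subnKC (lei : (i <= j)%N)) mulnDl.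
    rewrite -[in (m *+ j)%MM](subnKC (lei : (i <= j)%N)) mulmnD.
    by apply: (dg_mul_bihomog H); apply: hgam_bihomog.
  rewrite ev_hgam evD (vg_add vP _ (hh _ _ _ hx) (hh _ _ _ hy)) // ev_sum.
  by apply: eq_bigr => i _; rewrite (ev_mul HP) !ev_hgam.
- move=> d1 d2 m1 m2 x y j hx hy od1 od2 lej.
  rewrite (hgamE j (dg_mul_bihomog H hx hy)) (ev_mul HP).
  by rewrite [v _ j](vg_odd vP (hh _ _ _ hx) (hh _ _ _ hy)) ?hmg0.
- move=> d1 d2 m1 m2 x y j hx hy e1 d20 e2 lej.
  have d0 : (0 < d1 + d2)%N by rewrite addn_gt0 d20 orbT.
  have de : ~~ odd (d1 + d2) by rewrite oddD (negPf e1) (negPf e2).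
  apply: (bihomog_inj (hgam_bihomog (j := j) (dg_mul_bihomog H hx hy) d0 de)
      (d' := (j * d1 + j * d2)%N)).
    by rewrite mulmDl; apply: (dg_mul_bihomog H); [apply: dgexp_bihomog | apply: hgam_bihomog].
  rewrite ev_hgam !(ev_mul HP) ev_hgam ev_dgexp.
  by rewrite [v _ j](vg_even vP (hh _ _ _ hx) (hh _ _ _ hy)).
- move=> d m x h j hx d0 de h0.
  have d0' : (0 < h * d)%N by rewrite muln_gt0 h0.
  have de' : ~~ odd (h * d) by rewrite oddM (negPf de) andbF.
  apply: (bihomog_inj (hgam_bihomog (j := j) (hgam_bihomog (j := h) hx d0 de) d0' de')
      (d' := (h * j * d)%N)).
    by rewrite -mulmnA; apply: bihomogMn; apply: hgam_bihomog.
  by rewrite evMn !ev_hgam (vg_comp vP _ (hh _ _ _ hx)).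
- move=> d m x j hx d0 de.
  have hg := hgam_bihomog (j := j.+1) hx d0 de.
  have hd := diff_bihomog_pred HP hx.
  apply: (bihomog_inj (diff_bihomog_pred HP hg) (d' := (j * d + d.-1)%N)).
    by rewrite mulmSr; apply: (dg_mul_bihomog H) => //; apply: hgam_bihomog.
  rewrite (ev_diff HP) (ev_mul HP) !ev_hgam (ev_diff HP).
  by rewrite (vg_diff vP _ (hh _ _ _ hx)).
Qed.

End Homogenize.

End SpecialGamma.

Section VGammaTheory.
Variables (k : fieldType) (n : nat) (A : dgData k n) (H : is_dgAlgebra A).
Local Notation V := (vring H).
Variables (v : V -> nat -> V) (vP : vGamma v).

Lemma vg_exp d (x : V) j : hom d x -> (0 < d)%N -> ~~ odd d -> x ^+ j = v x j *+ j`!.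
Proof.
move=> hx d0 de; elim: j => [|j IHj]; first by rewrite (vg0 vP hx).
rewrite exprS IHj mulrnAr -{1}(vg1 vP hx) // (vg_mul vP _ _ hx) // add1n bin1.
by rewrite -mulrnA factS.
Qed.

Lemma vg_hom d (x : V) j : hom d x -> (0 < d)%N -> ~~ odd d -> hom (j * d) (v x j).
Proof. by move=> /hom_bnd hx d0 de; apply: (bnd_hom (vg_bnd vP (j := j) hx d0 de)). Qed.

Lemma vdiff_even (x y : V) : evenp x -> vdiff (x * y) = (vdiff x : V) * y + x * (vdiff y : V) :> V.
Proof.
move=> /evenpP hx.
have dL := vdiff_linear (dg_pre H).
move: x hx; apply: freeg_ind_in => [|c a x ha _ IHx].
  by rewrite !mul0r (lin0 dL) mul0r addr0.
rewrite mulrDl -vscalerAl !dL IHx !mulrDl -!vscalerAl addrACA -scalerDr.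
congr (_ *: _ + _).
rewrite vring_mulE (v_leibniz (dg_vdga H) _ (hom_basis (a := a))).
by rewrite -signr_odd (negPf ha) expr0 scale1r.
Qed.

Lemma vdiff_exp (x : V) j : evenp x ->
  vdiff (x ^+ j.+1) = (x ^+ j * (vdiff x : V)) *+ j.+1 :> V.
Proof.
move=> hx; elim: j => [|j IHj]; first by rewrite expr0 mul1r expr1.
rewrite exprS vdiff_even // IHj mulrnAr mulrA -exprS.
rewrite [RHS]mulrS; congr (_ + _).
suff hj : evenp (x ^+ j.+1) by apply/esym/comm_even.
elim: j {IHj} => [|j IHj]; first by rewrite expr1.
by rewrite exprS evenpM.
Qed.

Lemma comm_odd d d' (x y : V) : hom d x -> hom d' y -> odd d -> odd d' -> x * y = - (y * x).
Proof.
move=> hx hy od od'; rewrite vring_mulE (v_comm (dg_vdga H) hx hy) -signr_odd oddM od od'.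
by rewrite scaleN1r.
Qed.

Lemma sqr0_odd d (x : V) : hom d x -> odd d -> x * x = 0.
Proof. exact: v_sqr0 (dg_vdga H) _ _. Qed.

End VGammaTheory.

(** From index 2 on, the only product without a vanishing factor could be E_1 E'_1. This serves
    series of the form 1 + a t. *)
Lemma conv_small (S : pzRingType) (E E' : nat -> S) :
  (forall j, (2 <= j)%N -> E j = 0) -> (forall j, (2 <= j)%N -> E' j = 0) ->
  E 1%N * E' 1%N = 0 -> forall j, (2 <= j)%N -> conv E E' j = 0.
Proof.
move=> E2 E'2 E11 j lej; rewrite /conv big1 // => -[i /= lei] _.
have [le2|] := leqP 2 i; first by rewrite E2 // mul0r.
have [le2 _|lt1 lt2] := leqP 2 (j - i); first by rewrite E'2 // mulr0.
have [-> ->] : i = 1%N /\ (j - i)%N = 1%N by lia.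
by [].
Qed.

(** * Divided powers on the tensor product *)

Section TensorPowers.
Variables (k : fieldType) (n r : nat) (F : 'I_r -> dgData k n).
Variable HF : forall i, is_dgAlgebra (F i).
Local Notation R := (fun i : 'I_r => vring (HF i)).
Local Notation upd f i x := (@dfwith _ R f i x).
Local Notation "'Pi'" := (forall i : 'I_r, vring (HF i)).
Let HT := taylor_dg HF.
Local Notation W := (vring HT).
Implicit Types (d : 'I_r -> nat) (f : Pi).

Definition rtens (f : Pi) : W := tens f.

Lemma rtensD f i x y : rtens (upd f i (x + y)) = rtens (upd f i x) + rtens (upd f i y).
Proof. by have := @tens_linear _ _ _ _ f i 1 x y; rewrite !scale1r. Qed.

Lemma rtensZ f i c x : rtens (upd f i (c *: x)) = c *: rtens (upd f i x).
Proof. exact: tensZ. Qed.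

Lemma rtens0 f i : f i = 0 -> rtens f = 0.
Proof. exact: tens0. Qed.

Lemma rtens_sum f i (J : Type) (s : seq J) (P : pred J) (h : J -> vring (HF i)) :
  rtens (upd f i (\sum_(j <- s | P j) h j)) = \sum_(j <- s | P j) rtens (upd f i (h j)).
Proof.
apply: (big_morph (fun x => rtens (upd f i x))) => [x y|]; first exact: rtensD.
by apply: (@rtens0 _ i); rewrite dfwith_in.
Qed.

Lemma rtensMn f i x j : rtens (upd f i (x *+ j)) = rtens (upd f i x) *+ j.
Proof.
elim: j => [|j IHj]; first by rewrite !mulr0n (@rtens0 _ i) ?dfwith_in.
by rewrite !mulrS rtensD IHj.
Qed.

Lemma rtens1 : rtens (fun i => 1) = 1.
Proof. by rewrite /rtens [RHS]vone_taylor. Qed.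

Lemma rupd_eq f i x f' : x = f' i -> (forall l, i != l -> f l = f' l) -> upd f i x = f'.
Proof.
move=> ei el; apply: functional_extensionality_dep => l.
have [e|ne] := eqVneq i l; first by case: _ / e; rewrite dfwith_in.
by rewrite dfwith_out // el.
Qed.

Lemma rtens_mul d d' f f' : (forall i, hom (d i) (f i)) -> (forall i, hom (d' i) (f' i)) ->
  rtens f * rtens f' = (-1) ^+ crossing d d' *: rtens (fun i => f i * f' i).
Proof. exact: vmul_tens. Qed.

Lemma rtens_mul_even d d' f f' : (forall i, hom (d i) (f i)) -> (forall i, hom (d' i) (f' i)) ->
  (forall i, ~~ odd (d i)) -> rtens f * rtens f' = rtens (fun i => f i * f' i).
Proof.
move=> hf hf' de; rewrite (rtens_mul hf hf') -signr_odd.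
suff -> : odd (crossing d d') = false by rewrite scale1r.
rewrite /crossing (big_morph odd oddD (erefl _ : odd 0 = false)) big1 // => i _.
rewrite oddM (big_morph odd oddD (erefl _ : odd 0 = false)) big1 ?andbF // => j _.
exact/negbTE.
Qed.

Lemma rtens_mul0 d d' f f' i : (forall i, hom (d i) (f i)) -> (forall i, hom (d' i) (f' i)) ->
  f i * f' i = 0 -> rtens f * rtens f' = 0.
Proof. by move=> hf hf' z; rewrite (rtens_mul hf hf') (@rtens0 _ i) ?scaler0. Qed.

Lemma rtens_hom d f : (forall i, hom (d i) (f i)) -> hom (\sum_(i < r) d i) (rtens f).
Proof. exact: hom_tens. Qed.

Lemma rtens_exp d f j : (forall i, hom (d i) (f i)) -> (forall i, ~~ odd (d i)) ->
  rtens f ^+ j = rtens (fun i => f i ^+ j).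
Proof.
move=> hf de; elim: j => [|j IHj]; first by rewrite expr0 -rtens1.
rewrite exprS IHj (rtens_mul_even hf (fun i => hom_exp (j := j) (hf i)) de).
by congr rtens; apply: functional_extensionality_dep => i; rewrite exprS.
Qed.

Lemma rupd_hom d f i x : (forall l, hom (d l) (f l)) -> hom (d i) x ->
  forall l, hom (d l) (upd f i x l).
Proof. exact: upd_hom. Qed.

Lemma even_total d i : ~~ odd (\sum_(l < r) d l) -> odd (d i) -> exists2 l, i != l & odd (d l).
Proof.
move=> + odi; rewrite (bigD1 i) //= oddD odi /=.
have [l /andP[ne odl] _|all_even] := pickP (fun l => (i != l) && odd (d l)).
  by exists l.
rewrite (big_morph odd oddD (erefl _ : odd 0 = false)) big1 // => l ne.
by have := all_even l; rewrite /= (eq_sym i) ne.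
Qed.

Lemma odd_total d : odd (\sum_(l < r) d l) -> exists l, odd (d l).
Proof.
have [l odl _|all_even] := pickP (fun l => odd (d l)); first by exists l.
by rewrite (big_morph odd oddD (erefl _ : odd 0 = false)) big1.
Qed.

Variables (v : forall i, vring (HF i) -> nat -> vring (HF i)).
Hypothesis vP : forall i, vGamma (@v i).

Definition dpow_even (i : 'I_r) f (j : nat) : W :=
  rtens (upd (fun l => f l ^+ j) i (v (f i) j)).

Definition dpow_odd f (j : nat) : W :=
  if j is 0%N then 1 else if j is 1%N then rtens f else 0.

Section Even.
Variables (d : 'I_r -> nat) (i : 'I_r).
Hypotheses (de : forall l, ~~ odd (d l)) (di : (0 < d i)%N).

Lemma dpow_even_hom f j : (forall l, hom (d l) (f l)) ->
  forall l, hom (j * d l) (upd (fun l => f l ^+ j) i (v (f i) j) l).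
Proof.
move=> hf; apply: (@rupd_hom (fun l => j * d l)%N) => [l|]; first exact: hom_exp.
exact: vg_hom.
Qed.

Lemma dpow_even0 f : (forall l, hom (d l) (f l)) -> dpow_even i f 0 = 1.
Proof.
move=> hf; rewrite /dpow_even -rtens1; congr rtens.
by apply: rupd_eq => //; rewrite (vg0 (@vP i) (hf i)).
Qed.

Lemma dpow_even1 f : (forall l, hom (d l) (f l)) -> dpow_even i f 1 = rtens f.
Proof.
move=> hf; rewrite /dpow_even; congr rtens.
by apply: rupd_eq => //; rewrite (vg1 (@vP i) (hf i)).
Qed.

Lemma odd_mull h l : ~~ odd (h * d l). Proof. by rewrite oddM (negPf (de l)) andbF. Qed.

Lemma dpow_even_mul f h j : (forall l, hom (d l) (f l)) ->
  dpow_even i f h * dpow_even i f j = dpow_even i f (h + j) *+ 'C(h + j, h).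
Proof.
move=> hf; rewrite (rtens_mul_even (dpow_even_hom (j := h) hf) (dpow_even_hom (j := j) hf) (odd_mull h)).
rewrite /dpow_even -rtensMn -(vg_mul (@vP i) _ _ (hf i)) //; congr rtens.
apply/esym/rupd_eq; first by rewrite !dfwith_in.
by move=> l ne; rewrite !dfwith_out // exprD.
Qed.

(** Slot i' holds f_(i')^j = j! f_(i')^(j). By multilinearity the integer j! moves to slot i, where
    it turns f_i^(j) into f_i^j. *)
Lemma dpow_even_indep f j i' : (forall l, hom (d l) (f l)) -> (0 < d i')%N ->
  dpow_even i f j = dpow_even i' f j.
Proof.
move=> hf di'; have [<-//|ne] := eqVneq i i'.
have ne' : i' != i by rewrite eq_sym.
pose E l := f l ^+ j.
transitivity (rtens (upd (upd E i (v (f i) j)) i' (v (f i') j)) *+ j`!).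
  rewrite -rtensMn -(vg_exp (@vP i') _ (hf i')) //; congr rtens.
  by apply/esym/rupd_eq => //; rewrite dfwith_out.
have -> : upd (upd E i (v (f i) j)) i' (v (f i') j) = upd (upd E i' (v (f i') j)) i (v (f i) j).
  exact: upd_comm.
rewrite -rtensMn -(vg_exp (@vP i) _ (hf i)) //; congr rtens.
by apply/rupd_eq => //; rewrite dfwith_out.
Qed.

Lemma dpow_even_scale f l c (x : vring (HF l)) j : (forall l, hom (d l) (f l)) -> hom (d l) x ->
  dpow_even i (upd f l (c *: x)) j = c ^+ j *: dpow_even i (upd f l x) j.
Proof.
move=> hf hx; rewrite /dpow_even; have [e|ne] := eqVneq i l.
  case: _ / e in x hx *; rewrite !dfwith_in (vg_scale (@vP i) _ _ hx) // rtensZ.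
  congr (_ *: rtens _); apply: rupd_eq; first by rewrite dfwith_in.
  by move=> l' ne; rewrite !dfwith_out.
have ne' : l != i by rewrite eq_sym.
rewrite !(dfwith_out _ _ ne').
have e z : upd (fun l0 => upd f l z l0 ^+ j) i (v (f i) j) =
    upd (upd (fun l0 => f l0 ^+ j) i (v (f i) j)) l (z ^+ j).
  apply: rupd_eq => [|l' nel']; first by rewrite dfwith_out // dfwith_in.
  have [e|nel] := eqVneq l l'; first by case: _ / e; rewrite !dfwith_in.
  by rewrite !dfwith_out.
by rewrite !e vexprZ rtensZ.
Qed.

(** In the slot that carries the divided power this is the addition axiom. In any other slot the
    binomial theorem applies, as even elements commute, and the coefficient C(j, a) moves to slot i,
    where it is the one relating v_a v_(j - a) to v_j. *)
Lemma dpow_even_add f l (x y : vring (HF l)) : (forall l, hom (d l) (f l)) -> hom (d l) x -> hom (d l) y ->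
  dpow_even i (upd f l (x + y)) = conv (dpow_even i (upd f l x)) (dpow_even i (upd f l y)).
Proof.
move=> hf hx hy; apply: functional_extensionality => j; rewrite /conv.
have hfx := rupd_hom hf hx; have hfy := rupd_hom hf hy.
have mulE (a : 'I_j.+1) := rtens_mul_even (dpow_even_hom (j := a) hfx) (dpow_even_hom (j := (j - a)%N) hfy)
   (odd_mull a).
rewrite {1}/dpow_even; have [e|ne] := eqVneq i l.
  case: _ / e in x y hx hy hfx hfy mulE *.
  rewrite dfwith_in (vg_add (@vP i) _ hx hy) // rtens_sum; apply: eq_bigr => a _.
  rewrite [RHS]mulE; congr rtens; apply: rupd_eq; first by rewrite !dfwith_in.
  by move=> l' ne; rewrite !dfwith_out // -exprD subnKC // -ltnS.
have ne' : l != i by rewrite eq_sym.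
rewrite (dfwith_out _ _ ne').
have -> : upd (fun l0 => upd f l (x + y) l0 ^+ j) i (v (f i) j) =
    upd (upd (fun l0 => f l0 ^+ j) i (v (f i) j)) l ((x + y) ^+ j).
  apply: rupd_eq => [|l' nel']; first by rewrite dfwith_out // dfwith_in.
  have [e|nel] := eqVneq l l'; first by case: _ / e; rewrite !dfwith_in.
  by rewrite !dfwith_out.
have cxy : GRing.comm y x by apply: comm_even; apply: hom_even hy (de l).
rewrite addrC (exprDn_comm _ cxy) rtens_sum; apply: eq_bigr => a _.
have lea : (a <= j)%N by rewrite -ltnS.
rewrite [RHS]mulE rtensMn.
have vE : v (f i) a * v (f i) (j - a)%N = v (f i) j *+ 'C(j, a).
  by rewrite (vg_mul (@vP i) _ _ (hf i)) // subnKC.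
transitivity (rtens (upd (upd (fun l0 => f l0 ^+ j) l (y ^+ (j - a) * x ^+ a)) i
    (v (f i) j *+ 'C(j, a)))).
  by rewrite rtensMn; congr (rtens _ *+ _); apply: upd_comm.
congr rtens; apply: rupd_eq.
  by rewrite -vE !dfwith_in !(dfwith_out _ _ ne').
move=> l' nel'; rewrite !(dfwith_out _ _ nel').
have [e|nel] := eqVneq l l'.
  case: _ / e; rewrite !dfwith_in; apply/commrX/commr_sym/commrX/commr_sym.
  exact: cxy.
by rewrite !(dfwith_out _ _ nel) -exprD subnKC.
Qed.

End Even.

End TensorPowers.

(** * The exponential on the Taylor resolution and its values on pure tensors *)

Section TaylorGamma.
Variables (k : fieldType) (n r : nat) (F : 'I_r -> dgData k n).
Variable HF : forall i, is_dgAlgebra (F i).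
Local Notation R := (fun i : 'I_r => vring (HF i)).
Local Notation upd f i x := (@dfwith _ R f i x).
Local Notation "'Pi'" := (forall i : 'I_r, vring (HF i)).
Local Notation HT := (taylor_dg HF).
Local Notation W := (vring HT).
Local Notation S := (evenring HT).
Variables (v : forall i, vring (HF i) -> nat -> vring (HF i)).
Hypothesis vP : forall i, vGamma (@v i).
Implicit Types (b : tgen F) (d : 'I_r -> nat) (f : Pi).

Lemma dpow_odd_scale f l c (x : vring (HF l)) j :
  dpow_odd (upd f l (c *: x)) j = c ^+ j *: dpow_odd (upd f l x) j.
Proof.
case: j => [|[|j]] /=; first by rewrite expr0 scale1r.
  by rewrite rtensZ.
by rewrite scaler0.
Qed.

(** The total degree is even, so besides slot l there is another odd slot. It is the same in both
    tensors, hence its square, and with it the coefficient of t^2, vanishes. *)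
Lemma dpow_odd_add d f l (x y : vring (HF l)) :
  (forall l, hom (d l) (f l)) -> hom (d l) x -> hom (d l) y ->
  ~~ odd (\sum_(i < r) d i) -> (exists i, odd (d i)) ->
  dpow_odd (upd f l (x + y)) = conv (dpow_odd (upd f l x)) (dpow_odd (upd f l y)).
Proof.
move=> hf hx hy dE [i odi].
have [l' ne odl'] : exists2 l', l != l' & odd (d l').
  by have [e|ne] := eqVneq l i; [exact: (even_total dE (etrans (congr1 (fun l => odd (d l)) e) odi)) | exists i].
apply: functional_extensionality => -[|[|j]].
- by rewrite /conv big_ord_recl big_ord0 /= mulr1 addr0.
- by rewrite /conv !big_ord_recl big_ord0 /= rtensD mul1r mulr1 addr0 addrC.
rewrite conv_small // => [[//|[//|j']] _|[//|[//|j']] _|] //=.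
apply: (@rtens_mul0 _ _ _ _ HF d d _ _ l'); try exact: rupd_hom.
by rewrite !dfwith_out // (sqr0_odd (hf l')).
Qed.

Definition basisf b : Pi := fun i => << b i >>.

Lemma thdeg_gt0 b : (0 < thdeg b)%N -> exists i, (0 < hdeg (b i))%N.
Proof.
have [i di _|all0] := pickP (fun i => (0 < hdeg (b i))%N); first by exists i.
by rewrite /thdeg big1 // => i _; have := all0 i; case: (hdeg _).
Qed.

Lemma basisf_hom b i : hom (hdeg (b i)) (basisf b i). Proof. exact: hom_basis. Qed.
Arguments basisf_hom b i : clear implicits.

Lemma rtens_basis b : rtens (basisf b) = << b >> :> W.
Proof. exact: tens_basis. Qed.

(* Any slot of positive degree may carry the divided power, see
   [dpow_even_indep].  Outside even positive degrees the value is junk. *)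
Definition deltaW b : nat -> W :=
  if (0 < thdeg b)%N && ~~ odd (thdeg b) then
    if [exists i, odd (hdeg (b i))] then dpow_odd (basisf b)
    else if [pick i | (0 < hdeg (b i))%N] is Some i then dpow_even v i (basisf b)
    else conv1 W
  else conv1 W.

Variant deltaW_spec b : (nat -> W) -> Prop :=
| DeltaTriv of ~~ ((0 < thdeg b)%N && ~~ odd (thdeg b)) : deltaW_spec b (conv1 W)
| DeltaOdd i of (0 < thdeg b)%N & ~~ odd (thdeg b) & odd (hdeg (b i)) :
    deltaW_spec b (dpow_odd (basisf b))
| DeltaEven i of (0 < thdeg b)%N & ~~ odd (thdeg b) & (forall l, ~~ odd (hdeg (b l)))
    & (0 < hdeg (b i))%N : deltaW_spec b (dpow_even v i (basisf b)).

Lemma deltaWP b : deltaW_spec b (deltaW b).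
Proof.
rewrite /deltaW; case: (boolP (_ && _)) => [/andP[pos ev]|]; last exact: DeltaTriv.
case: existsP => [[i odi]|nod]; first exact: DeltaOdd odi.
have all_even l : ~~ odd (hdeg (b l)) by apply/negP => odl; case: nod; exists l.
case: pickP => [i di|all0]; first exact: DeltaEven.
by move: pos; rewrite /thdeg big1 // => i _; have := all0 i; case: (hdeg _).
Qed.

Lemma deltaW_hom b j : ~~ odd (thdeg b) -> hom (j * thdeg b) (deltaW b j).
Proof.
move=> ev; case: deltaWP => [|i pos _ odi|i pos _ de di].
- by rewrite ev andbT lt0n negbK => /eqP ->; rewrite muln0 /conv1; case: j => [|j];
    [apply: hom1 | apply: hom0].
- case: j => [|[|j]] /=; [exact: hom1 | | exact: hom0].
  by rewrite mul1n; apply: rtens_hom; apply: basisf_hom.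
rewrite /thdeg big_distrr /=; apply: rtens_hom.
exact: (dpow_even_hom vP de di (basisf_hom b)).
Qed.

(** Basis elements of odd degree are included, so that [delta] can take values in the even ring for
    every b. *)
Lemma deltaW_even b j : evenp (deltaW b j).
Proof.
have [od|ev] := boolP (odd (thdeg b)); last first.
  by apply: (hom_even (deltaW_hom (j := j) ev)); rewrite oddM (negPf ev) andbF.
rewrite /deltaW od andbF /conv1; case: eqP => _; last exact: evenp0.
by apply: (@hom_even _ _ _ HT 0) => //; apply: hom1.
Qed.

Lemma deltaW_divpow b h j : deltaW b 0 = 1 /\
  deltaW b h * deltaW b j = deltaW b (h + j) *+ 'C(h + j, h).
Proof.
case: deltaWP => [_|i pos ev odi|i pos ev de di].
- split=> //; case: h j => [|h] [|j]; rewrite /conv1 /= ?mulr0 ?mul0r ?mul0rn ?mulr1 ?mul1r ?bin0 //.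
- split=> //; case: h => [|h]; first by rewrite add0n bin0 mul1r mulr1n.
  case: j => [|j]; first by rewrite addn0 binn mulr1 mulr1n.
  rewrite addSnnS addnC; case: h => [|h]; case: j => [|j] /=; rewrite ?mulr0 ?mul0r ?mul0rn //.
  apply: (@rtens_mul0 _ _ _ _ HF (fun i => hdeg (b i)) (fun i => hdeg (b i)) _ _ i).
  + exact: basisf_hom.
  + exact: basisf_hom.
  + exact: sqr0_odd (basisf_hom b i) odi.
split; first exact: (dpow_even0 vP de di (basisf_hom b)).
exact: (dpow_even_mul vP de di h j (basisf_hom b)).
Qed.

Definition delta b : nat -> S := fun j => toeven (deltaW b j).

Lemma delta_val b j : evenval (delta b j) = deltaW b j.
Proof. by rewrite toevenK // deltaW_even. Qed.

Lemma delta_divpow b : divpow (delta b).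
Proof.
split=> [|h j]; apply: evenval_inj.
  by rewrite delta_val evenval1; case: (deltaW_divpow b 0 0).
by rewrite evenvalM evenvalMn !delta_val; case: (deltaW_divpow b h j).
Qed.

Definition iota (c : k) : S := toeven (c *: (1 : W)).

Lemma iota_val c : evenval (iota c) = c *: (1 : W).
Proof. by rewrite toevenK //; apply: (hom_even (d := 0)) => //; apply: homZ; apply: hom1. Qed.

Lemma iota0 : iota 0 = 0.
Proof. by apply: evenval_inj; rewrite iota_val evenval0 scale0r. Qed.
Lemma iota1 : iota 1 = 1.
Proof. by apply: evenval_inj; rewrite iota_val evenval1 scale1r. Qed.
Lemma iotaD c c' : iota (c + c') = iota c + iota c'.
Proof. by apply: evenval_inj; rewrite evenvalD !iota_val scalerDl. Qed.
Lemma iotaM c c' : iota (c * c') = iota c * iota c'.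
Proof. by apply: evenval_inj; rewrite evenvalM !iota_val -vscalerAl mul1r scalerA. Qed.

Definition expS (x : W) : nat -> S := expf iota delta x.
Definition expW (x : W) (j : nat) : W := evenval (expS x j).

Lemma expSD x y : expS (x + y) = conv (expS x) (expS y).
Proof. exact: (expfD iota0 iotaD delta_divpow). Qed.
Lemma expSZ c x : expS (c *: x) = scaleseq (iota c) (expS x).
Proof. exact: (expfZ iota0 iotaM delta_divpow). Qed.
Lemma expS0 : expS 0 = conv1 S.
Proof. exact: expf0. Qed.
Lemma expS_basis b : expS << b >> = delta b.
Proof. exact: (expf_basis iota1). Qed.
Lemma expS_divpow x : divpow (expS x).
Proof. exact: (expf_divpow _ delta_divpow). Qed.

Lemma val_conv (E E' : nat -> S) j : evenval (conv E E' j) = conv (fun i => evenval (E i)) (fun i => evenval (E' i)) j.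
Proof. by rewrite /conv evenval_sum; apply: eq_bigr => i _; rewrite evenvalM. Qed.

Lemma expWD x y j : expW (x + y) j = conv (expW x) (expW y) j.
Proof. by rewrite /expW expSD val_conv. Qed.

Lemma expWZ c x j : expW (c *: x) j = c ^+ j *: expW x j.
Proof.
rewrite /expW expSZ /scaleseq evenvalM evenvalX iota_val vexprZ expr1n.
by rewrite -vscalerAl mul1r.
Qed.

Lemma expW0 j : expW 0 j = conv1 W j.
Proof. by rewrite /expW expS0 /conv1; case: (j == 0%N); rewrite ?evenval1 ?evenval0. Qed.

Lemma expW_basis b j : expW << b >> j = deltaW b j.
Proof. by rewrite /expW expS_basis delta_val. Qed.

Lemma expW_0 x : expW x 0 = 1.
Proof. by rewrite /expW (expS_divpow x).1 evenval1. Qed.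

Lemma expW_mul x h j : expW x h * expW x j = expW x (h + j) *+ 'C(h + j, h).
Proof. by rewrite /expW -evenvalM (expS_divpow x).2 evenvalMn. Qed.

(** The prescribed formulas, with an arbitrary slot of positive degree in place of the first one. *)
Definition pure_pow d f (E : nat -> W) : Prop :=
  ((exists i, odd (d i)) -> E = dpow_odd f) /\
  (forall i, (forall l, ~~ odd (d l)) -> (0 < d i)%N -> E = dpow_even v i f).

Lemma multi_ind_ring d (P : Pi -> Prop) :
  (forall b, (forall i, hdeg (b i) = d i) -> P (basisf b)) ->
  (forall f i, (forall l, hom (d l) (f l)) -> P (upd f i 0)) ->
  (forall f i c (x y : vring (HF i)), (forall l, hom (d l) (f l)) -> hom (d i) x -> hom (d i) y ->
     P (upd f i x) -> P (upd f i y) -> P (upd f i (c *: x + y))) ->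
  forall f, (forall i, hom (d i) (f i)) -> P f.
Proof. exact: multi_ind. Qed.

(** Both sides turn a sum in one slot into a product of series and a scalar into a substitution, so
    the prescription on basis tensors spreads by [multi_ind_ring]. On the basis itself only the
    choice of slot has to be reconciled. *)
Lemma expW_rtens d f : (forall i, hom (d i) (f i)) ->
  (0 < \sum_(i < r) d i)%N -> ~~ odd (\sum_(i < r) d i) ->
  pure_pow d f (expW (rtens f)).
Proof.
move=> hf pos ev; move: f hf; apply: multi_ind_ring => [b hb|f i hf|f i c x y hf hx hy IHx IHy].
- have hd : thdeg b = (\sum_(i < r) d i)%N by apply: eq_bigr => i _; rewrite hb.
  have -> : expW (rtens (basisf b)) = deltaW b.
    by apply: functional_extensionality => j; rewrite rtens_basis expW_basis.
  case: deltaWP => [|i _ _ odi|i _ _ de di]; first by rewrite hd pos ev.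
    split=> // i' de'; by rewrite hb (negPf (de' i)) in odi.
  split=> [[l odl]|i' _ di']; first by rewrite -hb (negPf (de l)) in odl.
  apply: functional_extensionality => j; apply: (dpow_even_indep vP de di j (basisf_hom b)).
  by rewrite hb.
- have hf0 : forall l, hom (d l) (upd f i 0 l).
    by apply: rupd_hom => //; apply: hom0.
  have z : rtens (upd f i 0) = 0 by rewrite (@rtens0 _ _ _ _ _ _ i) // dfwith_in.
  rewrite z; split=> [_|i' de di].
    by apply: functional_extensionality => -[|[|j]]; rewrite expW0 /conv1 //= z.
  (* Writing 0 as 0 times 0 produces the factors 0^j, that is, the unit series. *)
  apply: functional_extensionality => j; rewrite expW0 -(scale0r 0) /=.
  rewrite (dpow_even_scale vP de di 0 j hf (@hom0 _ _ (F i) (d i))) /conv1.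
  case: j => [|j]; last by rewrite expr0n scale0r.
  by rewrite expr0 scale1r (dpow_even0 vP de di hf0).
have e : expW (rtens (upd f i (c *: x + y))) =
    conv (fun j => c ^+ j *: expW (rtens (upd f i x)) j) (expW (rtens (upd f i y))).
  apply: functional_extensionality => j; rewrite rtensD rtensZ expWD /conv.
  by apply: eq_bigr => a _; rewrite expWZ.
have hcx : hom (d i) (c *: x) by apply: homZ.
rewrite e; split=> [od|i' de di].
  rewrite (dpow_odd_add hf hcx hy ev od) IHx.1 // IHy.1 //; congr conv.
  by apply: functional_extensionality => j; rewrite dpow_odd_scale.
rewrite (dpow_even_add vP de di hf hcx hy) (IHx.2 i') // (IHy.2 i') //; congr conv.
by apply: functional_extensionality => j; rewrite (dpow_even_scale vP de di c j hf hx).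
Qed.

End TaylorGamma.

Arguments basisf_hom {k n r F} HF b i [a] _.

(** * Divided powers of products *)

Section TaylorGammaAxioms.
Variables (k : fieldType) (n r : nat) (F : 'I_r -> dgData k n).
Variable HF : forall i, is_dgAlgebra (F i).
Local Notation R := (fun i : 'I_r => vring (HF i)).
Local Notation "'Pi'" := (forall i : 'I_r, vring (HF i)).
Local Notation HT := (taylor_dg HF).
Local Notation W := (vring HT).
Variables (v : forall i, vring (HF i) -> nat -> vring (HF i)).
Hypothesis vP : forall i, vGamma (@v i).
Local Notation expS := (expS v).
Local Notation expW := (expW v).
Local Notation deltaW := (deltaW v).
Implicit Types (b : tgen F).

Definition evpos b : Prop := ~~ odd (thdeg b) /\ (0 < thdeg b)%N.
Definition evposp (x : W) : Prop := forall b : tgen F, coeff b x != 0 -> evpos b.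

Lemma hom_evposp d (x : W) : hom d x -> (0 < d)%N -> ~~ odd d -> evposp x.
Proof. by move=> hx d0 de b /hx hb; rewrite /evpos [thdeg b]hb. Qed.

Lemma basis_hom b : hom (thdeg b) (<< b >> : W).
Proof. exact: (@hom_basis _ _ (taylor F)). Qed.
Arguments basis_hom b : clear implicits.

Lemma evposp_ind (P : W -> Prop) : P 0 ->
  (forall c b x, evpos b -> evposp x -> P x -> P (c *: << b >> + x)) ->
  forall x, evposp x -> P x.
Proof. exact: freeg_ind_in. Qed.

(** The coefficient of t is additive on products of series with constant term 1. *)
Lemma expW_1 x : evposp x -> expW x 1 = x.
Proof.
move: x; apply: evposp_ind => [|c b x [be b0] _ IHx]; first by rewrite expW0.
rewrite (expWD vP) /conv !big_ord_recl big_ord0 /= !(expW_0 vP) (expWZ vP) IHx mul1r mulr1 addr0.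
rewrite addrC expr1; congr (_ *: _ + _); rewrite (expW_basis vP).
case: deltaWP => [|i _ _ _|i _ _ de di]; first by rewrite be b0.
  exact: rtens_basis.
by rewrite (dpow_even1 vP de di (basisf_hom HF b)) rtens_basis.
Qed.

Lemma deltaW_1 b : evpos b -> deltaW b 1 = << b >>.
Proof.
move=> hb; rewrite -(expW_basis vP) expW_1 //.
by apply: (hom_evposp (basis_hom b)); case: hb.
Qed.

Lemma basis_mul b b' : (<< b >> : W) * << b' >> =
  (-1) ^+ crossing (fun i => hdeg (b i)) (fun i => hdeg (b' i)) *:
  rtens (fun i => basisf HF b i * basisf HF b' i).
Proof.
by rewrite -!(rtens_basis HF) (rtens_mul (basisf_hom HF b) (basisf_hom HF b')).
Qed.

Lemma basisf_mul_hom b b' i :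
  hom (hdeg (b i) + hdeg (b' i)) (basisf HF b i * basisf HF b' i).
Proof. by apply: hom_mul; apply: basisf_hom. Qed.
Arguments basisf_mul_hom b b' i : clear implicits.

Lemma sum_thdeg b b' : (\sum_(i < r) (hdeg (b i) + hdeg (b' i)) = thdeg b + thdeg b')%N.
Proof. by rewrite big_split. Qed.

(* If some slots of b or b' are odd, either some slot of the product is odd,
   or some slot is a product of two odd elements. *)
Lemma expW_basis_mul_odd b b' l j : (0 < thdeg b + thdeg b')%N -> ~~ odd (thdeg b + thdeg b') ->
  odd (hdeg (b l)) || odd (hdeg (b' l)) -> (2 <= j)%N ->
  expW ((<< b >> : W) * << b' >>) j = 0.
Proof.
move=> pos ev odl lej; rewrite basis_mul (expWZ vP).
have := expW_rtens vP (basisf_mul_hom b b'); rewrite sum_thdeg => /(_ pos ev) [pO pE].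
have [i odi|all_even] := pickP (fun i => odd (hdeg (b i) + hdeg (b' i))).
  by rewrite pO; [case: j lej => [|[|j]] //=; rewrite scaler0 | exists i].
have := all_even l; rewrite /= oddD => e; move: odl.
have {e}-> : odd (hdeg (b' l)) = odd (hdeg (b l)) by move: e; case: (odd _); case: (odd _).
rewrite orbb => odl; rewrite (pE l) => [|i|]; last first.
- by rewrite addn_gt0 odd_gt0.
- by rewrite all_even.
rewrite /dpow_even (@rtens0 _ _ _ _ _ _ l) ?scaler0 // dfwith_in.
rewrite (vg_odd (@vP l) (basisf_hom HF b l) (basisf_hom HF b' l)) //.
by have := all_even l; rewrite /= oddD odl; case: (odd _).
Qed.

(** For j >= 2 an odd slot kills both sides: in b it gives b^2 = 0, in b' it makes the power of b'
    vanish. If all slots are even, the claim is the even-product axiom in one positive slot of b'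
    and commutation in the others. *)
Lemma expW_basis_mul b b' j : ~~ odd (thdeg b) -> evpos b' ->
  expW ((<< b >> : W) * << b' >>) j = (<< b >> : W) ^+ j * deltaW b' j.
Proof.
move=> eb eb'; have [e' p'] := eb'.
have pos : (0 < thdeg b + thdeg b')%N by rewrite addn_gt0 p' orbT.
have ev : ~~ odd (thdeg b + thdeg b') by rewrite oddD (negPf eb) (negPf e').
case: j => [|[|j]].
- by rewrite (expW_0 vP) expr0 mul1r; case: (deltaW_divpow vP b' 0 0).
- rewrite expr1 deltaW_1 // expW_1 //.
  by apply: (hom_evposp (hom_mul (basis_hom b) (basis_hom b'))).
have [l odl|all_even] := pickP (fun l => odd (hdeg (b l)) || odd (hdeg (b' l))).
  rewrite (expW_basis_mul_odd pos ev odl) //; case/orP: odl => odl.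
    rewrite !exprS [X in X * _]mulrA -{1 2}(rtens_basis HF).
    rewrite (@rtens_mul0 _ _ _ _ HF _ _ _ _ l (basisf_hom HF b) (basisf_hom HF b)) ?mul0r //.
    exact: sqr0_odd (basisf_hom HF b l) odl.
  case: deltaWP => [_|i _ _ _|i _ _ de _]; [by rewrite mulr0| by rewrite mulr0|].
  by have := de l; rewrite odl.
have de l : ~~ odd (hdeg (b l)) by have /negbT := all_even l; rewrite negb_or => /andP[].
have de' l : ~~ odd (hdeg (b' l)) by have /negbT := all_even l; rewrite negb_or => /andP[].
rewrite -{1 2}(rtens_basis HF) -(rtens_basis HF b').
rewrite (rtens_mul_even (basisf_hom HF b) (basisf_hom HF b') de).
have := expW_rtens vP (basisf_mul_hom b b'); rewrite sum_thdeg => /(_ pos ev) [_ pE].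
case: deltaWP => [|i _ _ odi|i _ _ _ di]; first by rewrite e' p'.
  by have := de' i; rewrite odi.
rewrite (pE i) => [|l|]; first last.
- by rewrite addn_gt0 di orbT.
- by rewrite oddD (negPf (de l)) (negPf (de' l)).
rewrite (rtens_exp _ (basisf_hom HF b) de).
rewrite (rtens_mul_even (fun l => hom_exp (j := j.+2) (basisf_hom HF b l))
   (dpow_even_hom vP de' di (j := j.+2) (basisf_hom HF b'))); last first.
  by move=> l; rewrite oddM (negPf (de l)) andbF.
congr rtens; apply: rupd_eq.
  by rewrite dfwith_in (vg_even (@vP i) (basisf_hom HF b i) (basisf_hom HF b' i)).
move=> l ne; rewrite dfwith_out // exprMn_comm //.
by apply: comm_even; apply: (hom_even (basisf_hom HF b l)).
Qed.

(** Both sides turn sums in x, and sums in y, into products of series, so basis elements suffice. No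
    homogeneity is required. *)
Lemma expS_mul x y : evenp x -> evposp y -> expS (x * y) = scaleseq (toeven x) (expS y).
Proof.
move=> ex ey; have dpy z : divpow (expS z) by apply: expS_divpow.
have eb b : ~~ odd (thdeg b) -> evenp (<< b >> : W).
  by move=> hb; apply: (hom_even (basis_hom b)).
have toL c x' y' : evenp x' -> evenp y' -> toeven (c *: x' + y') = iota HF c * toeven x' + toeven y'.
  move=> hx hy; apply: evenval_inj; rewrite evenvalD evenvalM iota_val !toevenK //; last exact: evenpL.
  by rewrite -vscalerAl mul1r.
move/evenpP: ex => ex; move: x ex.
apply: freeg_ind_in => [|c b x hb hx IHx].
  have -> : toeven (0 : W) = 0 by apply: evenval_inj; rewrite toevenK ?evenval0 ?evenp0.
  by rewrite mul0r (expS0 v) scale0seq.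
rewrite mulrDl -vscalerAl (expSD vP) (expSZ vP) IHx toL; first last.
- exact/evenpP.
- exact: eb.
rewrite (scaleseqD _ _ (dpy y)) -(scaleseqM (iota HF c)).
suff -> : expS ((<< b >> : W) * y) = scaleseq (toeven (<< b >> : W)) (expS y) by [].
move=> {c x hx IHx}.
move: y ey; apply: evposp_ind => [|c b' y hb' hy IHy].
  by rewrite mulr0 (expS0 v) scaleseq1.
rewrite mulrDr -vscalerAr !(expSD vP) !(expSZ vP) IHy scaleseq_conv !scaleseqM.
rewrite [_ * iota _ _]mulrC -(scaleseqM (iota HF c)).
suff -> : expS ((<< b >> : W) * << b' >>) = scaleseq (toeven (<< b >> : W)) (expS << b' >>) by [].
apply: functional_extensionality => j; apply: evenval_inj.
rewrite [LHS](expW_basis_mul j hb hb') /scaleseq evenvalM evenvalX toevenK ?eb //.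
by rewrite (expS_basis v) (delta_val vP).
Qed.

(** Odd factors lie outside the even ring, so [expS_mul] does not apply. Peeling off the terms of x,
    then those of y, only multiplies series that stop at t; the product of their linear coefficients
    repeats an odd factor and vanishes. *)
Lemma expW_mul_odd e e' (x y : W) j : hom e x -> hom e' y -> odd e -> odd e' ->
  (2 <= j)%N -> expW (x * y) j = 0.
Proof.
move=> hx hy od od'.
have evp (x' y' : W) : hom e x' -> hom e' y' -> evposp (x' * y').
  move=> hx' hy'; apply: (hom_evposp (hom_mul hx' hy')); first by rewrite addn_gt0 odd_gt0.
  by rewrite oddD od od'.
have homL e0 c b : thdeg b = e0 -> hom e0 (c *: (<< b >> : W)).
  by move=> <-; apply: homZ; apply: basis_hom.
move: j; move: x hx; apply: freeg_ind_in => [|c b x hb hx IHx] j lej.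
  by rewrite mul0r expW0 /conv1; case: j lej.
have hcb : hom e (c *: (<< b >> : W)) by apply: homL.
rewrite mulrDl (expWD vP); apply: (conv_small _ IHx _ lej); last first.
  rewrite !expW_1; try exact: evp.
  rewrite -!mulrA [X in _ * X]mulrA (comm_odd hy hx) // mulNr -mulrA (sqr0_odd hy) //.
  by rewrite mulr0 oppr0 mulr0.
move=> {j lej} j lej; rewrite -vscalerAl (expWZ vP) -[RHS](scaler0 _ (c ^+ j)); congr (_ *: _).
move=> {x hx IHx hcb c}; have hb' : hom e (<< b >> : W) by rewrite -hb; apply: basis_hom.
move: j lej; move: y hy; apply: freeg_ind_in => [|c b' y hb2 hy IHy] j lej.
  by rewrite mulr0 expW0 /conv1; case: j lej.
have hcb : hom e' (c *: (<< b' >> : W)) by apply: homL.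
rewrite mulrDr (expWD vP); apply: (conv_small _ IHy _ lej); last first.
  rewrite !expW_1; try exact: evp.
  rewrite -!mulrA [X in _ * X]mulrA (comm_odd hcb hb') // mulNr mulrN -!mulrA mulrA.
  by rewrite (sqr0_odd hb') // mul0r oppr0.
move=> {j lej} j lej; rewrite -vscalerAr (expWZ vP) -[RHS](scaler0 _ (c ^+ j)); congr (_ *: _).
have [l odl] : exists l, odd (hdeg (b l)) by apply: odd_total; rewrite [odd _](_ : _ = odd e) // -hb.
apply: (@expW_basis_mul_odd b b' l); rewrite ?odl // [thdeg b]hb [thdeg b']hb2 ?addn_gt0 ?odd_gt0 //.
by rewrite oddD od od'.
Qed.

End TaylorGammaAxioms.

Arguments basis_hom {k n r F} HF b [a] _.

(** * Iterated powers, differential and multidegree bounds *)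

Section TaylorGammaStructure.
Variables (k : fieldType) (n r : nat) (F : 'I_r -> dgData k n).
Variable HF : forall i, is_dgAlgebra (F i).
Local Notation R := (fun i : 'I_r => vring (HF i)).
Local Notation upd f i x := (@dfwith _ R f i x).
Local Notation "'Pi'" := (forall i : 'I_r, vring (HF i)).
Local Notation HT := (taylor_dg HF).
Local Notation W := (vring HT).
Local Notation S := (evenring HT).
Variables (v : forall i, vring (HF i) -> nat -> vring (HF i)).
Hypothesis vP : forall i, vGamma (@v i).
Local Notation expS := (expS v).
Local Notation expW := (expW v).
Local Notation deltaW := (deltaW v).
Implicit Types (b : tgen F) (f : Pi).

Definition posdeg (x : W) : Prop := forall b : tgen F, coeff b x != 0 -> (0 < thdeg b)%N.

Lemma posdeg_hom d (x : W) : hom d x -> (0 < d)%N -> posdeg x.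
Proof. by move=> hx d0 b /hx hb; rewrite [thdeg b]hb. Qed.

Lemma posdeg0 : posdeg 0. Proof. by move=> b; rewrite coeff0 eqxx. Qed.

Lemma posdegD x y : posdeg x -> posdeg y -> posdeg (x + y).
Proof.
move=> hx hy b; rewrite coeffD; have [->|nz _] := eqVneq (coeff b x) 0.
  by rewrite add0r; apply: hy.
exact: hx.
Qed.

Lemma posdegZ c x : posdeg x -> posdeg (c *: x).
Proof.
by move=> hx b; rewrite coeffZ => h; apply: hx; apply: contraNneq h => ->; rewrite mulr0.
Qed.

Lemma posdegM x y : posdeg x -> posdeg (y * x).
Proof.
move: x; apply: freeg_ind_in => [|c b x hb _ IHx]; first by rewrite mulr0; apply: posdeg0.
rewrite mulrDr -vscalerAr; apply: posdegD => //; apply: posdegZ => {c x IHx}.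
elim/freeg_ind: y => [|c b' y IHy]; first by rewrite mul0r; apply: posdeg0.
rewrite mulrDl -vscalerAl; apply: posdegD => //; apply: posdegZ.
apply: (posdeg_hom (hom_mul (basis_hom HF b') (basis_hom HF b))).
by rewrite addn_gt0 hb orbT.
Qed.

Lemma deltaW_posdeg b j : (0 < j)%N -> posdeg (deltaW b j).
Proof.
move=> j0; have := @deltaW_hom _ _ _ _ _ _ vP b j; case: deltaWP => [_ _|i p e _ h|i p e _ _ h].
- by rewrite /conv1 gtn_eqF //; apply: posdeg0.
- by apply: (posdeg_hom (h e)); rewrite muln_gt0 j0.
- by apply: (posdeg_hom (h e)); rewrite muln_gt0 j0.
Qed.

Lemma expW_posdeg x j : (0 < j)%N -> posdeg (expW x j).
Proof.
elim/freeg_ind: x j => [|c b x IHx] j j0.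
  by rewrite expW0 /conv1 gtn_eqF //; apply: posdeg0.
rewrite (expWD vP) /conv; apply: big_ind => [||i _]; [exact: posdeg0|exact: posdegD|].
have [i0|i0] := posnP i; first by apply: posdegM; apply: IHx; rewrite i0 subn0.
rewrite [_ * _](_ : _ = expW x (j - i) * expW (c *: << b >>) i); last first.
  exact/comm_even/evenval_even.
apply: posdegM; rewrite (expWZ vP) (expW_basis vP); apply: posdegZ.
exact: deltaW_posdeg.
Qed.

(** Powers of positive index have no component of degree 0; this is what makes their own divided
    powers subject to the product rule. *)
Lemma expW_evposp x j : (0 < j)%N -> evposp (expW x j).
Proof.
move=> j0 b hb; split; last exact: (expW_posdeg j0 hb).
by have /evenpP := evenval_even (expS x j); apply.
Qed.

(** With an odd slot all powers from the second on vanish. Otherwise the axiom is applied in one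
    positive slot, and the remaining slots only need (f^h)^j = f^(h j). *)
Lemma expW_comp_basis b h j : evpos b -> (0 < h)%N ->
  expW (expW << b >> h) j = expW << b >> (h * j) *+ comp_coef h j.
Proof.
move=> [be b0] h0; have hb := basisf_hom HF b.
have := expW_rtens vP hb b0 be; rewrite (rtens_basis HF) => -[pO pE].
have [l odl|all_even] := pickP (fun l => odd (hdeg (b l))).
  have e : expW << b >> = dpow_odd (basisf HF b) by apply: pO; exists l.
  rewrite !e; case: h h0 => [//|[|h]] _.
    rewrite mul1n /= (rtens_basis HF) e /comp_coef mul1n (factS 0) fact0 exp1n muln1 divnn fact_gt0.
    by rewrite mulr1n.
  case: j => [|j].
    by rewrite muln0 /comp_coef muln0 expn0 fact0 mulr1n (expW_0 vP).
  have -> : dpow_odd (basisf HF b) (h.+2 * j.+1) = 0.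
    have : (2 <= h.+2 * j.+1)%N by lia.
    by case: (h.+2 * j.+1)%N => [|[|l']].
  by rewrite mul0rn [expW _ _]expW0.
have de l : ~~ odd (hdeg (b l)) by have /negbT := all_even l.
have [i di] := thdeg_gt0 b0.
have e := pE i de di; rewrite !e /dpow_even.
have hf := dpow_even_hom vP de di (j := h) hb.
have := expW_rtens vP hf; rewrite -big_distrr /= => /(_ _ _) [||_ pE'].
- by rewrite muln_gt0 h0.
- by rewrite oddM (negPf be) andbF.
rewrite (pE' i) => [|l|]; first last.
- by rewrite muln_gt0 h0.
- by rewrite oddM (negPf (de l)) andbF.
rewrite /dpow_even -rtensMn; congr rtens; apply: rupd_eq.
  by rewrite !dfwith_in (vg_comp (@vP i) j (hb i)).
by move=> l ne; rewrite !dfwith_out // exprM.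
Qed.

Lemma expW_comp x h j : evposp x -> (0 < h)%N ->
  expW (expW x h) j = expW x (h * j) *+ comp_coef h j.
Proof.
move=> hx; move: x hx h j; apply: evposp_ind => [|c b x hb hx IHx] h j h0.
  have -> : expW 0 h = 0 by rewrite expW0 /conv1 gtn_eqF.
  rewrite !expW0 /conv1; case: j => [|j].
    by rewrite muln0 /comp_coef muln0 expn0 fact0 mulr1n.
  by rewrite (_ : (h * j.+1 == 0)%N = false) ?mul0rn // muln_eq0 gtn_eqF.
have hcb l : expW (expW (c *: << b >>) h) l = expW (c *: << b >>) (h * l) *+ comp_coef h l.
  by rewrite !(expWZ vP) (expW_comp_basis _ hb) // -exprM scalerMnr.
pose E := expS (c *: << b >>); pose E' := expS x.
have dE : divpow E by apply: (expS_divpow vP).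
have dE' : divpow E' by apply: (expS_divpow vP).
(* The exponential series of the i-th summand of (c b + x)^(h). *)
pose X i := expS (evenval (E i * E' (h - i)%N)).
have := comp_conv dE dE' (X := X) h0 _ _ j.
have -> : (\big[@conv S/conv1 S]_(i < h.+1) X i) j = expS (evenval (conv E E' h)) j.
  rewrite /conv evenval_sum /X.
  by rewrite (big_morph _ (expSD vP) (expS0 v)).
move=> H; rewrite {1}/expW -[in RHS]/(evenval _).
have -> : expW (c *: << b >> + x) h = evenval (conv E E' h) by rewrite /expW (expSD vP).
rewrite H; first by rewrite evenvalMn /expW (expSD vP).
- move=> i l lt; rewrite /X evenvalM (expS_mul vP) ?evenval_even //; last first.
    by apply: expW_evposp; rewrite subn_gt0.
  rewrite /scaleseq; congr (_ * _).
    by congr (_ ^+ _); apply: evenval_inj; rewrite toevenK // evenval_even.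
  by apply: evenval_inj; rewrite evenvalMn; apply: IHx; rewrite subn_gt0.
- move=> l; rewrite /X subnn dE'.1 mulr1; apply: evenval_inj; rewrite evenvalMn.
  exact: hcb.
Qed.

Lemma vdiff_rtens d f : (forall i, hom (d i) (f i)) -> (forall i, ~~ odd (d i)) ->
  vdiff (rtens f) = \sum_(i < r) rtens (upd f i (vdiff (f i))) :> W.
Proof.
move=> hf de; rewrite [LHS](vdiff_tens HF hf); apply: eq_bigr => i _.
suff /negPf e : ~~ odd (before d i) by rewrite -signr_odd e expr0 scale1r.
by rewrite /before (big_morph odd oddD (erefl _ : odd 0 = false)) big1 // => l _; apply/negbTE.
Qed.

Lemma vdiff_rtens_hom d f i : (forall i, hom (d i) (f i)) ->
  forall l, hom (@dfwith _ (fun=> nat) d i (d i).-1 l) (upd f i (vdiff (f i)) l).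
Proof. exact: hom_vdiff_pred. Qed.

Lemma expW_diff_basis b j : evpos b ->
  vdiff (expW << b >> j.+1) = expW << b >> j * (vdiff (<< b >> : W) : W) :> W.
Proof.
move=> [be b0]; have hb := basisf_hom HF b.
have := expW_rtens vP hb b0 be; rewrite (rtens_basis HF) => -[pO pE].
have dL := vdiff_linear (dg_pre HT).
have [l odl|all_even] := pickP (fun l => odd (hdeg (b l))).
  have -> : expW << b >> = dpow_odd (basisf HF b) by apply: pO; exists l.
  case: j => [|[|j]] /=; first by rewrite mul1r (rtens_basis HF).
    rewrite (lin0 dL) (rtens_basis HF) -(rtens_basis HF) [vdiff _](vdiff_tens HF hb).
    rewrite mulr_sumr big1 // => i _; rewrite -vscalerAr.
    have [l' ne odl'] : exists2 l', i != l' & odd (hdeg (b l')).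
      have [e|ne] := eqVneq i l; last by exists l.
      by rewrite -e in odl; apply: (@even_total r (fun l => hdeg (b l)) i be odl).
    rewrite [_ * _](@rtens_mul0 _ _ _ _ HF _ _ _ _ l' hb (vdiff_rtens_hom (i := i) hb)) ?scaler0 //.
    by rewrite dfwith_out // (sqr0_odd (hb l')).
  by rewrite (lin0 dL) mul0r.
have de l : ~~ odd (hdeg (b l)) by have /negbT := all_even l.
have [i di] := thdeg_gt0 b0.
have e := pE i de di; rewrite !e /dpow_even.
have hf l := dpow_even_hom vP de di (j := l) hb.
have odf l l' : ~~ odd (l * hdeg (b l')) by rewrite oddM (negPf (de l')) andbF.
rewrite (vdiff_rtens (hf j.+1)) // -[in RHS](rtens_basis HF) (vdiff_rtens hb) // mulr_sumr.
apply: eq_bigr => l _.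
rewrite (rtens_mul_even (hf j) (vdiff_rtens_hom (i := l) hb)) //.
have [eil|ne] := eqVneq i l.
  case: _ / eil; congr rtens; apply: rupd_eq.
    by rewrite !dfwith_in (vg_diff (@vP i) _ (hb i)).
  by move=> l' ne; rewrite !dfwith_out // exprSr.
have ne' : l != i by rewrite eq_sym.
(* Differentiating f_l^(j + 1) as an ordinary power yields the integer j + 1. It moves to slot i,
   where v_j f_i = (j + 1) v_(j + 1); this is what the right-hand side has there. *)
pose E := upd (upd (fun l0 => basisf HF b l0 ^+ j.+1) i (v (basisf HF b i) j.+1)) l
    (basisf HF b l ^+ j * vdiff (basisf HF b l)).
transitivity (rtens E *+ j.+1).
  rewrite dfwith_out // vdiff_exp; last exact: (hom_even (hb l)).
  by rewrite rtensMn.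
have -> : E = upd E i (E i).
  by apply/esym/rupd_eq.
rewrite -rtensMn; congr rtens; apply: rupd_eq.
  have vj : v (basisf HF b i) j * basisf HF b i = v (basisf HF b i) j.+1 *+ j.+1.
    by have := vg_mul (@vP i) j 1 (hb i) di (de i); rewrite (vg1 (@vP i) (hb i)) // addn1 binSn.
  by rewrite /E dfwith_out // !dfwith_in dfwith_out // vj.
move=> l' nel'; rewrite /E; have [ell|nel] := eqVneq l l'.
  by case: _ / ell in nel' *; rewrite !dfwith_in dfwith_out.
by rewrite !dfwith_out // exprSr.
Qed.

Lemma expW_diff x j : evposp x -> vdiff (expW x j.+1) = expW x j * (vdiff x : W) :> W.
Proof.
move=> hx; have dL := vdiff_linear (dg_pre HT).
move: x hx j; apply: evposp_ind => [|c b x hb hx IHx] j.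
  by rewrite expW0 !(lin0 dL) mulr0.
have hcb l : vdiff (expW (c *: << b >>) l.+1) =
    expW (c *: << b >>) l * (vdiff (c *: << b >> : W) : W) :> W.
  rewrite !(expWZ vP) !(linZ dL) (expW_diff_basis _ hb) -vscalerAl -vscalerAr scalerA exprSr.
  by [].
have comm y l (z : W) : z * expW y l = expW y l * z.
  by rewrite [RHS]comm_even //; apply: evenval_even.
rewrite (linD dL); move: hcb; set y := c *: << b >> => hcb.
have z0 y' : vdiff (expW y' 0) = 0 by rewrite (expW_0 vP) (vdiff_bottom (dg_pre HT)) //; apply: hom1.
rewrite !(expWD vP) /conv (lin_sum dL).
have -> : \sum_(i < j.+2) vdiff (expW y i * expW x (j.+1 - i)%N) =
   \sum_(i < j.+2) ((vdiff (expW y i) : W) * expW x (j.+1 - i)%N) +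
   \sum_(i < j.+2) (expW y i * (vdiff (expW x (j.+1 - i)%N) : W)) :> W.
  rewrite -big_split; apply: eq_bigr => i _; rewrite vdiff_even //; exact: evenval_even.
(* The constant terms are 1 and have zero differential, so each sum loses one end term and both get
   the length of the right-hand side. *)
rewrite big_ord_recl z0 mul0r add0r [X in _ + X]big_ord_recr /= subnn z0 mulr0 addr0 mulrDr.
rewrite !mulr_suml; congr (_ + _); apply: eq_bigr => i _.
  by rewrite /bump /= add1n subSS hcb -!mulrA; congr (_ * _); apply: comm.
by rewrite subSn -1?ltnS // IHx mulrA.
Qed.

(** Rests on [lcms_muln]: the least common multiple of j-th powers is the j-th power of the least
    common multiple. *)
Lemma deltaW_bnd b j : ~~ odd (thdeg b) -> (0 < thdeg b)%N ->
  @bnd _ _ (taylor F) (j * thdeg b) (tmultideg b *+ j)%MM (deltaW b j).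
Proof.
move=> be b0; have hb := basisf_hom HF b.
have bb l : bnd (hdeg (b l)) (multideg (b l)) (basisf HF b l) by apply: bnd_basis.
case: deltaWP => [|i _ _ odi|i _ _ de di]; first by rewrite be b0.
  case: j => [|[|j]] /=; last exact: bnd0.
    exact: (vone_bnd (dg_pre HT)).
  by rewrite (rtens_basis HF) mul1n mulm1n; apply: (@bnd_basis _ _ (taylor F)).
rewrite /thdeg big_distrr /= /tmultideg -lcms_muln; apply: bnd_tens => l.
have [e|ne] := eqVneq i l; first by case: _ / e; rewrite dfwith_in; apply: (vg_bnd (@vP i)).
by rewrite dfwith_out //; apply: bnd_exp.
Qed.

Lemma expW_bnd d m (x : W) j : bnd d m x -> (0 < d)%N -> ~~ odd d ->
  bnd (j * d) (m *+ j)%MM (expW x j).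
Proof.
move=> hx d0 de; move: x hx j.
apply: (@freeg_ind_in k (tgen F) (fun b => thdeg b = d /\ (tmultideg b <= m)%MM)).
  move=> j; rewrite expW0 /conv1; case: j => [|j]; last exact: bnd0.
  exact: (vone_bnd (dg_pre HT)).
move=> c b x [hb mb] _ IHx j; rewrite (expWD vP); apply: bnd_sum => -[i /= lei] _.
rewrite -[in (j * d)%N](subnKC (lei : (i <= j)%N)) mulnDl.
rewrite -[in (m *+ j)%MM](subnKC (lei : (i <= j)%N)) mulmnD.
apply: (vmul_bnd (dg_pre HT)) => //; rewrite (expWZ vP) (expW_basis vP); apply: bndZ.
apply: (@bnd_le _ _ (taylor F) _ (tmultideg b *+ i)%MM); first exact: lem_muln.
by rewrite -hb; apply: deltaW_bnd; rewrite hb.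
Qed.

Lemma taylor_vGamma : vGamma expW.
Proof.
split.
- exact: expW_bnd.
- by move=> d x hx _ _; apply: expW_0.
- by move=> d x hx d0 de; apply: (expW_1 vP); apply: hom_evposp hx d0 de.
- by move=> d x h j _ _ _; apply: expW_mul.
- by move=> d x y j _ _ _ _; apply: expWD.
- by move=> d c x j _ _ _; apply: expWZ.
- move=> d d' x y j hx hy od od' lej; exact: (expW_mul_odd vP hx hy).
- move=> d d' x y j hx hy de d0 de' lej.
  rewrite {1}/expW (expS_mul vP) /scaleseq ?evenvalM ?evenvalX ?toevenK //.
  + exact: (hom_even hx).
  + exact: (hom_even hx).
  + exact: hom_evposp hy d0 de'.
- by move=> d x h j hx d0 de h0; apply: expW_comp => //; apply: hom_evposp hx d0 de.
- by move=> d x j hx d0 de; apply: expW_diff; apply: hom_evposp hx d0 de.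
Qed.

End TaylorGammaStructure.

(** * Divided powers are determined by their values on a basis *)

Section GammaExtensionality.
Variables (k : fieldType) (n : nat) (A : dgData k n) (H : is_dgAlgebra A).
Local Notation elem := {freeg (gen A) / {mpoly k[n]}}.
Local Notation V := (vring H).

(** Each term of a homogeneous element has the same degree, so additivity and scaling reduce to
    basis elements, where the powers 0 and 1 are forced. *)
Lemma vGamma_ext (v v' : V -> nat -> V) : vGamma v -> vGamma v' ->
  (forall (a : gen A) j, (0 < hdeg a)%N -> ~~ odd (hdeg a) -> (2 <= j)%N ->
     v << a >> j = v' << a >> j) ->
  forall d (x : V), hom d x -> (0 < d)%N -> ~~ odd d -> v x = v' x.
Proof.
move=> vP vP' e d x + d0 de; move: x; apply: freeg_ind_in => [|c a x ha hx IHx].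
  apply: functional_extensionality => -[|j]; last by rewrite (vgamma_zero vP) // (vgamma_zero vP').
  by rewrite (vg0 vP (@hom0 _ _ A d)) // (vg0 vP' (@hom0 _ _ A d)).
have ha' : hom d (<< a >> : V) by rewrite -ha; apply: hom_basis.
have hca : hom d (c *: (<< a >> : V)) by apply: homZ.
apply: functional_extensionality => j.
rewrite (vg_add vP _ hca hx) // (vg_add vP' _ hca hx) // IHx; apply: eq_bigr => i _.
rewrite (vg_scale vP _ _ ha') // (vg_scale vP' _ _ ha') //; congr (_ * _); congr (_ *: _).
case: (nat_of_ord i) => [|[|l]]; last by apply: e; rewrite ?ha.
  by rewrite (vg0 vP ha') // (vg0 vP' ha').
by rewrite (vg1 vP ha') // (vg1 vP' ha').
Qed.

Lemma dgGamma_ext (g g' : elem -> nat -> elem) (gP : is_dgGamma g) (gP' : is_dgGamma g') :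
  (forall (a : gen A) j, (0 < hdeg a)%N -> ~~ odd (hdeg a) -> (2 <= j)%N ->
     vgam (H := H) g << a >> j = vgam g' << a >> j) -> gamma_eq g g'.
Proof.
move=> e d m x j hx d0 de.
apply: (bihomog_inj (gamma_bihomog gP hx d0 de) (gamma_bihomog gP' hx d0 de)).
rewrite (ev_gamma H gP j hx) // (ev_gamma H gP' j hx) //.
rewrite (vGamma_ext (vgam_vGamma H gP) (vgam_vGamma H gP') e (bnd_hom (bihomog_bnd hx))) //.
Qed.

Lemma vgam_basis (g : elem -> nat -> elem) (gP : is_dgGamma g) (a : gen A) j :
  (0 < hdeg a)%N -> ~~ odd (hdeg a) -> vgam g (<< a >> : V) j = ev (g << a >> j).
Proof. by move=> d0 de; rewrite (ev_gamma H gP j (@bihomog_basis _ _ _ a)) // ev_basis. Qed.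

End GammaExtensionality.

(** * Inclusions and uniqueness *)

Section TaylorInclusions.
Variables (k : fieldType) (n r : nat) (F : 'I_r -> dgData k n).
Variable HF : forall i, is_dgAlgebra (F i).
Local Notation elem A := {freeg (gen A) / {mpoly k[n]}}.
Local Notation R := (fun i : 'I_r => vring (HF i)).
Local Notation upd f i x := (@dfwith _ R f i x).
Local Notation HT := (taylor_dg HF).
Local Notation W := (vring HT).
Local Notation incl := (@taylor_incl k n r F).

Definition vincl i (x : vring (HF i)) : W := rtens (upd (fun=> 1) i x).

Lemma one_bihomog i : @is_bihomog _ _ (F i) 0 0%MM (one_elt (F i)).
Proof. exact: (dg_one_bihomog (HF i)). Qed.
Arguments one_bihomog i : clear implicits.

Lemma sum_dfwith0 i e : (\sum_(l < r) @dfwith _ (fun=> nat) (fun=> 0%N) i e l = e)%N.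
Proof. by have := sum_dfwith (fun=> 0%N) i e; rewrite /= addn0 sum_nat_const muln0. Qed.

Lemma lcms_dfwith0 i u : lcms (@dfwith 'I_r (fun=> 'X_{1..n}) (fun=> 0%MM) i u) = u.
Proof.
apply/mnmP => l; apply/eqP; rewrite eqn_leq; apply/andP; split; move: l; apply/mnm_lepP.
  apply/lem_lcms => l; have [<-|ne] := eqVneq i l; first by rewrite dfwith_in lepm_refl.
  by rewrite dfwith_out //; apply/mnm_lepP => q; rewrite mnm0E.
by have := le_lcms (@dfwith 'I_r (fun=> 'X_{1..n}) (fun=> 0%MM) i u) i; rewrite dfwith_in.
Qed.

Lemma incl_gen_bihomog i (a : gen (F i)) l :
  is_bihomog (@dfwith _ (fun=> nat) (fun=> 0%N) i (hdeg a) l)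
     (@dfwith _ (fun=> 'X_{1..n}) (fun=> 0%MM) i (multideg a) l)
     (@dfwith _ (fun l => elem (F l)) (fun l => one_elt (F l)) i << a >> l).
Proof. exact: (dfwith_bihomog one_bihomog (@bihomog_basis _ _ _ a)). Qed.
Arguments incl_gen_bihomog i a l : clear implicits.

Lemma incl_linear i : linear (@incl i).
Proof. exact: fglift_linear. Qed.

Lemma incl_bihomog i d m (x : elem (F i)) : is_bihomog d m x -> @is_bihomog _ _ (taylor F) d m (incl x).
Proof.
move=> hx; rewrite -[m]addm0; apply: fglift_bihomog hx => a ha; rewrite addm0.
have := star_bihomog (incl_gen_bihomog i a).
by rewrite sum_dfwith0 lcms_dfwith0 ha.
Qed.

Lemma vincl_linear i c (x y : vring (HF i)) : vincl (c *: x + y) = c *: vincl x + vincl y.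
Proof. exact: tens_linear. Qed.

Lemma ev_incl i (x : elem (F i)) : @ev _ _ (taylor F) (incl x) = vincl (ev x).
Proof.
elim/freeg_ind: x => [|c a x IHx].
  rewrite (lin0 (@incl_linear i)) !ev0 /vincl (@rtens0 _ _ _ _ _ _ i) ?dfwith_in //.
rewrite incl_linear evD evZ IHx evD evZ [RHS]vincl_linear; congr (_ *: _ + _).
rewrite {1}/taylor_incl fglift_basis ev_star => [|l].
  by rewrite dfwith_ev.
exact: bihomog_mhomog (incl_gen_bihomog i a l).
Qed.

Lemma vincl_hom_slots i d (x : vring (HF i)) : hom d x ->
  forall l, hom (@dfwith _ (fun=> nat) (fun=> 0%N) i d l) (upd (fun=> 1) i x l).
Proof.
move=> hx l; have [e|ne] := eqVneq i l; first by case: _ / e; rewrite !dfwith_in.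
by rewrite !dfwith_out //; apply: hom1.
Qed.

Lemma vincl_diff i d (x : vring (HF i)) : hom d x -> vdiff (vincl x) = vincl (vdiff x).
Proof.
move=> /vincl_hom_slots hx; rewrite [LHS](vdiff_tens HF hx) (bigD1 i) //= big1 => [|l ne].
  rewrite addr0 dfwith_in upd_upd /before big1 ?expr0 ?scale1r // => l lt.
  by rewrite dfwith_out // -val_eqE neq_ltn /= lt orbT.
rewrite (@tens0 _ _ _ _ _ l) ?scaler0 // upd_in dfwith_out 1?eq_sym //.
by apply: (vdiff_bottom (dg_pre (HF l))); apply: hom1.
Qed.

(** No sign arises, since both degree families are concentrated in slot i and no factor passes
    another slot of nonzero degree. *)
Lemma vincl_mul i d d' (x y : vring (HF i)) : hom d x -> hom d' y ->
  vincl x * vincl y = vincl (x * y).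
Proof.
move=> /vincl_hom_slots hx /vincl_hom_slots hy; rewrite (rtens_mul hx hy).
have -> : crossing (@dfwith _ (fun=> nat) (fun=> 0%N) i d)
    (@dfwith _ (fun=> nat) (fun=> 0%N) i d') = 0%N.
  rewrite /crossing big1 // => l _; have [<-|ne] := eqVneq i l; last by rewrite dfwith_out.
  by rewrite big1 ?muln0 // => l' lt; rewrite dfwith_out // -val_eqE neq_ltn lt.
rewrite scale1r; congr rtens; apply/esym/rupd_eq; first by rewrite !dfwith_in.
by move=> l ne; rewrite !dfwith_out // mulr1.
Qed.

Lemma incl_dgMap i : is_dgMap (@incl i).
Proof.
have H := HF i.
split.
- exact: incl_linear.
- by move=> d m x; apply: incl_bihomog.
- have dL := dg_diff_linear (HF i); have dL' := dg_diff_linear HT.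
  elim/freeg_ind => [|c a x IHx]; first by rewrite (lin0 dL) (lin0 (@incl_linear i)) (lin0 dL').
  rewrite dL !incl_linear dL' IHx; congr (_ *: _ + _).
  have ba := @bihomog_basis _ _ _ a.
  apply: (bihomog_inj (incl_bihomog (diff_bihomog_pred (dg_pre H) ba))
     (diff_bihomog_pred (dg_pre HT) (incl_bihomog ba))).
  rewrite ev_incl (ev_diff (dg_pre HT)) ev_incl (ev_diff (dg_pre H)) ev_basis.
  by rewrite (vincl_diff (hom_basis (a := a))).
- have mL := dg_mul_linearl H; have mR := dg_mul_linearr H.
  have mL' := dg_mul_linearl HT; have mR' := dg_mul_linearr HT.
  have iL := @incl_linear i.
  move=> x y; apply: (@basis_ind2 _ _ _ _ (fun x y => incl (mul x y))
    (fun x y => mul (incl x : elem (taylor F)) (incl y)) (fun=> True)) => //.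
  + by move=> u c w z; rewrite mR iL.
  + by move=> u c w z; rewrite mL iL.
  + by move=> u c w z; rewrite iL mR'.
  + by move=> u c w z; rewrite iL mL'.
  move=> a b _; have ba := @bihomog_basis _ _ _ a; have bb := @bihomog_basis _ _ _ b.
  apply: (bihomog_inj (incl_bihomog (dg_mul_bihomog H ba bb))
     (dg_mul_bihomog HT (incl_bihomog ba) (incl_bihomog bb))).
  rewrite ev_incl (ev_mul (dg_pre HT)) !ev_incl (ev_mul (dg_pre H)) !ev_basis.
  exact/esym/(vincl_mul (hom_basis (a := a)) (hom_basis (a := b))).
apply: (bihomog_inj (incl_bihomog (dg_one_bihomog H)) (dg_one_bihomog HT)).
rewrite ev_incl [RHS]vone_taylor // /vincl; congr tens.
exact: rupd_eq.
Qed.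

End TaylorInclusions.

(** * The structure on the Taylor resolution, its formula and its uniqueness *)

Section TaylorDividedPowers.
Variables (k : fieldType) (n r : nat) (F : 'I_r -> dgData k n).
Local Notation elem A := {freeg (gen A) / {mpoly k[n]}}.
Variable g : forall i, elem (F i) -> nat -> elem (F i).
Hypothesis hg : forall i, is_dgGamma (@g i).
Local Notation HF := (fun i => gamma_dg (hg i)).
Local Notation R := (fun i : 'I_r => vring (HF i)).
Local Notation upd f i x := (@dfwith _ R f i x).
Local Notation HT := (taylor_dg HF).
Local Notation W := (vring HT).
Local Notation incl i := (@taylor_incl k n r F i).
Implicit Types (b : tgen F).

Definition slot_powers (i : 'I_r) : vring (HF i) -> nat -> vring (HF i) := vgam (@g i).

Lemma slot_vGamma i : vGamma (@slot_powers i).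
Proof. exact: vgam_vGamma. Qed.

Definition taylor_gamma : elem (taylor F) -> nat -> elem (taylor F) :=
  hgam (H := HT) (expW slot_powers).

Lemma taylor_gammaP : is_dgGamma taylor_gamma.
Proof. exact: hgam_dgGamma (taylor_vGamma slot_vGamma). Qed.

Lemma ev_taylor_gamma x j : ev (taylor_gamma x j) = expW slot_powers (ev x) j.
Proof. exact: ev_hgam. Qed.

Lemma taylor_gamma_powers : taylor_powers g taylor_gamma.
Proof.
move=> d m f e hf pos evd le2.
have hv i : hom (d i) (ev (f i)) := bnd_hom (bihomog_bnd (hf i)).
have [pO pE] := expW_rtens slot_vGamma hv pos evd.
have GE : taylor_gamma (star m f) e =
    hmg (lcms m *+ e)%MM (expW slot_powers (rtens (fun i => ev (f i) : vring (HF i))) e).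
  rewrite /taylor_gamma (hgamE (taylor_vGamma slot_vGamma) e (star_bihomog hf)).
  by rewrite ev_star // => i; apply: bihomog_mhomog (hf i).
split=> [[l odl]|j de dj _].
  rewrite GE pO; last by exists l.
  by case: e le2 {GE} => [|[|e]] // _; rewrite hmg0.
have h i : @is_bihomog _ _ (F i) (e * d i) (m i *+ e)%MM
     (@dfwith _ (fun i => elem (F i)) (fun i => dgexp (f i) e) j (g (f j) e) i).
  have [eij|ne] := eqVneq j i.
    case: _ / eij; rewrite dfwith_in; exact: (gamma_bihomog (hg j)).
  by rewrite dfwith_out //; apply: (dgexp_bihomog (HF i)).
rewrite GE (pE j) // starE => [|i]; last exact: bihomog_mhomog (h i).
rewrite lcms_muln dfwith_ev; congr hmg; congr rtens; apply: rupd_eq => [|l ne].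
  by rewrite dfwith_in (ev_gamma (HF j) (hg j) e (hf j)).
by rewrite dfwith_out // (ev_dgexp (HF l)).
Qed.

Lemma star_basis b : star (fun i => multideg (b i)) (fun i => << b i >> : elem (F i)) = << b >>.
Proof.
have hb i : @is_bihomog _ _ (F i) (hdeg (b i)) (multideg (b i)) << b i >>.
  exact: bihomog_basis.
apply: (bihomog_inj (star_bihomog hb) (@bihomog_basis _ _ (taylor F) b)).
rewrite ev_star => [|i]; last exact: bihomog_mhomog (hb i).
rewrite (@ev_basis _ _ (taylor F)) -tens_basis; congr tens.
by apply: functional_extensionality_dep => i; rewrite ev_basis.
Qed.

Lemma taylor_powers_basis G b j : taylor_powers g G ->
  (0 < thdeg b)%N -> ~~ odd (thdeg b) -> (2 <= j)%N ->
  G << b >> j = taylor_gamma << b >> j.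
Proof.
move=> GP pos evd le2.
have hb i : @is_bihomog _ _ (F i) (hdeg (b i)) (multideg (b i)) << b i >>.
  exact: bihomog_basis.
have [GO GE] := GP _ _ _ j hb pos evd le2.
have [TO TE] := taylor_gamma_powers hb pos evd le2.
rewrite -star_basis; have [l odl|all_even] := pickP (fun l => odd (hdeg (b l))).
  by rewrite GO ?TO //; exists l.
have de l : ~~ odd (hdeg (b l)) by have /negbT := all_even l.
have [i di] := thdeg_gt0 pos.
(* [taylor_powers] speaks only of the first slot of positive degree, so the least index is
   selected. *)
case: (@arg_minnP _ i (fun i => (0 < hdeg (b i))%N) (fun i => nat_of_ord i) di) => l dl lmin.
have dmin (i' : 'I_r) : (i' < l)%N -> hdeg (b i') = 0%N.
  by apply: contraTeq; rewrite -lt0n -leqNgt; apply: lmin.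
by rewrite (GE l) // (TE l).
Qed.

(** The image is a pure tensor in which i is the only slot of positive degree; the formula puts the
    divided power there, and the other slots are powers of 1. *)
Lemma taylor_incl_gamma i : is_gammaMap (@g i) taylor_gamma (incl i).
Proof.
split=> [|d m x j hx d0 de]; first exact: (incl_dgMap HF).
apply: (bihomog_inj (incl_bihomog HF (gamma_bihomog (hg i) hx d0 de))
  (gamma_bihomog taylor_gammaP (incl_bihomog HF hx) d0 de)).
rewrite ev_taylor_gamma !(ev_incl HF) (ev_gamma (HF i) (hg i) j hx) //.
have hv := @vincl_hom_slots _ _ _ _ HF i d (ev x) (bnd_hom (bihomog_bnd hx)).
have := expW_rtens slot_vGamma hv; rewrite sum_dfwith0 => /(_ d0 de) [_ pE].
rewrite [RHS](_ : _ = expW slot_powers (rtens (upd (fun=> 1) i (ev x))) j) // (pE i).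
- congr rtens; apply/esym/rupd_eq; first by rewrite !dfwith_in.
  by move=> l ne; rewrite !dfwith_out // expr1n.
- move=> l; have [<-|ne] := eqVneq i l; first by rewrite dfwith_in.
  by rewrite dfwith_out.
- by rewrite dfwith_in.
Qed.

(* b is, up to sign, the product of an element supported away from slot l with
   the image of the l-th component of b; both have odd degree if that component
   has. *)
Lemma gammaMap_unique G G' : is_dgGamma G -> is_dgGamma G' ->
  (forall i, is_gammaMap (@g i) G (incl i)) -> (forall i, is_gammaMap (@g i) G' (incl i)) ->
  gamma_eq G' G.
Proof.
move=> GP GP' GI GI'; apply: (dgGamma_ext (H := HT) GP' GP) => b j; rewrite -[hdeg b]/(thdeg b) => pos evd le2.
have hb := basisf_hom HF b; have vP := vgam_vGamma HT GP; have vP' := vgam_vGamma HT GP'.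
have [l hl] : exists l, odd (hdeg (b l)) \/ (0 < hdeg (b l))%N /\ forall i, ~~ odd (hdeg (b i)).
  have [l odl|all_even] := pickP (fun l => odd (hdeg (b l))); first by exists l; left.
  have de l : ~~ odd (hdeg (b l)) by have /negbT := all_even l.
  by have [i di] := thdeg_gt0 pos; exists i; right.
pose d' := @dfwith _ (fun=> nat) (fun i => hdeg (b i)) l 0%N.
pose f' := upd (basisf HF b) l 1.
have hf' i : hom (d' i) (f' i).
  rewrite /d' /f'; have [e|ne] := eqVneq l i; last by rewrite !dfwith_out.
  by case: _ / e; rewrite !dfwith_in; apply: hom1.
have hbl := @vincl_hom_slots _ _ _ _ HF l _ _ (hb l).
have hy : hom (hdeg (b l)) (vincl (basisf HF b l)).
  have := rtens_hom hbl; rewrite sum_dfwith0; exact.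
have hd : (\sum_(i < r) d' i + hdeg (b l) = thdeg b)%N.
  by rewrite /d' (sum_dfwith (fun i => hdeg (b i)) l 0) addn0.
(* The scalar is the Koszul sign of the product, which is its own inverse. *)
have [c bE] : exists c, << b >> = (c *: rtens f' : W) * vincl (basisf HF b l).
  pose s := crossing d' (@dfwith _ (fun=> nat) (fun=> 0%N) l (hdeg (b l))).
  exists ((-1) ^+ s); rewrite -vscalerAl (rtens_mul hf' hbl) -/s.
  rewrite scalerA signrr scale1r -(rtens_basis HF b); congr rtens.
  apply: functional_extensionality_dep => i; rewrite /f'.
  have [e|ne] := eqVneq l i; last by rewrite !dfwith_out // mulr1.
  by case: _ / e; rewrite !dfwith_in mul1r.
have hx : hom (\sum_(i < r) d' i) (c *: rtens f' : W) by apply: homZ; apply: rtens_hom.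
rewrite bE; case: hl => [odl|[dl de]].
  have od' : odd (\sum_(i < r) d' i) by move: evd; rewrite -hd oddD odl addbT negbK.
  by rewrite (vg_odd vP hx hy) // (vg_odd vP' hx hy).
have ed' : ~~ odd (\sum_(i < r) d' i).
  by move: evd; rewrite -hd oddD (negPf (de l)) addbF.
rewrite (vg_even vP hx hy) // (vg_even vP' hx hy) //; congr (_ * _).
have bl := @bihomog_basis _ _ (F l) (b l).
(* On the factor coming from slot l the value is forced, because the inclusion commutes with divided
   powers. *)
have vE G0 : is_dgGamma G0 -> (forall i, is_gammaMap (@g i) G0 (incl i)) ->
    vgam G0 (vincl (basisf HF b l)) j = vincl (ev (g << b l >> j) : vring (HF l)).
  move=> G0P G0I; have [_ /(_ _ _ _ j bl dl (de l)) e] := G0I l.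
  rewrite -(ev_incl HF) e (ev_gamma HT G0P j (incl_bihomog HF bl)) //.
  by rewrite (ev_incl HF) ev_basis.
by rewrite vE // vE.
Qed.

End TaylorDividedPowers.

Theorem theorem3p4 (k : fieldType) (n r : nat)
    (I : 'I_r -> {mpoly k[n]} -> Prop)
    (F : 'I_r -> dgData k n)
    (g : forall i, {freeg (gen (F i)) / {mpoly k[n]}} -> nat -> {freeg (gen (F i)) / {mpoly k[n]}})
    (hI : forall i, is_monomialIdeal (I i))
    (hg : forall i, is_dgGamma (g i))
    (hF : forall i, is_resolution (F i) (I i)) :
  exists G : {freeg (gen (taylor F)) / {mpoly k[n]}} -> nat -> {freeg (gen (taylor F)) / {mpoly k[n]}},
    [/\ is_dgGamma G,
        taylor_powers g G,
        (forall G', is_dgGamma G' -> taylor_powers g G' -> gamma_eq G' G),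
        (forall i, is_gammaMap (g i) G (@taylor_incl k n r F i))
      & (forall G', is_dgGamma G' ->
           (forall i, is_gammaMap (g i) G' (@taylor_incl k n r F i)) ->
           gamma_eq G' G)].
Proof.
exists (taylor_gamma hg); split.
- exact: taylor_gammaP.
- exact: taylor_gamma_powers.
(* The prescribed formulas cover basis tensors, and these determine the structure. *)
- move=> G' GP' tp'.
  apply: (dgGamma_ext (H := taylor_dg (fun i => gamma_dg (hg i))) GP' (taylor_gammaP hg)).
  move=> b j pos evd le2; rewrite !vgam_basis //; last exact: taylor_gammaP.
  by rewrite (taylor_powers_basis hg).
- exact: taylor_incl_gamma.
- move=> G' GP' GI'; apply: (gammaMap_unique hg (taylor_gammaP hg) GP') => //.
  exact: taylor_incl_gamma.
Qed.
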